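(* Let $\rho,\eta\in\mathbb{R}$, and let $L>-3/2$, $L\neq-1$ if $\eta\neq0$, and $L>-3/2$ if $\eta=0$. Then, for every such $\rho$ at which the left-hand side is defined (that is, $\rho$ is not a nonzero zero of $F_L(\eta,\cdot)$), $$\frac{F_{L+1}(\eta,\rho)}{F_{L}(\eta,\rho)}=\frac{L+1}{\sqrt{(L+1)^2+\eta^2}}\sum_{n\geq 1}\left[\frac{\rho}{x_{L,\eta,n}(x_{L,\eta,n}-\rho)}+\frac{\rho}{y_{L,\eta,n}(y_{L,\eta,n}-\rho)}\right],$$ where $x_{L,\eta,n}$ and $y_{L,\eta,n}$ are the $n$th positive and the $n$th negative zero of the Coulomb wave function $\rho\mapsto F_L(\eta,\rho)$.
   Context: For real $L,\eta$ the regular Coulomb wave function is $$F_{L}(\eta,\rho)=C_{L}(\eta)\,\rho^{L+1}e^{-\mathrm{i}\rho}\,{}_1F_1(L+1-\mathrm{i}\eta,2L+2;2\mathrm{i}\rho),\qquad C_L(\eta)=\frac{2^Le^{-\pi\eta/2}\left|\Gamma(L+1+\mathrm{i}\eta)\right|}{\Gamma(2L+2)},$$ where ${}_1F_1$ is the Kummer confluent hypergeometric function. The function $\rho\mapsto e^{-\mathrm{i}\rho}\,{}_1F_1(L+1-\mathrm{i}\eta,2L+2;2\mathrm{i}\rho)$ is entire and real on the real axis; the nonzero zeros of $F_L(\eta,\cdot)$ are the zeros of this entire function. The positive zeros are enumerated increasingly, $0<x_{L,\eta,1}<x_{L,\eta,2}<\cdots$, and the negative zeros by increasing absolute value, $0>y_{L,\eta,1}>y_{L,\eta,2}>\cdots$.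 In the ratio $F_{L+1}/F_L$ the powers are simplified as $\rho^{L+2}/\rho^{L+1}=\rho$, so that the ratio is defined also for $\rho\le 0$. When $\eta=0$ and $L=-1$, where the printed expressions are indeterminate, $F_L(0,\rho)$ and the factor $(L+1)/\sqrt{(L+1)^2+\eta^2}$ are read as limits as $L\downarrow-1$, i.e. $F_{-1}(0,\rho)=\cos\rho$ and the factor equals $1$. *)

(* Defs.v *)
From Stdlib Require Import Reals Lra Factorial.
From Coquelicot Require Import Coquelicot.

Open Scope R_scope.

(** * Complex limits, series and elementary functions *)

(** Limits in [C] are taken componentwise; as for [Lim_seq] and [Series], the
    value is meaningful only when the sequence (resp. series) converges. *)
Definition CLim_seq (u : nat -> C) : C :=
  (real (Lim_seq (fun n => Re (u n))), real (Lim_seq (fun n => Im (u n)))).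

Definition CSeries (a : nat -> C) : C :=
  (Series (fun n => Re (a n)), Series (fun n => Im (a n))).

Definition Cexp (z : C) : C :=
  (exp (Re z) * cos (Im z), exp (Re z) * sin (Im z)).

Fixpoint Cpochhammer (a : C) (n : nat) : C :=
  match n with
  | O => RtoC 1
  | S m => (Cpochhammer a m * (a + RtoC (INR m)))%C
  end.

(** The Gamma function on [C] minus the nonpositive integers, by Euler's (Gauss's)
    limit [n! n^z / (z (z+1) ... (z+n))], with [n^z = exp (z ln n)]. *)
Definition CGamma (z : C) : C :=
  CLim_seq (fun n =>
    (RtoC (INR (fact n)) * Cexp (z * RtoC (ln (INR n))) / Cpochhammer z (S n))%C).

(** Kummer's function [1F1(a, b; z)], for [b] not a nonpositive integer. *)
Definition Kummer_1F1 (a b z : C) : C :=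
  CSeries (fun n =>
    (Cpochhammer a n / Cpochhammer b n * (z ^ n / RtoC (INR (fact n))))%C).

(** * Coulomb wave functions *)

(** The parameters at which the formulas below are indeterminate and have to be
    read as limits as [L] decreases to [-1]. *)
Definition limit_case (L eta : R) : {L = -1 /\ eta = 0} + {~ (L = -1 /\ eta = 0)} :=
  match Req_EM_T L (-1), Req_EM_T eta 0 with
  | left p, left q => left (conj p q)
  | right p, _ => right (fun h => p (proj1 h))
  | _, right q => right (fun h => q (proj2 h))
  end.

Definition coulomb_C (L eta : R) : C :=
  if limit_case L eta then RtoC 1 else
    (RtoC (Rpower 2 L * exp (- PI * eta / 2)
           * Cmod (CGamma (RtoC (L + 1) + Ci * RtoC eta)))
     / CGamma (RtoC (2 * L + 2)))%C.

(** The entire factor [e^(-i rho) 1F1(L+1-i eta, 2L+2; 2 i rho)], at real [rho]. *)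
Definition coulomb_entire (L eta rho : R) : C :=
  if limit_case L eta then RtoC (cos rho) else
    (Cexp (- (Ci * RtoC rho))
     * Kummer_1F1 (RtoC (L + 1) - Ci * RtoC eta) (RtoC (2 * L + 2))
                  (RtoC 2 * Ci * RtoC rho))%C.

(** [F_L(eta, rho)]; only the values at [rho > 0] are meaningful, because
    [Rpower rho (L + 1)] is the real power only there. *)
Definition coulomb_F (L eta rho : R) : C :=
  (coulomb_C L eta * RtoC (Rpower rho (L + 1)) * coulomb_entire L eta rho)%C.

(** [F_(L+1)(eta, rho) / F_L(eta, rho)] for all real [rho], with
    [rho^(L+2) / rho^(L+1)] simplified to [rho]. *)
Definition coulomb_ratio (L eta rho : R) : C :=
  (coulomb_C (L + 1) eta * RtoC rho * coulomb_entire (L + 1) eta rho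
   / (coulomb_C L eta * coulomb_entire L eta rho))%C.

Lemma coulomb_ratio_pos (L eta rho : R) :
  0 < rho -> coulomb_C L eta <> RtoC 0 -> coulomb_entire L eta rho <> RtoC 0 ->
  coulomb_ratio L eta rho = (coulomb_F (L + 1) eta rho / coulomb_F L eta rho)%C.
Proof.
intros hrho hC hE; unfold coulomb_ratio, coulomb_F.
rewrite (Rpower_plus (L + 1) 1), Rpower_1, RtoC_mult by exact hrho.
assert (hp : RtoC (Rpower rho (L + 1)) <> RtoC 0).
{ intros h; apply RtoC_inj in h; unfold Rpower in h.
  pose proof (exp_pos ((L + 1) * ln rho)); lra. }
field; repeat split; assumption.
Qed.

(** The factor [(L+1) / sqrt ((L+1)^2 + eta^2)]. *)
Definition coulomb_factor (L eta : R) : R :=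
  if limit_case L eta then 1 else (L + 1) / sqrt ((L + 1) ^ 2 + eta ^ 2).

Definition nonzero_zero (L eta rho : R) : Prop :=
  rho <> 0 /\ coulomb_entire L eta rho = RtoC 0.

(** [x n], for [n >= 1], is the [n]-th positive zero of [F_L(eta, .)]; [x 0] is
    unconstrained. *)
Definition enumerates_positive_zeros (L eta : R) (x : nat -> R) : Prop :=
  (forall n m : nat, (1 <= n < m)%nat -> x n < x m) /\
  (forall r : R,
     (0 < r /\ nonzero_zero L eta r) <-> exists n : nat, (1 <= n)%nat /\ x n = r).

(** [y n], for [n >= 1], is the [n]-th negative zero of [F_L(eta, .)] in order of
    increasing absolute value; [y 0] is unconstrained. *)
Definition enumerates_negative_zeros (L eta : R) (y : nat -> R) : Prop :=
  (forall n m : nat, (1 <= n < m)%nat -> y m < y n) /\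
  (forall r : R,
     (r < 0 /\ nonzero_zero L eta r) <-> exists n : nat, (1 <= n)%nat /\ y n = r).

(* Main.v *)
Require Import Defs.
From Stdlib Require Import Reals Lra Lia Arith List Factorial FunctionalExtensionality.
From Coquelicot Require Import Coquelicot.

Open Scope R_scope.

(** Write [phi_n] for the entire factor of the Coulomb wave function with parameter [L + n], with
    real Taylor coefficients.  Two relations between neighbours carry the proof:
    [phi_0' = e phi_0 - kappa x phi_1] and the three-term recurrence
    [phi_n = (1 + b_n x) phi_(n+1) - a_n x^2 phi_(n+2)], where [a_n > 0] because [L > -3/2].
    The first identifies the left-hand side of the theorem, up to its constant factor, with
    [kappa x phi_1 / phi_0], the logarithmic derivative of [phi_0] with its sign changed and made
    to vanish at the origin; the claim is therefore the Hadamard factorization of [phi_0],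
    including the reality of its zeros and the absence of a factor [exp(- m x^2)].

    The recurrence turns this into the spectral theorem for one Jacobi operator [J], symmetric
    for the weights [d_n = a_0 ... a_(n-1)].  The vector [psi x = (x^n phi_(n+1)(x))_n] satisfies
    [J (psi x) = psi x / x - (phi_0(x) / x) e_0] ([jacobi_psi]), so that every real zero [c] of
    [phi_0] gives an eigenvector [psi c] with eigenvalue [1 / c] and squared norm
    [kappa c^2 phi_1(c)^2] ([norm_psi_at_zero]).  Expanding the component [phi_1(rho)] of
    [psi rho] along [e_0] in these eigenvectors, by means of [christoffel_darboux], gives the
    partial fractions of the theorem, provided that [e_0] lies in the closed span of the
    eigenvectors.

    This completeness is proved without complex analysis.  Let [residual X] be the inner product
    of the components orthogonal to the eigenvectors with zeros in a finite list [X]; it is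
    nonnegative by Bessel's inequality ([bessel]), and [J] is symmetric for it.  The numbers
    [s_n = residual X (J^n e_0) e_0] are the Taylor coefficients of [phi_1 / phi_0] minus
    finitely many simple fractions, that is, of a quotient of entire functions, whose denominator
    vanishes on the real line only at the zeros not in [X] ([moment_off_quotient]).  By the Cauchy-Schwarz
    inequality the even ones are log-convex, so their ratios converge, and the square root of the
    limit or its opposite has to be a zero of the denominator ([log_convex_ratio_zero],
    [even_moment_ratio_zero]).  Hence [residual X (J e_0) (J e_0)] is at most the inverse of the
    smallest [c^2] among the remaining zeros ([residual_gap]), and tends to [0] as [X] exhausts
    the zeros; the same follows for [J e_n] for all [n].

    What could still be missed is a part of [e_0] in the kernel of [J], the spectral form of the
    Gaussian factor.  It is excluded by comparing the Hilbert-Schmidt norm of [J], whose square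
    is [sum (b_n^2 + 2 a_n) = kappa] by the telescoping identity [kappa_diff], with the sum of the
    squares [1 / c^2] of the eigenvalues: the two agree, which leaves nothing of [e_0]
    ([trace_inequality], [residual_basis_0_lim]).

    It remains to see that the definitions through Kummer's function and the Gamma function yield
    [phi] and the right constants ([coulomb_entire_phi], [coulomb_C_succ]). *)

(** * Everywhere convergent power series *)

(** Boundedness of all the [a_n r^n] is equivalent to an infinite radius of convergence and
    easier to establish. *)
Definition entire (a : nat -> R) : Prop :=
  forall r : R, exists M : R, forall n : nat, Rabs (a n * r ^ n) <= M.

Lemma entire_CV_radius (a : nat -> R) : entire a -> CV_radius a = p_infty.
Proof.
intros ha.
destruct (CV_radius_bounded a) as [hub _].
destruct (CV_radius a) as [r| |] eqn:E; trivial.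
- specialize (hub (r + 1) (ha (r + 1))); simpl in hub; lra.
- specialize (hub 0 (ha 0)); simpl in hub; tauto.
Qed.

Lemma entire_lt_radius (a : nat -> R) (x : R) :
  entire a -> Rbar_lt (Rabs x) (CV_radius a).
Proof. intros ha; rewrite (entire_CV_radius a ha); exact I. Qed.

Lemma entire_ex_pseries (a : nat -> R) (x : R) : entire a -> ex_pseries a x.
Proof. intros ha; apply CV_radius_inside, entire_lt_radius, ha. Qed.

Lemma entire_ex_series (a : nat -> R) (x : R) :
  entire a -> ex_series (fun n => a n * x ^ n).
Proof. intros ha; apply ex_pseries_R, entire_ex_pseries, ha. Qed.

Lemma entire_ex_series_abs (a : nat -> R) (x : R) :
  entire a -> ex_series (fun n => Rabs (a n * x ^ n)).
Proof. intros ha; apply CV_disk_inside, entire_lt_radius, ha. Qed.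

Lemma ex_series_bounded (a : nat -> R) :
  ex_series a -> exists M, forall n, Rabs (a n) <= M.
Proof.
intros ha; apply ex_series_lim_0 in ha.
destruct (filterlim_bounded a) as [M hM].
- exists 0; exact ha.
- exists M; exact hM.
Qed.

Lemma ex_pseries_entire (a : nat -> R) : (forall x, ex_pseries a x) -> entire a.
Proof.
intros ha r; apply ex_series_bounded, ex_pseries_R, ha.
Qed.

Lemma entire_mult (a b : nat -> R) : entire a -> entire b -> entire (PS_mult a b).
Proof.
intros ha hb; apply ex_pseries_entire; intros x.
apply ex_pseries_mult; apply entire_lt_radius; assumption.
Qed.

Lemma entire_minus_scal (a b : nat -> R) (c : R) :
  entire a -> entire b -> entire (fun n => a n - c * b n).
Proof.
intros ha hb r; destruct (ha r) as [M hM], (hb r) as [N hN].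
exists (M + Rabs c * N); intros n.
replace ((a n - c * b n) * r ^ n) with (a n * r ^ n + - (c * (b n * r ^ n))) by ring.
eapply Rle_trans; [apply Rabs_triang|].
rewrite Rabs_Ropp, (Rabs_mult c).
apply Rplus_le_compat; [apply hM|apply Rmult_le_compat_l; [apply Rabs_pos|apply hN]].
Qed.

Lemma entire_alternate (a : nat -> R) : entire a -> entire (fun n => a n * (-1) ^ n).
Proof.
intros ha r; destruct (ha (- r)) as [M hM]; exists M; intros n.
replace (a n * (-1) ^ n * r ^ n) with (a n * (- r) ^ n); [apply hM|].
rewrite Rmult_assoc, <- Rpow_mult_distr; do 2 f_equal; ring.
Qed.

Lemma PSeries_alternate (a : nat -> R) (x : R) :
  PSeries (fun n => a n * (-1) ^ n) x = PSeries a (- x).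
Proof.
apply Series_ext; intros n.
rewrite Rmult_assoc, <- Rpow_mult_distr; do 2 f_equal; ring.
Qed.

Lemma entire_even_part (a : nat -> R) : entire a -> entire (fun n => a (2 * n)%nat).
Proof.
intros ha r; destruct (ha (sqrt (Rabs r))) as [M hM]; exists M; intros n.
specialize (hM (2 * n)%nat); rewrite pow_mult, pow2_sqrt in hM by apply Rabs_pos.
rewrite Rabs_mult in *; rewrite <- !RPow_abs in *; rewrite Rabs_Rabsolu in hM; exact hM.
Qed.

Lemma PSeries_minus_scal (a b : nat -> R) (c x : R) :
  entire a -> entire b ->
  PSeries (fun n => a n - c * b n) x = PSeries a x - c * PSeries b x.
Proof.
intros ha hb; unfold PSeries; rewrite <- Series_scal_l, <- Series_minus.
- apply Series_ext; intros n; ring.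
- apply entire_ex_series, ha.
- exact (@ex_series_scal_l R_AbsRing R_NormedModule c _ (entire_ex_series b x hb)).
Qed.

(** * Removing a zero of a power series *)

(** The coefficients of [(1 - x / c) h(x)]. *)
Definition lin_mult (c : R) (h : nat -> R) (n : nat) : R :=
  match n with O => h 0%nat | S m => h (S m) - h m / c end.

Lemma lin_mult_inj (c : R) (h k : nat -> R) :
  (forall n, lin_mult c h n = lin_mult c k n) -> forall n, h n = k n.
Proof.
intros H; induction n as [|n IH]; [exact (H 0%nat)|].
specialize (H (S n)); simpl in H; rewrite IH in H; lra.
Qed.

Lemma PSeries_lin_mult (c x : R) (h : nat -> R) :
  entire h -> PSeries (lin_mult c h) x = (1 - x / c) * PSeries h x.
Proof.
intros hh.
replace ((1 - x / c) * PSeries h x) with (PSeries h x + - / c * (x * PSeries h x))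
  by (unfold Rdiv; ring).
rewrite <- PSeries_incr_1, <- PSeries_scal, <- PSeries_plus.
- apply PSeries_ext; intros [|n]; unfold PS_plus, PS_scal, PS_incr_1, plus, scal; simpl;
    unfold mult; simpl; unfold zero; simpl; unfold Rdiv; ring.
- apply entire_ex_pseries, hh.
- apply ex_pseries_scal; [apply Rmult_comm|].
  apply ex_pseries_incr_1, entire_ex_pseries, hh.
Qed.

Lemma PS_mult_lin_mult (c : R) (h f : nat -> R) (n : nat) :
  PS_mult (lin_mult c h) f n = lin_mult c (PS_mult h f) n.
Proof.
destruct n as [|m]; [reflexivity|].
unfold lin_mult at 2, PS_mult.
rewrite !(decomp_sum _ (S m)) by lia; simpl pred.
replace (sum_f_R0 (fun k => h k * f (m - k)%nat) m / c)
  with (sum_f_R0 (fun k => h k * f (m - k)%nat * / c) m)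
  by (unfold Rdiv; rewrite <- scal_sum; ring).
unfold Rminus at 1; rewrite Rplus_assoc; f_equal.
fold (Rminus (sum_f_R0 (fun i => h (S i) * f (S m - S i)%nat) m)
             (sum_f_R0 (fun k => h k * f (m - k)%nat * / c) m)).
rewrite <- minus_sum; apply sum_eq; intros i _; simpl; unfold Rdiv; ring.
Qed.

Lemma PS_mult_geometric (c : R) (h : nat -> R) (n : nat) :
  PS_mult (lin_mult c h) (fun k => (/ c) ^ k) n = h n.
Proof.
rewrite PS_mult_lin_mult.
destruct n as [|m]; [unfold lin_mult, PS_mult; simpl; ring|].
unfold lin_mult, PS_mult; rewrite tech5.
replace (S m - S m)%nat with 0%nat by lia; rewrite pow_O.
rewrite (sum_eq _ (fun k => h k * (/ c) ^ (m - k) * / c)).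
- rewrite <- scal_sum; unfold Rdiv; ring.
- intros i hi; replace (S m - i)%nat with (S (m - i)) by lia; cbn [pow]; ring.
Qed.

Lemma PS_mult_minus_scal (h f g : nat -> R) (c : R) (n : nat) :
  PS_mult h (fun k => f k - c * g k) n = PS_mult h f n - c * PS_mult h g n.
Proof.
unfold PS_mult; rewrite scal_sum, <- minus_sum; apply sum_eq; intros; ring.
Qed.

(** The quotient by [1 - x / c] has the coefficients [c^(-n) sum_(k <= n) a_k c^k]; since the
    full sum is [0], the partial sum is minus a tail, which makes them small enough. *)
Lemma entire_remove_zero (a : nat -> R) (c : R) :
  entire a -> c <> 0 -> PSeries a c = 0 ->
  exists h, entire h /\ forall n, a n = lin_mult c h n.
Proof.
intros ha hc h0.
set (h := fun n => sum_f_R0 (fun k => a k * c ^ k) n / c ^ n).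
exists h; split.
- assert (htail : forall n, h n = - Series (fun k => a (S n + k)%nat * c ^ (S n + k)) / c ^ n).
  { intros n; unfold h; f_equal.
    pose proof (Series_incr_n (fun k => a k * c ^ k) (S n) ltac:(lia) (entire_ex_series a c ha)) as E.
    unfold PSeries in h0; rewrite h0 in E; simpl pred in E; lra. }
  intros r.
  (* for [T] above both [|r|] and [|c|], each term [|a_j| |c|^(j-n) |r|^n] of the tail is at most [|a_j| T^j] *)
  set (T := Rabs r + Rabs c).
  assert (hT : 0 < T) by (unfold T; pose proof (Rabs_pos r); pose proof (Rabs_pos_lt c hc); lra).
  exists (Series (fun k => Rabs (a k * T ^ k))); intros n.
  assert (exT : ex_series (fun k => Rabs (a k * T ^ k))) by (apply entire_ex_series_abs, ha).
  assert (exc : ex_series (fun k => Rabs (a k * c ^ k))) by (apply entire_ex_series_abs, ha).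
  rewrite Rabs_mult, htail; unfold Rdiv; rewrite Rabs_mult, Rabs_Ropp.
  apply Rle_trans with (Series (fun k => Rabs (a (S n + k)%nat * T ^ (S n + k)))).
  + assert (hcn : 0 < Rabs (c ^ n)) by (apply Rabs_pos_lt, pow_nonzero, hc).
    apply Rle_trans with
      (Series (fun k => Rabs (a (S n + k)%nat * c ^ (S n + k))) * Rabs (/ c ^ n) * Rabs (r ^ n)).
    { do 2 (apply Rmult_le_compat_r; [apply Rabs_pos|]).
      apply Series_Rabs, (ex_series_incr_n (fun k => Rabs (a k * c ^ k)) (S n)), exc. }
    rewrite <- !Series_scal_r.
    apply Series_le; [|apply (ex_series_incr_n (fun k => Rabs (a k * T ^ k)) (S n)), exT].
    intros k; split; [repeat apply Rmult_le_pos; apply Rabs_pos|].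
    rewrite !Rabs_mult, !Rmult_assoc; apply Rmult_le_compat_l; [apply Rabs_pos|].
    rewrite Rabs_inv.
    replace (S n + k)%nat with (n + S k)%nat by lia.
    rewrite !pow_add, !Rabs_mult.
    replace (Rabs (c ^ n) * Rabs (c ^ S k) * (/ Rabs (c ^ n) * Rabs (r ^ n)))
      with (Rabs (r ^ n) * Rabs (c ^ S k)) by (field; lra).
    rewrite <- !RPow_abs, (Rabs_pos_eq T) by lra.
    apply Rmult_le_compat; try (apply pow_le, Rabs_pos);
      apply pow_incr; split; try apply Rabs_pos; unfold T;
      pose proof (Rabs_pos r); pose proof (Rabs_pos c); lra.
  + rewrite (Series_incr_n (fun k => Rabs (a k * T ^ k)) (S n)) by (lia || exact exT).
    assert (0 <= sum_f_R0 (fun k => Rabs (a k * T ^ k)) (pred (S n)))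
      by (apply cond_pos_sum; intros; apply Rabs_pos).
    lra.
- intros [|n]; unfold lin_mult, h.
  + simpl; field.
  + rewrite tech5; cbn [pow]; field; split; [apply pow_nonzero|]; exact hc.
Qed.

(** * Cauchy products and limits of sums *)

Lemma PS_mult_S (a b : nat -> R) (n : nat) :
  PS_mult a b (S n) = a 0%nat * b (S n) + PS_mult (fun k => a (S k)) b n.
Proof. unfold PS_mult; rewrite decomp_sum by lia; reflexivity. Qed.

Lemma PS_mult_linear_l (a b c : nat -> R) (x : R) (n : nat) :
  PS_mult (fun k => x * a k + b k) c n = x * PS_mult a c n + PS_mult b c n.
Proof.
unfold PS_mult; rewrite scal_sum, <- plus_sum; apply sum_eq; intros; ring.
Qed.

Lemma PS_mult_assoc (a b c : nat -> R) (n : nat) :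
  PS_mult (PS_mult a b) c n = PS_mult a (PS_mult b c) n.
Proof.
revert a; induction n as [|n IH]; intros a; [unfold PS_mult; simpl; ring|].
rewrite (PS_mult_S (PS_mult a b)), (PS_mult_S a (PS_mult b c)).
rewrite (functional_extensionality
  (fun k => PS_mult a b (S k))
  (fun k => a 0%nat * b (S k) + PS_mult (fun i => a (S i)) b k)
  (fun k => PS_mult_S a b k)).
rewrite PS_mult_linear_l, IH, (PS_mult_S b c).
unfold PS_mult at 1; simpl; ring.
Qed.

Lemma sum_le_Series (a : nat -> R) (n : nat) :
  (forall k, 0 <= a k) -> ex_series a -> sum_f_R0 a n <= Series a.
Proof.
intros h0 ha.
rewrite <- sum_n_Reals.
apply (is_lim_seq_incr_compare (sum_n a) (Series a)).
- exact (Series_correct a ha).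
- intros k; rewrite sum_Sn; unfold plus; simpl; specialize (h0 (S k)); lra.
Qed.

Lemma is_lim_seq_tail (a : nat -> R) :
  ex_series a -> is_lim_seq (fun n => Series (fun k => a (S n + k)%nat)) 0.
Proof.
intros ha.
apply is_lim_seq_ext with (fun n => Series a - sum_n a n).
- intros n; rewrite (Series_incr_n a (S n)) by (lia || exact ha).
  rewrite sum_n_Reals; simpl pred; ring.
- replace (Finite 0) with (Finite (Series a - Series a)) by (f_equal; ring).
  apply is_lim_seq_minus'; [apply is_lim_seq_const|exact (Series_correct a ha)].
Qed.

Lemma is_lim_seq_inv_INR : is_lim_seq (fun n => / INR n) 0.
Proof.
replace (Finite 0) with (Rbar_inv p_infty) by reflexivity.
apply is_lim_seq_inv; [apply is_lim_seq_INR|discriminate].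
Qed.

Lemma is_lim_seq_sum (F : nat -> nat -> R) (l : nat -> R) (J : nat) :
  (forall j, (j <= J)%nat -> is_lim_seq (F j) (l j)) ->
  is_lim_seq (fun n => sum_f_R0 (fun j => F j n) J) (sum_f_R0 l J).
Proof.
induction J as [|J IH]; intros hF; simpl; [apply hF; lia|].
apply is_lim_seq_plus'; [apply IH; intros; apply hF; lia|apply hF; lia].
Qed.

(** * Moments of a meromorphic function *)

(** The ratios [s_n / s_(n+1)] of a log-convex sequence decrease to some [l];
    dividing [H_n = sum_j P_j s_(n-j)] by [s_n] and letting [n] grow turns the
    right-hand side into [P(l)], while the left-hand side vanishes because the
    [H_n] decay faster than any geometric sequence and the [s_n] do not. *)
Lemma log_convex_ratio_zero (s P H : nat -> R) :
  (forall n, 0 < s n) ->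
  (forall n, s (S n) ^ 2 <= s n * s (S (S n))) ->
  entire P -> entire H -> (forall n, H n = PS_mult P s n) ->
  exists l, 0 <= l <= s 0%nat / s 1%nat /\ PSeries P l = 0.
Proof.
intros hs hconv hP hH HE.
set (q := fun n => s n / s (S n)).
assert (hq : forall n, 0 < q n) by (intros; apply Rdiv_lt_0_compat; apply hs).
assert (hdec : forall n, q (S n) <= q n).
{ intros n; unfold q.
  pose proof (hs n); pose proof (hs (S n)); pose proof (hs (S (S n))); specialize (hconv n).
  apply Rmult_le_reg_r with (s (S n) * s (S (S n))); [apply Rmult_lt_0_compat; lra|].
  replace (s (S n) / s (S (S n)) * (s (S n) * s (S (S n)))) with (s (S n) ^ 2) by (field; lra).
  replace (s n / s (S n) * (s (S n) * s (S (S n)))) with (s n * s (S (S n))) by (field; lra).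
  exact hconv. }
destruct (ex_finite_lim_seq_decr q 0 hdec (fun n => Rlt_le _ _ (hq n))) as [l hl].
assert (hq0 : forall n, q n <= q 0%nat).
{ induction n as [|n IH]; [lra|specialize (hdec n); lra]. }
assert (hl0 : 0 <= l).
{ apply (is_lim_seq_le (fun _ => 0) q 0 l); [intros; apply Rlt_le, hq|apply is_lim_seq_const|exact hl]. }
exists l; split; [split; [exact hl0|]|].
{ apply (is_lim_seq_le q (fun _ => q 0%nat) l (q 0%nat)); [exact hq0|exact hl|apply is_lim_seq_const]. }
set (q0 := q 0%nat) in *.
assert (hq0p : 0 < q0) by apply hq.
assert (hrat : forall j n, s n / s (n + S j)%nat = s n / s (n + j)%nat * q (n + j)%nat).
{ intros j n; replace (n + S j)%nat with (S (n + j)) by lia; unfold q.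
  pose proof (hs (n + j)%nat); pose proof (hs (S (n + j))); field; lra. }
assert (hbd : forall j n, 0 < s n / s (n + j)%nat <= q0 ^ j).
{ induction j as [|j IH]; intros n.
  - replace (n + 0)%nat with n by lia; simpl; unfold Rdiv; rewrite Rinv_r by (specialize (hs n); lra); lra.
  - rewrite hrat; specialize (IH n); specialize (hq (n + j)%nat); specialize (hq0 (n + j)%nat).
    split; [apply Rmult_lt_0_compat; lra|].
    simpl; rewrite (Rmult_comm q0); apply Rmult_le_compat; lra. }
assert (hlim : forall j, is_lim_seq (fun n => s n / s (n + j)%nat) (l ^ j)).
{ induction j as [|j IH].
  - apply is_lim_seq_ext with (fun _ => 1); [|apply is_lim_seq_const].
    intros n; replace (n + 0)%nat with n by lia; field; specialize (hs n); lra.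
  - apply is_lim_seq_ext with (fun n => s n / s (n + j)%nat * q (n + j)%nat);
      [intros; symmetry; apply hrat|].
    simpl; rewrite (Rmult_comm l).
    apply is_lim_seq_mult'; [exact IH|apply (is_lim_seq_incr_n q j); exact hl]. }
(* [s_n >= s_0 / q_0^n], while the coefficients of [H] beat any geometric sequence *)
assert (hH0 : is_lim_seq (fun n => H n / s n) 0).
{ apply is_lim_seq_abs_0.
  apply is_lim_seq_le_le with (fun _ => 0) (fun n => / s 0%nat * Rabs (H n * q0 ^ n)).
  - intros n; split; [apply Rabs_pos|].
    pose proof (hbd n 0%nat) as hb; change (0 + n)%nat with n in hb.
    unfold Rdiv; rewrite !Rabs_mult, Rabs_inv, (Rabs_pos_eq (s n)) by apply Rlt_le, hs.
    rewrite (Rabs_pos_eq (q0 ^ n)) by (apply pow_le; lra).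
    replace (/ s 0%nat * (Rabs (H n) * q0 ^ n)) with (Rabs (H n) * (/ s 0%nat * q0 ^ n)) by ring.
    apply Rmult_le_compat_l; [apply Rabs_pos|].
    replace (/ s n) with (/ s 0%nat * (s 0%nat / s n))
      by (pose proof (hs 0%nat); pose proof (hs n); field; lra).
    apply Rmult_le_compat_l; [apply Rlt_le, Rinv_0_lt_compat, hs|lra].
  - apply is_lim_seq_const.
  - replace (Finite 0) with (Rbar_mult (/ s 0%nat) 0) by (simpl; f_equal; ring).
    apply is_lim_seq_scal_l.
    apply ex_series_lim_0, entire_ex_series_abs, hH. }
assert (exP : ex_series (fun k => Rabs (P k * q0 ^ k))) by apply entire_ex_series_abs, hP.
set (T := fun J => Series (fun k => Rabs (P (S J + k)%nat * q0 ^ (S J + k)))).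
(* [H_(m+J) / s_(m+J)] with the terms [j > J] bounded by the tail [T J] *)
assert (hmain : forall J m, Rabs (sum_f_R0 (fun j => P j * (s (m + (J - j))%nat / s (m + J)%nat)) J
                      - H (m + J)%nat / s (m + J)%nat) <= T J).
{ intros J m.
  assert (E : H (m + J)%nat / s (m + J)%nat
              = sum_f_R0 (fun j => P j * (s (m + J - j)%nat / s (m + J)%nat)) (m + J)).
  { rewrite HE; unfold PS_mult, Rdiv; rewrite Rmult_comm, scal_sum.
    apply sum_eq; intros; ring. }
  rewrite E; clear E.
  rewrite (sum_eq (fun j => P j * (s (m + (J - j))%nat / s (m + J)%nat))
             (fun j => P j * (s (m + J - j)%nat / s (m + J)%nat)) J)
    by (intros i hi; do 3 f_equal; lia).
  destruct m as [|m].
  - simpl plus; unfold Rminus; rewrite Rplus_opp_r, Rabs_R0.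
    apply Rle_trans with (sum_f_R0 (fun k => Rabs (P (S J + k)%nat * q0 ^ (S J + k))) 0);
      [apply cond_pos_sum; intros; apply Rabs_pos|].
    apply sum_le_Series; [intros; apply Rabs_pos|].
    apply (ex_series_incr_n (fun k => Rabs (P k * q0 ^ k)) (S J)), exP.
  - rewrite (tech2 _ J (S m + J)) by lia.
    match goal with |- Rabs (?a - (?a + ?b)) <= _ => replace (a - (a + b)) with (- b) by ring end.
    rewrite Rabs_Ropp.
    eapply Rle_trans; [apply Rsum_abs|].
    eapply Rle_trans; [|apply sum_le_Series; [intros; apply Rabs_pos|]].
    2: { apply (ex_series_incr_n (fun k => Rabs (P k * q0 ^ k)) (S J)), exP. }
    apply sum_Rle; intros k hk.
    rewrite !Rabs_mult; apply Rmult_le_compat_l; [apply Rabs_pos|].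
    pose proof (hbd (S J + k)%nat (S m + J - (S J + k))%nat) as hb.
    replace (S m + J - (S J + k) + (S J + k))%nat with (S m + J)%nat in hb by lia.
    rewrite !Rabs_pos_eq; [lra|apply pow_le; lra|lra]. }
(* [m] tends to infinity with [J] fixed, and then [J] does *)
assert (hJ : forall J, Rabs (sum_f_R0 (fun j => P j * l ^ j) J) <= T J).
{ intros J.
  apply (is_lim_seq_le
    (fun m => Rabs (sum_f_R0 (fun j => P j * (s (m + (J - j))%nat / s (m + J)%nat)) J
                      - H (m + J)%nat / s (m + J)%nat)) (fun _ => T J)
     (Rabs (sum_f_R0 (fun j => P j * l ^ j) J)) (T J)); [apply hmain| |apply is_lim_seq_const].
  apply (is_lim_seq_abs _ (Finite _)).
  rewrite <- (Rminus_0_r (sum_f_R0 (fun j => P j * l ^ j) J)).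
  apply is_lim_seq_minus'; [|apply (is_lim_seq_incr_n (fun n => H n / s n) J); exact hH0].
  apply (is_lim_seq_sum (fun j m => P j * (s (m + (J - j))%nat / s (m + J)%nat))).
  intros j hj.
  apply is_lim_seq_mult'; [apply is_lim_seq_const|].
  apply is_lim_seq_ext with (fun m => (fun n => s n / s (n + j)%nat) (m + (J - j))%nat).
  { intros m; simpl; do 2 f_equal; lia. }
  apply (is_lim_seq_incr_n (fun n => s n / s (n + j)%nat) (J - j)), hlim. }
assert (hlast : Rabs (PSeries P l) <= 0).
{ apply (is_lim_seq_le (fun J => Rabs (sum_f_R0 (fun j => P j * l ^ j) J)) T
           (Rabs (PSeries P l)) 0); [exact hJ| |].
  - apply (is_lim_seq_abs _ (Finite _)).
    apply is_lim_seq_ext with (sum_n (fun j => P j * l ^ j)); [intros; apply sum_n_Reals|].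
    exact (Series_correct _ (entire_ex_series P l hP)).
  - apply is_lim_seq_tail with (a := fun k => Rabs (P k * q0 ^ k)), exP. }
apply Rabs_eq_0; pose proof (Rabs_pos (PSeries P l)); lra.
Qed.

(** [p(-x) p(x)] is even. *)
Lemma alternate_square_odd (a : nat -> R) (n : nat) :
  PS_mult (fun k => a k * (-1) ^ k) a (2 * n + 1)%nat = 0.
Proof.
set (m := (2 * n + 1)%nat).
assert (E : PS_mult (fun k => a k * (-1) ^ k) a m = - PS_mult (fun k => a k * (-1) ^ k) a m).
{ unfold PS_mult at 1; rewrite <- (sum_f_R0_skip _ m).
  replace (- PS_mult (fun k => a k * (-1) ^ k) a m)
    with (-1 * PS_mult (fun k => a k * (-1) ^ k) a m) by ring.
  unfold PS_mult; rewrite scal_sum; apply sum_eq; intros i hi.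
  replace (m - (m - i))%nat with i by lia.
  assert (hsign : (-1) ^ (m - i) = - (-1) ^ i).
  { replace (- (-1) ^ i) with ((-1) ^ S i) by (simpl; ring).
    destruct (Nat.Even_or_Odd i) as [[j ->]|[j ->]]; unfold m.
    - replace (2 * n + 1 - 2 * j)%nat with (S (2 * (n - j))) by lia.
      rewrite !pow_1_odd; reflexivity.
    - replace (2 * n + 1 - (2 * j + 1))%nat with (2 * (n - j))%nat by lia.
      replace (S (2 * j + 1)) with (2 * (j + 1))%nat by lia.
      rewrite !pow_1_even; reflexivity. }
  rewrite hsign; ring. }
lra.
Qed.

Lemma sum_even_terms (F : nat -> R) (n : nat) :
  (forall k, F (2 * k + 1)%nat = 0) ->
  sum_f_R0 F (2 * n) = sum_f_R0 (fun k => F (2 * k)%nat) n.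
Proof.
intros h; induction n as [|n IH]; [reflexivity|].
replace (2 * S n)%nat with (S (S (2 * n))) by lia.
rewrite !tech5, IH.
replace (S (2 * n)) with (2 * n + 1)%nat by lia; rewrite h.
replace (S (2 * n + 1)) with (2 * S n)%nat by lia; ring.
Qed.

(** If [sum_n s_n x^n] is the quotient [g / p] of entire functions, its even
    moments can only grow as fast as the zeros of [p] nearest to the origin
    allow.  Multiplying by [p(-x)] makes the denominator even, so that the even
    moments satisfy a convolution equation of their own. *)
Lemma even_moment_ratio_zero (s p g : nat -> R) :
  (forall n, 0 < s (2 * n)%nat) ->
  (forall n, s (2 * S n)%nat ^ 2 <= s (2 * n)%nat * s (2 * S (S n))%nat) ->
  entire p -> entire g -> (forall n, g n = PS_mult p s n) ->
  exists r, r ^ 2 <= s 0%nat / s 2%nat /\ PSeries p r = 0.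
Proof.
intros hs hconv hp hg hE.
set (p' := fun k => p k * (-1) ^ k).
assert (hp' : entire p') by (apply entire_alternate, hp).
destruct (log_convex_ratio_zero (fun n => s (2 * n)%nat)
           (fun n => PS_mult p' p (2 * n)%nat) (fun n => PS_mult p' g (2 * n)%nat))
  as [l [[hl0 hl] hz]].
- exact hs.
- exact hconv.
- apply (entire_even_part (PS_mult p' p)), entire_mult; assumption.
- apply (entire_even_part (PS_mult p' g)), entire_mult; assumption.
- intros n.
  rewrite (functional_extensionality g (PS_mult p s) hE), <- PS_mult_assoc.
  unfold PS_mult at 1; rewrite sum_even_terms.
  + unfold PS_mult at 2; apply sum_eq; intros i hi; do 2 f_equal; lia.
  + intros k; unfold p'; rewrite alternate_square_odd; ring.
- set (r := sqrt l).
  assert (hr : r ^ 2 = l) by (unfold r; apply pow2_sqrt, hl0).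
  assert (h0 : PSeries p (- r) * PSeries p r = 0).
  { rewrite <- PSeries_alternate; fold p'.
    rewrite <- PSeries_mult by (apply entire_lt_radius; assumption).
    assert (hpp : entire (PS_mult p' p)) by (apply entire_mult; assumption).
    assert (hodd : forall n, PS_mult p' p (2 * n + 1)%nat = 0)
      by (intros; apply alternate_square_odd).
    rewrite PSeries_odd_even.
    - rewrite hr, hz.
      rewrite (PSeries_ext _ (fun _ => 0) l) by exact hodd.
      rewrite PSeries_const_0; ring.
    - apply (entire_ex_pseries (fun n => PS_mult p' p (2 * n)%nat)), entire_even_part, hpp.
    - apply ex_pseries_ext with (fun _ : nat => 0); [intros; symmetry; apply hodd|].
      apply entire_ex_pseries; intros x; exists 0; intros n.
      rewrite Rmult_0_l, Rabs_R0; lra. }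
  simpl Nat.mul in hl.
  apply Rmult_integral in h0; destruct h0 as [h0|h0]; [exists (- r)|exists r]; split; trivial.
  + replace ((- r) ^ 2) with l by (rewrite <- hr; ring); exact hl.
  + rewrite hr; exact hl.
Qed.

(** * The real power series of the Coulomb wave function *)

(** When [L = -1] and [eta = 0] the convention [0 / 0 = 0] gives the slope [0]
    that belongs to [cos]. *)
Definition slope (L eta : R) : R := eta / (L + 1).

Fixpoint coef_pair (L eta : R) (n : nat) : R * R :=
  match n with
  | O => (1, slope L eta)
  | S m => let (p, q) := coef_pair L eta m in
           (q, (2 * eta * q - p) / ((INR m + 2) * (INR m + (2 * L + 3))))
  end.

(** The coefficients of the solution, equal to [1] at the origin, of
    [rho f'' + (2 L + 2) f' + (rho - 2 eta) f = 0]. *)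
Definition coef (L eta : R) (n : nat) : R := fst (coef_pair L eta n).

Definition phi (L eta x : R) : R := PSeries (coef L eta) x.

(** The coefficient of [- x phi_(L+1)] in [phi_L']. *)
Definition kappa (L eta : R) : R := (1 + slope L eta ^ 2) / (2 * L + 3).

Lemma coef_0 (L eta : R) : coef L eta 0 = 1.
Proof. reflexivity. Qed.

Lemma coef_1 (L eta : R) : coef L eta 1 = slope L eta.
Proof. reflexivity. Qed.

Lemma coef_SS (L eta : R) (n : nat) :
  coef L eta (S (S n)) =
  (2 * eta * coef L eta (S n) - coef L eta n) / ((INR n + 2) * (INR n + (2 * L + 3))).
Proof.
unfold coef; simpl; destruct (coef_pair L eta n) as [p q]; reflexivity.
Qed.

Lemma nat_ind2 (P : nat -> Prop) :
  P 0%nat -> P 1%nat -> (forall n, P n -> P (S n) -> P (S (S n))) -> forall n, P n.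
Proof.
intros h0 h1 hS n; assert (H : P n /\ P (S n)); [|tauto].
induction n as [|n [IH1 IH2]]; auto.
Qed.

Lemma slope_succ (L eta : R) : - 3 / 2 < L -> slope (L + 1) eta * (L + 2) = eta.
Proof. intros hL; unfold slope; field; lra. Qed.

(** The coefficients of [phi_L' = slope phi_L - kappa x phi_(L+1)]: the sequence on the left
    satisfies the recurrence that defines [coef (L + 1)]. *)
Lemma coef_derive (L eta : R) (n : nat) :
  - 3 / 2 < L -> slope L eta * (L + 1) = eta ->
  slope L eta * coef L eta (S n) - (INR n + 2) * coef L eta (S (S n))
  = kappa L eta * coef (L + 1) eta n.
Proof.
intros hL he.
assert (hn : forall m, 0 <= INR m) by apply pos_INR.
unfold kappa.
set (e := slope L eta) in *.
induction n as [| |n IH1 IH2] using nat_ind2.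
- rewrite coef_SS, coef_0, coef_1; fold e; rewrite coef_0, <- he; simpl INR; field; lra.
- rewrite !coef_SS, coef_0, coef_1; fold e; rewrite coef_1; simpl INR.
  unfold slope; rewrite <- he; field; lra.
- rewrite (coef_SS (L + 1)).
  specialize (hn n).
  set (k := (1 + e ^ 2) / (2 * L + 3)) in *.
  replace (k * ((2 * eta * coef (L + 1) eta (S n) - coef (L + 1) eta n)
              / ((INR n + 2) * (INR n + (2 * (L + 1) + 3)))))
    with ((2 * eta * (k * coef (L + 1) eta (S n)) - k * coef (L + 1) eta n)
              / ((INR n + 2) * (INR n + (2 * (L + 1) + 3)))) by (field; lra).
  rewrite <- IH1, <- IH2.
  rewrite (coef_SS L eta (S (S n))), (coef_SS L eta (S n)), (coef_SS L eta n), !S_INR.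
  generalize (coef L eta (S n)) (coef L eta n); intros u v.
  rewrite <- he; field; lra.
Qed.

(** The companion relation
    [x phi_(L+1)' = (2 L + 3) (phi_L - phi_(L+1)) - slope x phi_(L+1)]. *)
Lemma coef_lower (L eta : R) (n : nat) :
  - 3 / 2 < L -> slope L eta * (L + 1) = eta ->
  (INR n + 2 * L + 4) * coef (L + 1) eta (S n)
  = (2 * L + 3) * coef L eta (S n) - slope L eta * coef (L + 1) eta n.
Proof.
intros hL he.
assert (hk : 0 < kappa L eta).
{ unfold kappa; apply Rdiv_lt_0_compat; [pose proof (pow2_ge_0 (slope L eta))|]; lra. }
apply Rmult_eq_reg_l with (kappa L eta); [|lra].
transitivity ((INR n + 2 * L + 4) * (kappa L eta * coef (L + 1) eta (S n))); [ring|].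
transitivity ((kappa L eta * (2 * L + 3)) * coef L eta (S n)
   - slope L eta * (kappa L eta * coef (L + 1) eta n)); [|ring].
rewrite <- !coef_derive by assumption.
replace (kappa L eta * (2 * L + 3)) with (1 + slope L eta ^ 2) by (unfold kappa; field; lra).
rewrite (coef_SS L eta (S n)), !S_INR.
pose proof (pos_INR n).
set (e := slope L eta) in *; rewrite <- he; field; lra.
Qed.

Lemma coef_three_term_1 (L eta : R) :
  - 3 / 2 < L -> slope L eta * (L + 1) = eta ->
  coef L eta 1 = coef (L + 1) eta 1 + (slope L eta + slope (L + 1) eta) / (2 * L + 3).
Proof.
intros hL he; pose proof (slope_succ L eta hL) as he'.
rewrite !coef_1.
apply Rmult_eq_reg_r with (2 * L + 3); [|lra].
rewrite Rmult_plus_distr_r; unfold Rdiv at 1; rewrite Rmult_assoc, Rinv_l by lra.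
lra.
Qed.

(** Eliminates the derivative of [phi_(L+1)] between [coef_lower] and [coef_derive] for
    [L + 1]. *)
Lemma coef_three_term (L eta : R) (n : nat) :
  - 3 / 2 < L -> slope L eta * (L + 1) = eta ->
  coef L eta (S (S n))
  = coef (L + 1) eta (S (S n))
    + (slope L eta + slope (L + 1) eta) / (2 * L + 3) * coef (L + 1) eta (S n)
    - kappa (L + 1) eta / (2 * L + 3) * coef (L + 1 + 1) eta n.
Proof.
intros hL he.
pose proof (slope_succ L eta hL) as he'.
assert (he2 : slope (L + 1) eta * (L + 1 + 1) = eta) by (rewrite <- he' at 2; ring).
pose proof (coef_lower L eta (S n) hL he) as h1.
pose proof (coef_derive (L + 1) eta n ltac:(lra) he2) as h2.
rewrite S_INR in h1.
apply Rmult_eq_reg_l with (2 * L + 3); [|lra].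
transitivity ((2 * L + 3) * coef (L + 1) eta (S (S n))
   + (slope L eta + slope (L + 1) eta) * coef (L + 1) eta (S n)
   - kappa (L + 1) eta * coef (L + 1 + 1) eta n); [|field; lra].
rewrite <- h2; lra.
Qed.

(** Lets [B] be small when [L] is large, unlike the next bound. *)
Lemma coef_bound_geometric (L eta B : R) (n : nat) :
  - 3 / 2 < L -> 0 < B -> Rabs (slope L eta) <= B ->
  2 * Rabs eta * B + 1 <= B ^ 2 * (2 * (2 * L + 3)) ->
  Rabs (coef L eta n) <= B ^ n.
Proof.
intros hL hB hs hr.
induction n as [| |n IH1 IH2] using nat_ind2.
- rewrite coef_0, Rabs_R1; simpl; lra.
- rewrite coef_1; simpl; lra.
- rewrite coef_SS; pose proof (pos_INR n) as hn.
  assert (hD : 2 * (2 * L + 3) <= (INR n + 2) * (INR n + (2 * L + 3)))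
    by (apply Rmult_le_compat; lra).
  rewrite Rabs_div, (Rabs_pos_eq ((INR n + 2) * _)) by lra.
  apply Rle_div_l; [lra|].
  apply Rle_trans with (2 * Rabs eta * B ^ S n + B ^ n).
  + unfold Rminus; eapply Rle_trans; [apply Rabs_triang|].
    rewrite Rabs_Ropp, !Rabs_mult, (Rabs_pos_eq 2) by lra.
    apply Rplus_le_compat; [|exact IH1].
    apply Rmult_le_compat_l; [|exact IH2].
    pose proof (Rabs_pos eta); lra.
  + apply Rle_trans with (B ^ n * (B ^ 2 * (2 * (2 * L + 3)))).
    * replace (2 * Rabs eta * B ^ S n + B ^ n) with (B ^ n * (2 * Rabs eta * B + 1)) by (simpl; ring).
      apply Rmult_le_compat_l; [apply pow_le; lra|exact hr].
    * replace (B ^ S (S n) * ((INR n + 2) * (INR n + (2 * L + 3))))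
        with (B ^ n * (B ^ 2 * ((INR n + 2) * (INR n + (2 * L + 3))))) by (simpl; ring).
      apply Rmult_le_compat_l; [apply pow_le; lra|].
      apply Rmult_le_compat_l; [apply pow_le; lra|exact hD].
Qed.

Lemma coef_bound_factorial (L eta A : R) (n : nat) :
  - 3 / 2 < L -> 1 <= A -> Rabs (slope L eta) <= A ->
  2 * Rabs eta * A + 1 <= A ^ 2 * (2 * L + 3) ->
  Rabs (coef L eta n) <= A ^ n / INR (fact n).
Proof.
intros hL hB hs hr.
induction n as [| |n IH1 IH2] using nat_ind2.
- rewrite coef_0, Rabs_R1; simpl; lra.
- rewrite coef_1; simpl; lra.
- rewrite coef_SS; pose proof (pos_INR n) as hn.
  assert (hf : 0 < INR (fact n)) by apply INR_fact_lt_0.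
  assert (hD : 0 < (INR n + 2) * (INR n + (2 * L + 3)))
    by (apply Rmult_lt_0_compat; lra).
  rewrite !fact_simpl, !mult_INR, !S_INR in *.
  rewrite Rabs_div, (Rabs_pos_eq ((INR n + 2) * _)) by lra.
  apply Rle_div_l; [lra|].
  apply Rle_trans with (2 * Rabs eta * (A ^ S n / ((INR n + 1) * INR (fact n))) + A ^ n / INR (fact n)).
  + unfold Rminus; eapply Rle_trans; [apply Rabs_triang|].
    rewrite Rabs_Ropp, !Rabs_mult, (Rabs_pos_eq 2) by lra.
    apply Rplus_le_compat; [|exact IH1].
    apply Rmult_le_compat_l; [|exact IH2].
    pose proof (Rabs_pos eta); lra.
  + replace (2 * Rabs eta * (A ^ S n / ((INR n + 1) * INR (fact n))) + A ^ n / INR (fact n))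
      with (A ^ n / ((INR n + 1) * INR (fact n)) * (2 * Rabs eta * A + 1 + INR n)) by (simpl; field; lra).
    replace (A ^ S (S n) / ((INR n + 1 + 1) * ((INR n + 1) * INR (fact n))) *
              ((INR n + 2) * (INR n + (2 * L + 3))))
      with (A ^ n / ((INR n + 1) * INR (fact n)) * (A ^ 2 * (2 * L + 3) + A ^ 2 * INR n))
      by (simpl; field; lra).
    apply Rmult_le_compat_l.
    * apply Rdiv_le_0_compat; [apply pow_le; lra|apply Rmult_lt_0_compat; lra].
    * assert (1 <= A ^ 2) by (simpl; nra).
      assert (INR n <= A ^ 2 * INR n) by nra.
      lra.
Qed.

Lemma exp_term_le (x : R) (n : nat) : 0 <= x -> x ^ n / INR (fact n) <= exp x.
Proof.
intros hx.
pose proof (is_exp_Reals x) as E; apply is_pseries_R in E.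
assert (hp : forall k, 0 <= / INR (fact k) * x ^ k).
{ intros k; apply Rmult_le_pos; [apply Rlt_le, Rinv_0_lt_compat, INR_fact_lt_0|apply pow_le, hx]. }
rewrite <- (is_series_unique _ _ E).
eapply Rle_trans; [|apply (sum_le_Series _ n hp); exists (exp x); exact E].
destruct n as [|n]; [simpl; lra|].
rewrite tech5.
assert (0 <= sum_f_R0 (fun k => / INR (fact k) * x ^ k) n) by (apply cond_pos_sum; exact hp).
unfold Rdiv; rewrite Rmult_comm; lra.
Qed.

Lemma factorial_bound_entire (c : nat -> R) (A : R) :
  0 <= A -> (forall n, Rabs (c n) <= A ^ n / INR (fact n)) -> entire c.
Proof.
intros hA hc r; exists (exp (A * Rabs r)); intros n.
eapply Rle_trans; [|apply (exp_term_le (A * Rabs r) n), Rmult_le_pos; [exact hA|apply Rabs_pos]].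
rewrite Rabs_mult, <- RPow_abs, Rpow_mult_distr.
replace (A ^ n * Rabs r ^ n / INR (fact n)) with (A ^ n / INR (fact n) * Rabs r ^ n)
  by (field; apply INR_fact_neq_0).
apply Rmult_le_compat_r; [apply pow_le, Rabs_pos|apply hc].
Qed.

Lemma factorial_bound_exp (c : nat -> R) (A x : R) :
  0 <= A -> (forall n, Rabs (c n) <= A ^ n / INR (fact n)) ->
  Rabs (PSeries c x) <= exp (A * Rabs x).
Proof.
intros hA hc.
pose proof (is_exp_Reals (A * Rabs x)) as E; apply is_pseries_R in E.
unfold PSeries.
eapply Rle_trans; [apply Series_Rabs, entire_ex_series_abs, (factorial_bound_entire c A hA hc)|].
rewrite <- (is_series_unique _ _ E).
apply Series_le; [|eexists; exact E].
intros n; split; [apply Rabs_pos|].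
rewrite Rabs_mult, <- RPow_abs, Rpow_mult_distr.
replace (/ INR (fact n) * (A ^ n * Rabs x ^ n)) with (A ^ n / INR (fact n) * Rabs x ^ n)
  by (field; apply INR_fact_neq_0).
apply Rmult_le_compat_r; [apply pow_le, Rabs_pos|apply hc].
Qed.

(** * The sequence of levels L, L + 1, L + 2, ... *)

(** The entries of the Jacobi operator, in the form in which the elimination of the derivative
    produces them; [jacobi_b] is also [eta / ((L + n + 1) (L + n + 2))]. *)
Definition jacobi_b (L eta : R) (n : nat) : R :=
  (slope (L + INR n) eta + slope (L + INR (S n)) eta) / (2 * (L + INR n) + 3).

Definition jacobi_a (L eta : R) (n : nat) : R :=
  kappa (L + INR (S n)) eta / (2 * (L + INR n) + 3).

Section Levels.

Context (L eta : R).
Context (hL : - 3 / 2 < L) (he : slope L eta * (L + 1) = eta).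

Lemma level_gt (n : nat) : - 3 / 2 < L + INR n.
Proof. pose proof (pos_INR n); lra. Qed.

Lemma level_slope (n : nat) : slope (L + INR n) eta * (L + INR n + 1) = eta.
Proof.
destruct n as [|n]; [simpl INR; rewrite Rplus_0_r; exact he|].
pose proof (slope_succ (L + INR n) eta (level_gt n)) as h.
rewrite S_INR; replace (L + (INR n + 1)) with (L + INR n + 1) by ring.
rewrite <- h at 2; ring.
Qed.

Lemma level_S (n : nat) : L + INR (S n) = L + INR n + 1.
Proof. rewrite S_INR; ring. Qed.

Lemma slope_level_bound (n : nat) :
  Rabs (slope (L + INR n) eta) <= Rabs (slope L eta) + 2 * Rabs eta.
Proof.
pose proof (Rabs_pos eta); pose proof (Rabs_pos (slope L eta)).
destruct n as [|n]; [simpl INR; rewrite Rplus_0_r; lra|].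
unfold slope at 1; rewrite Rabs_div.
2: { pose proof (level_gt n); rewrite level_S; lra. }
pose proof (level_gt n); rewrite level_S.
rewrite (Rabs_pos_eq (L + INR n + 1 + 1)) by lra.
apply Rle_div_l; [lra|]; nra.
Qed.

(** A bound uniform in the level [n] is needed for the norms of the vectors [psi x]; it exists
    because [2 (L + n) + 3] is smallest, and still positive, for [n = 0]. *)
Lemma coef_level_bound :
  exists A, 1 <= A /\
    forall n k, Rabs (coef (L + INR n) eta k) <= A ^ k / INR (fact k).
Proof.
set (l := 2 * L + 3).
assert (hl : 0 < l) by (unfold l; lra).
pose proof (Rabs_pos eta); pose proof (Rabs_pos (slope L eta)).
set (A := 1 + (1 + 2 * Rabs eta) / l + 2 * Rabs eta + Rabs (slope L eta)).
assert (hd : 0 <= (1 + 2 * Rabs eta) / l) by (apply Rdiv_le_0_compat; lra).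
assert (hA : 1 <= A) by (unfold A; lra).
exists A; split; [exact hA|]; intros n k.
apply coef_bound_factorial; [apply level_gt|exact hA| |].
- eapply Rle_trans; [apply slope_level_bound|unfold A; lra].
- pose proof (pos_INR n).
  assert (h1 : 1 + 2 * Rabs eta <= A * l).
  { replace (1 + 2 * Rabs eta) with ((1 + 2 * Rabs eta) / l * l) by (field; lra).
    apply Rmult_le_compat_r; unfold A; lra. }
  apply Rle_trans with (A * (A * l)); [nra|].
  replace (A * (A * l)) with (A ^ 2 * l) by ring.
  apply Rmult_le_compat_l; [apply pow2_ge_0|unfold l; lra].
Qed.

Lemma coef_level_entire (n : nat) : entire (coef (L + INR n) eta).
Proof.
destruct coef_level_bound as [A [hA h]].
apply factorial_bound_entire with A; [lra|apply h].
Qed.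

Lemma phi_level_bound (x : R) :
  exists M, 0 < M /\ forall n, Rabs (phi (L + INR n) eta x) <= M.
Proof.
destruct coef_level_bound as [A [hA h]].
exists (exp (A * Rabs x)); split; [apply exp_pos|].
intros n; apply factorial_bound_exp; [lra|apply h].
Qed.

Lemma phi_three_term (n : nat) (x : R) :
  phi (L + INR n) eta x
  = (1 + jacobi_b L eta n * x) * phi (L + INR (S n)) eta x
    - jacobi_a L eta n * x ^ 2 * phi (L + INR (S (S n))) eta x.
Proof.
set (c := coef (L + INR n) eta); set (c1 := coef (L + INR (S n)) eta);
  set (c2 := coef (L + INR (S (S n))) eta).
set (a := jacobi_a L eta n); set (b := jacobi_b L eta n).
assert (E : forall k, c k = PS_plus (PS_plus c1 (PS_scal b (PS_incr_1 c1)))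
                         (PS_scal (- a) (PS_incr_1 (PS_incr_1 c2))) k).
{ intros k; unfold PS_plus, PS_scal, PS_incr_1, plus, scal; simpl; unfold mult; simpl.
  pose proof (level_gt n) as hg; pose proof (level_slope n) as hs.
  unfold c, c1, c2, a, b, jacobi_a, jacobi_b; rewrite !level_S.
  destruct k as [|[|k]].
  - rewrite !coef_0; unfold zero; simpl; ring.
  - rewrite (coef_three_term_1 (L + INR n)) by assumption.
    rewrite coef_0; unfold zero; simpl; ring.
  - rewrite (coef_three_term (L + INR n)) by assumption; ring. }
unfold phi; fold c c1 c2; rewrite (PSeries_ext _ _ x E).
assert (h1 : ex_pseries c1 x) by apply entire_ex_pseries, coef_level_entire.
assert (h2 : ex_pseries c2 x) by apply entire_ex_pseries, coef_level_entire.
assert (h1' : ex_pseries (PS_scal b (PS_incr_1 c1)) x)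
  by (apply ex_pseries_scal; [apply Rmult_comm|]; apply ex_pseries_incr_1, h1).
rewrite PSeries_plus, PSeries_plus, !PSeries_scal, !PSeries_incr_1; trivial.
- ring.
- apply (ex_pseries_plus (V := R_NormedModule)); assumption.
- apply ex_pseries_scal; [apply Rmult_comm|]; apply ex_pseries_incr_1, ex_pseries_incr_1, h2.
Qed.

Lemma phi_0_level (x : R) : phi (L + INR 0) eta x = phi L eta x.
Proof. simpl INR; rewrite Rplus_0_r; reflexivity. Qed.

Lemma coef_entire : entire (coef L eta).
Proof. pose proof (coef_level_entire 0) as h; simpl INR in h; rewrite Rplus_0_r in h; exact h. Qed.

Lemma phi_derive (x : R) :
  PSeries (PS_derive (coef L eta)) x
  = slope L eta * phi L eta x - kappa L eta * x * phi (L + 1) eta x.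
Proof.
assert (E : forall k, PS_derive (coef L eta) k
   = PS_plus (PS_scal (slope L eta) (coef L eta))
             (PS_scal (- kappa L eta) (PS_incr_1 (coef (L + 1) eta))) k).
{ intros [|k]; unfold PS_derive, PS_plus, PS_scal, PS_incr_1, plus, scal; simpl;
    unfold mult; simpl.
  - rewrite coef_1, coef_0; unfold zero; simpl; ring.
  - pose proof (coef_derive L eta k hL he) as h.
    change (match k with 0%nat => 1 | S _ => INR k + 1 end) with (INR (S k)); rewrite S_INR; lra. }
rewrite (PSeries_ext _ _ x E).
pose proof (coef_level_entire 1) as h1; simpl INR in h1.
rewrite PSeries_plus, !PSeries_scal, PSeries_incr_1.
- unfold phi; ring.
- apply ex_pseries_scal; [apply Rmult_comm|]; apply entire_ex_pseries, coef_entire.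
- apply ex_pseries_scal; [apply Rmult_comm|]; apply ex_pseries_incr_1, entire_ex_pseries, h1.
Qed.

Lemma kappa_pos (n : nat) : 0 < kappa (L + INR n) eta.
Proof.
unfold kappa; pose proof (level_gt n); pose proof (pow2_ge_0 (slope (L + INR n) eta)).
apply Rdiv_lt_0_compat; lra.
Qed.

Lemma jacobi_a_pos (n : nat) : 0 < jacobi_a L eta n.
Proof.
unfold jacobi_a; pose proof (level_gt n).
apply Rdiv_lt_0_compat; [apply kappa_pos|lra].
Qed.

Lemma kappa_lim : is_lim_seq (fun n => kappa (L + INR n) eta) 0.
Proof.
set (S0 := Rabs (slope L eta) + 2 * Rabs eta).
apply is_lim_seq_le_le with (fun _ => 0) (fun n => (1 + S0 ^ 2) / (2 * (L + INR n) + 3)).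
- intros n; split; [apply Rlt_le, kappa_pos|].
  pose proof (level_gt n); unfold kappa; apply Rmult_le_compat_r.
  + apply Rlt_le, Rinv_0_lt_compat; lra.
  + rewrite <- (pow2_abs (slope _ _)); apply Rplus_le_compat_l, pow_incr.
    split; [apply Rabs_pos|apply slope_level_bound].
- apply is_lim_seq_const.
- replace (Finite 0) with (Rbar_mult (1 + S0 ^ 2) 0) by (simpl; f_equal; ring).
  apply is_lim_seq_scal_l.
  replace (Finite 0) with (Rbar_inv p_infty) by reflexivity.
  apply is_lim_seq_inv; [|discriminate].
  apply is_lim_seq_le_p_loc with (fun n => INR n + (2 * L + 3)).
  + exists 0%nat; intros n _; pose proof (pos_INR n); lra.
  + apply is_lim_seq_plus with p_infty (2 * L + 3); [apply is_lim_seq_INR|apply is_lim_seq_const|reflexivity].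
Qed.

(** The telescoping identity that evaluates the Hilbert-Schmidt norm of the operator. *)
Lemma kappa_diff (n : nat) :
  kappa (L + INR n) eta - kappa (L + INR (S n)) eta
  = jacobi_b L eta n ^ 2 + 2 * jacobi_a L eta n.
Proof.
unfold jacobi_a, jacobi_b, kappa.
pose proof (level_gt n) as hg; pose proof (level_slope n) as h0; pose proof (level_slope (S n)) as h1.
rewrite !level_S in *.
set (l := L + INR n) in *; set (e0 := slope l eta) in *; set (e1 := slope (l + 1) eta) in *.
assert (hrel : e0 * (l + 1) = e1 * (l + 1 + 1)) by lra.
clearbody e0 e1.
apply Rminus_diag_uniq.
match goal with |- ?g = 0 =>
  replace g with ((e0 + e1) * (2 * (e0 * (l + 1) - e1 * (l + 1 + 1))) / (2 * l + 3) ^ 2)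
    by (field; lra) end.
rewrite hrel; unfold Rdiv; ring.
Qed.

Lemma jacobi_a_lim : is_lim_seq (jacobi_a L eta) 0.
Proof.
apply is_lim_seq_le_le with (fun _ => 0) (fun n => kappa (L + INR n) eta).
- intros n; split; [apply Rlt_le, jacobi_a_pos|].
  pose proof (kappa_diff n); pose proof (pow2_ge_0 (jacobi_b L eta n)).
  pose proof (jacobi_a_pos n); pose proof (kappa_pos (S n)); lra.
- apply is_lim_seq_const.
- exact kappa_lim.
Qed.

Lemma kappa_decr (n : nat) : kappa (L + INR n) eta <= kappa L eta.
Proof.
induction n as [|n IH]; [simpl INR; rewrite Rplus_0_r; lra|].
pose proof (kappa_diff n); pose proof (pow2_ge_0 (jacobi_b L eta n)).
pose proof (jacobi_a_pos n); lra.
Qed.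

Lemma jacobi_a_bound (n : nat) : jacobi_a L eta n <= kappa L eta.
Proof.
pose proof (kappa_diff n); pose proof (pow2_ge_0 (jacobi_b L eta n)).
pose proof (jacobi_a_pos n); pose proof (kappa_pos (S n)); pose proof (kappa_decr n); lra.
Qed.

Lemma jacobi_b_bound (n : nat) : jacobi_b L eta n ^ 2 <= kappa L eta.
Proof.
pose proof (kappa_diff n); pose proof (jacobi_a_pos n).
pose proof (kappa_pos (S n)); pose proof (kappa_decr n); lra.
Qed.

(** At a high level the power series is close to its constant term [1]. *)
Lemma phi_level_nonzero (x : R) : exists n, phi (L + INR n) eta x <> 0.
Proof.
pose proof (Rabs_pos x) as hx; pose proof (Rabs_pos eta) as hE.
(* with [|B x| <= 1/4] the terms after the first sum to at most [1/3] *)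
set (B := / (4 * (1 + Rabs x))).
assert (hB : 0 < B) by (apply Rinv_0_lt_compat; lra).
assert (hBx : B * Rabs x <= 1 / 4).
{ unfold B; apply Rmult_le_reg_l with (4 * (1 + Rabs x)); [lra|].
  rewrite <- Rmult_assoc, Rinv_r by lra; lra. }
set (t := (2 * Rabs eta * B + 1) / (2 * B ^ 2) + Rabs eta / B + 1).
destruct (nfloor_ex (Rmax 0 t) (Rmax_l _ _)) as [m [_ hm]].
pose proof (Rmax_r 0 t) as hmt.
assert (hB2 : 0 < B ^ 2) by (apply pow_lt, hB).
assert (ht1 : 0 <= (2 * Rabs eta * B + 1) / (2 * B ^ 2)).
{ apply Rdiv_le_0_compat; [|lra].
  assert (0 <= Rabs eta * B) by (apply Rmult_le_pos; lra); lra. }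
assert (ht2 : 0 <= Rabs eta / B) by (apply Rdiv_le_0_compat; lra).
exists (S (S m)).
set (n := S (S m)).
assert (hn : t + 1 < INR n) by (unfold n; rewrite !S_INR; lra).
assert (hc : forall k, Rabs (coef (L + INR n) eta k) <= B ^ k).
{ intros k; apply coef_bound_geometric; [apply level_gt|exact hB| |].
  - unfold slope; rewrite Rabs_div by (unfold t in hn; lra).
    unfold t in hn.
    rewrite (Rabs_pos_eq (L + INR n + 1)) by lra.
    apply Rle_div_l; [lra|].
    replace (Rabs eta) with (B * (Rabs eta / B)) at 1 by (field; lra).
    apply Rmult_le_compat_l; lra.
  - replace (2 * Rabs eta * B + 1)
      with (B ^ 2 * (2 * ((2 * Rabs eta * B + 1) / (2 * B ^ 2)))) by (field; lra).
    unfold t in hn.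
    apply Rmult_le_compat_l; lra. }
assert (hser : is_series (fun k => (1 / 4) ^ k) (/ (1 - 1 / 4)))
  by (apply is_series_geom; rewrite Rabs_pos_eq; lra).
assert (hterm : forall k, Rabs (coef (L + INR n) eta (S k) * x ^ S k) <= 1 / 4 * (1 / 4) ^ k).
{ intros k; rewrite Rabs_mult, <- RPow_abs.
  replace (1 / 4 * (1 / 4) ^ k) with ((1 / 4) ^ S k) by (simpl; ring).
  apply Rle_trans with ((B * Rabs x) ^ S k).
  - rewrite Rpow_mult_distr; apply Rmult_le_compat_r; [apply pow_le; lra|apply hc].
  - apply pow_incr; split; [apply Rmult_le_pos; lra|exact hBx]. }
pose proof (coef_level_entire n) as hent.
assert (E : phi (L + INR n) eta x = 1 + Series (fun k => coef (L + INR n) eta (S k) * x ^ S k)).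
{ unfold phi, PSeries; rewrite Series_incr_1 by (apply entire_ex_series, hent).
  rewrite coef_0; simpl; ring. }
assert (hS : Rabs (Series (fun k => coef (L + INR n) eta (S k) * x ^ S k)) <= 1 / 3).
{ eapply Rle_trans; [apply Series_Rabs|].
  - apply (ex_series_incr_1 (fun k => Rabs (coef (L + INR n) eta k * x ^ k))),
      entire_ex_series_abs, hent.
  - replace (1 / 3) with (1 / 4 * / (1 - 1 / 4)) by field.
    rewrite <- (is_series_unique _ _ hser), <- Series_scal_l.
    apply Series_le; [intros k; split; [apply Rabs_pos|apply hterm]|].
    apply (@ex_series_scal_l R_AbsRing R_NormedModule (1 / 4)); eexists; exact hser. }
apply Rabs_le_between in hS; lra.
Qed.

(** By the recurrence a common zero of two consecutive functions would be a zero of all of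
    them, against [phi_level_nonzero]. *)
Lemma phi_1_nonzero_at_zero (c : R) :
  c <> 0 -> phi L eta c = 0 -> phi (L + 1) eta c <> 0.
Proof.
intros hc h0 h1.
assert (H : forall n, phi (L + INR n) eta c = 0 /\ phi (L + INR (S n)) eta c = 0).
{ induction n as [|n [IH1 IH2]].
  - rewrite phi_0_level, level_S; simpl INR; rewrite Rplus_0_r; auto.
  - split; [exact IH2|].
    pose proof (phi_three_term n c) as E; rewrite IH1, IH2 in E.
    assert (hp : jacobi_a L eta n * c ^ 2 <> 0).
    { apply Rmult_integral_contrapositive; split;
        [pose proof (jacobi_a_pos n); lra|apply pow_nonzero, hc]. }
    apply Rmult_eq_reg_l with (jacobi_a L eta n * c ^ 2); [lra|exact hp]. }
destruct (phi_level_nonzero c) as [n hn]; apply hn, H.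
Qed.

End Levels.

(** * Jacobi operators on weighted square-summable sequences *)

Definition sum_over (f : R -> R) (X : list R) : R := fold_right (fun c s => f c + s) 0 X.

Lemma sum_over_ext (f g : R -> R) (X : list R) :
  (forall c, In c X -> f c = g c) -> sum_over f X = sum_over g X.
Proof.
induction X as [|c X IH]; intros h; simpl; [reflexivity|].
rewrite (h c), IH; [reflexivity| |left; reflexivity].
intros; apply h; right; assumption.
Qed.

Lemma sum_over_lin (f g : R -> R) (x : R) (X : list R) :
  sum_over (fun c => x * f c + g c) X = x * sum_over f X + sum_over g X.
Proof. induction X as [|c X IH]; simpl; [ring|rewrite IH; ring]. Qed.

Lemma sum_over_0 (X : list R) : sum_over (fun _ => 0) X = 0.
Proof. induction X as [|c X IH]; simpl; [reflexivity|rewrite IH; ring]. Qed.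

Lemma sum_over_scal (f : R -> R) (x : R) (X : list R) :
  sum_over (fun c => x * f c) X = x * sum_over f X.
Proof. induction X as [|c X IH]; simpl; [ring|rewrite IH; ring]. Qed.

Lemma sum_over_le (f g : R -> R) (X : list R) :
  (forall c, In c X -> f c <= g c) -> sum_over f X <= sum_over g X.
Proof.
induction X as [|c X IH]; intros h; simpl; [lra|].
apply Rplus_le_compat; [apply h; left; reflexivity|apply IH; intros; apply h; right; assumption].
Qed.

Lemma sum_over_nonneg (f : R -> R) (X : list R) :
  (forall c, In c X -> 0 <= f c) -> 0 <= sum_over f X.
Proof. intros h; rewrite <- (sum_over_0 X); apply sum_over_le, h. Qed.

Lemma sum_over_app (f : R -> R) (X Y : list R) :
  sum_over f (X ++ Y) = sum_over f X + sum_over f Y.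
Proof. induction X as [|c X IH]; simpl; [ring|rewrite IH; ring]. Qed.

Section Weighted.

Context (d a b : nat -> R) (K : R).
Context (d_pos : forall n, 0 < d n) (d_S : forall n, d (S n) = a n * d n).
Context (a_pos : forall n, 0 < a n) (a_le : forall n, a n <= K) (b_le : forall n, b n ^ 2 <= K).

Definition in_l2 (u : nat -> R) : Prop := ex_series (fun n => d n * u n ^ 2).

Definition ip (u v : nat -> R) : R := Series (fun n => d n * u n * v n).

Definition lin (x : R) (u v : nat -> R) : nat -> R := fun n => x * u n + v n.

(** The matrix is symmetric for the weights [d], not in itself: its entries are [1] below the
    diagonal and [a n] above, so that no square root is needed. *)
Definition jacobi (u : nat -> R) (n : nat) : R :=
  match n with O => 0 | S m => u m end - b n * u n + a n * u (S n).

Definition basis (m n : nat) : R := if Nat.eq_dec m n then 1 else 0.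

Lemma ex_series_le_R (u v : nat -> R) :
  (forall n, Rabs (u n) <= v n) -> ex_series v -> ex_series u.
Proof. intros h hv; exact (@ex_series_le R_AbsRing R_CompleteNormedModule u v h hv). Qed.

Lemma ex_series_lin_R (x : R) (u v : nat -> R) :
  ex_series u -> ex_series v -> ex_series (fun n => x * u n + v n).
Proof.
intros hu hv; apply (@ex_series_plus R_AbsRing R_NormedModule); [|exact hv].
exact (@ex_series_scal_l R_AbsRing R_NormedModule x _ hu).
Qed.

Lemma Series_lin (x : R) (u v : nat -> R) :
  ex_series u -> ex_series v -> Series (fun n => x * u n + v n) = x * Series u + Series v.
Proof.
intros hu hv; rewrite <- Series_scal_l, <- Series_plus; trivial.
exact (@ex_series_scal_l R_AbsRing R_NormedModule x _ hu).
Qed.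

Lemma ex_ip (u v : nat -> R) :
  in_l2 u -> in_l2 v -> ex_series (fun n => d n * u n * v n).
Proof.
intros hu hv.
apply ex_series_le_R with (fun n => 1 * (d n * u n ^ 2) + d n * v n ^ 2);
  [|apply ex_series_lin_R; assumption].
intros n; rewrite Rmult_assoc, Rabs_mult, (Rabs_pos_eq (d n)) by apply Rlt_le, d_pos.
replace (1 * (d n * u n ^ 2) + d n * v n ^ 2) with (d n * (u n ^ 2 + v n ^ 2)) by ring.
apply Rmult_le_compat_l; [apply Rlt_le, d_pos|].
apply Rabs_le; pose proof (pow2_ge_0 (u n + v n)); pose proof (pow2_ge_0 (u n - v n)).
pose proof (pow2_ge_0 (u n)); pose proof (pow2_ge_0 (v n)); simpl in *; lra.
Qed.

Lemma in_l2_lin (x : R) (u v : nat -> R) : in_l2 u -> in_l2 v -> in_l2 (lin x u v).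
Proof.
intros hu hv.
apply ex_series_le_R with
  (fun n => (2 * x ^ 2) * (d n * u n ^ 2) + (2 * (d n * v n ^ 2) + 0 * (d n * v n ^ 2))).
2: { apply ex_series_lin_R; [exact hu|].
     apply ex_series_lin_R; [exact hv|].
     apply (@ex_series_scal_l R_AbsRing R_NormedModule 0 _ hv). }
intros n; rewrite Rabs_pos_eq by (apply Rmult_le_pos; [apply Rlt_le, d_pos|apply pow2_ge_0]).
replace (2 * x ^ 2 * (d n * u n ^ 2) + (2 * (d n * v n ^ 2) + 0 * (d n * v n ^ 2)))
  with (d n * (2 * (x * u n) ^ 2 + 2 * v n ^ 2)) by ring.
apply Rmult_le_compat_l; [apply Rlt_le, d_pos|].
unfold lin; pose proof (pow2_ge_0 (x * u n - v n)); simpl in *; lra.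
Qed.

Lemma ip_sym (u v : nat -> R) : ip u v = ip v u.
Proof. apply Series_ext; intros; ring. Qed.

Lemma ip_lin_l (x : R) (u v w : nat -> R) :
  in_l2 u -> in_l2 v -> in_l2 w -> ip (lin x u v) w = x * ip u w + ip v w.
Proof.
intros hu hv hw; unfold ip; rewrite <- Series_lin by (apply ex_ip; assumption).
apply Series_ext; intros; unfold lin; ring.
Qed.

Lemma ip_lin_r (x : R) (u v w : nat -> R) :
  in_l2 u -> in_l2 v -> in_l2 w -> ip w (lin x u v) = x * ip w u + ip w v.
Proof. intros; rewrite !(ip_sym w); apply ip_lin_l; assumption. Qed.

Lemma ip_partial_le (u : nat -> R) (n : nat) :
  in_l2 u -> sum_f_R0 (fun k => d k * u k ^ 2) n <= ip u u.
Proof.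
intros hu; unfold ip.
rewrite (Series_ext (fun k => d k * u k * u k) (fun k => d k * u k ^ 2)) by (intros; ring).
apply sum_le_Series; [|exact hu].
intros k; apply Rmult_le_pos; [apply Rlt_le, d_pos|apply pow2_ge_0].
Qed.

Lemma ip_pos (u : nat -> R) : in_l2 u -> 0 <= ip u u.
Proof.
intros hu; eapply Rle_trans; [|apply (ip_partial_le u 0 hu)]; simpl sum_f_R0.
apply Rmult_le_pos; [apply Rlt_le, d_pos|apply pow2_ge_0].
Qed.

Lemma is_series_basis (m : nat) (f : nat -> R) :
  is_series (fun n => f n * basis m n) (f m).
Proof.
apply (is_lim_seq_ext_loc (fun _ => f m) _ (Finite (f m))); [|apply is_lim_seq_const].
exists m; intros n hn.
assert (E : forall k, sum_f_R0 (fun n => f n * basis m n) k = if le_lt_dec m k then f m else 0).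
{ unfold basis; induction k as [|k IH].
  - simpl; destruct (Nat.eq_dec m 0) as [e|h], (le_lt_dec m 0) as [h'|h'];
      try lia; try rewrite e; ring.
  - rewrite tech5, IH.
    destruct (Nat.eq_dec m (S k)) as [e|h], (le_lt_dec m k) as [h1|h1],
      (le_lt_dec m (S k)) as [h2|h2]; try lia; try rewrite e; ring. }
rewrite sum_n_Reals, E; destruct (le_lt_dec m n); [reflexivity|lia].
Qed.

Lemma in_l2_basis (m : nat) : in_l2 (basis m).
Proof.
assert (E : forall n, d n * basis m n = d n * basis m n ^ 2)
  by (intros n; unfold basis; destruct (Nat.eq_dec m n); ring).
exists (d m); exact (is_series_ext _ _ _ E (is_series_basis m d)).
Qed.

Lemma ip_basis_l (m : nat) (v : nat -> R) : ip (basis m) v = d m * v m.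
Proof.
unfold ip; rewrite <- (is_series_unique _ _ (is_series_basis m (fun n => d n * v n))).
apply Series_ext; intros; ring.
Qed.

Lemma in_l2_shift (u : nat -> R) : in_l2 u -> in_l2 (fun n => match n with O => 0 | S m => u m end).
Proof.
intros hu; apply ex_series_incr_1.
apply ex_series_le_R with (fun n => K * (d n * u n ^ 2)).
- intros n; rewrite d_S, Rabs_pos_eq.
  + rewrite !Rmult_assoc; apply Rmult_le_compat_r; [|apply a_le].
    apply Rmult_le_pos; [apply Rlt_le, d_pos|apply pow2_ge_0].
  + rewrite <- d_S; apply Rmult_le_pos; [apply Rlt_le, d_pos|apply pow2_ge_0].
- exact (@ex_series_scal_l R_AbsRing R_NormedModule K _ hu).
Qed.

(** The two off-diagonal terms are bounded by means of [d_(n+1) = a_n d_n]. *)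
Lemma in_l2_jacobi (u : nat -> R) : in_l2 u -> in_l2 (jacobi u).
Proof.
intros hu.
assert (hb : in_l2 (fun n => - b n * u n)).
{ apply ex_series_le_R with (fun n => K * (d n * u n ^ 2));
    [|exact (@ex_series_scal_l R_AbsRing R_NormedModule K _ hu)].
  intros n; rewrite Rabs_pos_eq by (apply Rmult_le_pos; [apply Rlt_le, d_pos|apply pow2_ge_0]).
  replace (d n * (- b n * u n) ^ 2) with (b n ^ 2 * (d n * u n ^ 2)) by ring.
  apply Rmult_le_compat_r; [|apply b_le].
  apply Rmult_le_pos; [apply Rlt_le, d_pos|apply pow2_ge_0]. }
assert (ha : in_l2 (fun n => a n * u (S n))).
{ apply ex_series_le_R with (fun n => K * (d (S n) * u (S n) ^ 2)).
  - intros n; rewrite Rabs_pos_eq by (apply Rmult_le_pos; [apply Rlt_le, d_pos|apply pow2_ge_0]).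
    rewrite d_S.
    replace (d n * (a n * u (S n)) ^ 2) with (a n * (a n * d n * u (S n) ^ 2)) by ring.
    apply Rmult_le_compat_r; [|apply a_le].
    rewrite <- d_S; apply Rmult_le_pos; [apply Rlt_le, d_pos|apply pow2_ge_0].
  - refine (@ex_series_scal_l R_AbsRing R_NormedModule K (fun n => d (S n) * u (S n) ^ 2) _).
    exact (proj1 (ex_series_incr_1 (fun n => d n * u n ^ 2)) hu). }
replace (jacobi u) with (lin 1 (lin 1 (fun n => match n with O => 0 | S m => u m end)
                       (fun n => - b n * u n)) (fun n => a n * u (S n))).
- apply in_l2_lin; [apply in_l2_lin; [apply in_l2_shift|]|]; assumption.
- apply functional_extensionality; intros n; unfold lin, jacobi; ring.
Qed.

Lemma jacobi_lin (x : R) (u v : nat -> R) : jacobi (lin x u v) = lin x (jacobi u) (jacobi v).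
Proof. apply functional_extensionality; intros [|n]; unfold lin, jacobi; ring. Qed.

Lemma jacobi_basis (m : nat) :
  jacobi (basis m) = lin 1 (basis (S m)) (lin (- b m) (basis m)
     (match m with O => fun _ => 0 | S l => lin (a l) (basis l) (fun _ => 0) end)).
Proof.
apply functional_extensionality; intros n.
destruct m as [|l], n as [|k]; unfold jacobi, lin, basis;
  repeat (match goal with |- context [Nat.eq_dec ?p ?q] => destruct (Nat.eq_dec p q) end; try lia);
  subst; try ring;
  repeat match goal with H : S _ = S _ |- _ => injection H as H; subst end; try lia; ring.
Qed.

(** The Lagrange identity. *)
Lemma sum_jacobi_sym (u v : nat -> R) (n : nat) :
  sum_f_R0 (fun k => d k * jacobi u k * v k) n
  = sum_f_R0 (fun k => d k * u k * jacobi v k) n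
    + d (S n) * (u (S n) * v n - u n * v (S n)).
Proof.
induction n as [|n IH]; [cbn [sum_f_R0]; rewrite d_S; unfold jacobi; ring|].
rewrite !tech5, IH; unfold jacobi; rewrite !d_S; ring.
Qed.

Lemma boundary_lim (u v : nat -> R) :
  in_l2 u -> in_l2 v -> is_lim_seq (fun n => d (S n) * (u n * v (S n))) 0.
Proof.
intros hu hv.
apply (ex_series_lim_0 (fun n => d (S n) * (u n * v (S n)))).
pose proof (ex_ip _ _ (in_l2_shift u hu) hv) as h.
apply ex_series_incr_1 in h.
assert (E : forall n, d (S n) * u n * v (S n) = d (S n) * (u n * v (S n))) by (intros; ring).
exact (ex_series_ext _ _ E h).
Qed.

Lemma jacobi_sym (u v : nat -> R) :
  in_l2 u -> in_l2 v -> ip (jacobi u) v = ip u (jacobi v).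
Proof.
intros hu hv.
pose proof (Series_correct _ (ex_ip _ _ (in_l2_jacobi u hu) hv)) as h1.
pose proof (Series_correct _ (ex_ip _ _ hu (in_l2_jacobi v hv))) as h2.
fold (ip (jacobi u) v) in h1; fold (ip u (jacobi v)) in h2.
assert (h3 : is_lim_seq (sum_n (fun k => d k * jacobi u k * v k)) (ip u (jacobi v) + (0 - 0))).
{ apply is_lim_seq_ext with (fun n => sum_n (fun k => d k * u k * jacobi v k) n
    + (d (S n) * (v n * u (S n)) - d (S n) * (u n * v (S n)))).
  - intros n; rewrite !sum_n_Reals, sum_jacobi_sym; ring.
  - apply is_lim_seq_plus'; [exact h2|].
    apply is_lim_seq_minus'; apply boundary_lim; assumption. }
pose proof (is_lim_seq_unique _ (Finite _) h1) as e1.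
pose proof (is_lim_seq_unique _ (Finite _) h3) as e3.
assert (e : Finite (ip (jacobi u) v) = Finite (ip u (jacobi v) + (0 - 0)))
  by (rewrite <- e1; exact e3).
injection e as e; rewrite e; ring.
Qed.

(** ** Removing finitely many eigenvectors *)

Context (v : R -> nat -> R) (mu : R -> R).

Definition orthogonal_family (X : list R) : Prop :=
  NoDup X /\
  (forall c, In c X -> in_l2 (v c) /\ 0 < ip (v c) (v c) /\ jacobi (v c) = fun n => mu c * v c n) /\
  (forall c c', In c X -> In c' X -> c <> c' -> ip (v c) (v c') = 0).

(** The inner product of the components of [u] and [w] orthogonal to the family. *)
Definition residual (X : list R) (u w : nat -> R) : R :=
  ip u w - sum_over (fun c => ip u (v c) * ip w (v c) / ip (v c) (v c)) X.

(** By induction on the list: subtracting from [u] its component along the first vector leaves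
    the products with the others unchanged and takes the first term of the sum out of [ip u u]. *)
Lemma bessel (X : list R) (u : nat -> R) :
  orthogonal_family X -> in_l2 u -> 0 <= residual X u u.
Proof.
revert u; induction X as [|c X IH]; intros u hX hu.
- unfold residual; simpl; rewrite Rminus_0_r; apply ip_pos, hu.
- destruct hX as [hnd [hv ho]].
  apply NoDup_cons_iff in hnd; destruct hnd as [hc hnd].
  destruct (hv c (or_introl eq_refl)) as [hvc [hN _]].
  set (N := ip (v c) (v c)) in *.
  set (al := - (ip u (v c) / N)).
  specialize (IH (lin al (v c) u)).
  assert (hX : orthogonal_family X).
  { split; [exact hnd|split].
    - intros c' h'; apply hv; right; exact h'.
    - intros c1 c2 h1 h2; apply ho; right; assumption. }
  specialize (IH hX (in_l2_lin _ _ _ hvc hu)).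
  unfold residual in *; simpl sum_over.
  rewrite (sum_over_ext _ (fun c' => ip u (v c') * ip u (v c') / ip (v c') (v c'))) in IH.
  + rewrite ip_lin_l, !ip_lin_r in IH by (try apply in_l2_lin; assumption).
    fold N in IH; rewrite (ip_sym (v c) u) in IH; fold N.
    set (t := ip u (v c)) in *; set (A := ip u u) in *.
    set (s := sum_over _ X) in *.
    replace (A - (t * t / N + s)) with (al * (al * N + t) + (al * t + A) - s);
      [exact IH|unfold al; field; lra].
  + intros c' h'.
    destruct (hv c' (or_intror h')) as [hvc' _].
    rewrite !ip_lin_l by assumption.
    rewrite (ho c c'); [|left; reflexivity|right; exact h'|intros ->; exact (hc h')].
    do 2 f_equal; ring.
Qed.

Lemma residual_sym (X : list R) (u w : nat -> R) : residual X u w = residual X w u.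
Proof.
unfold residual; rewrite (ip_sym u w); f_equal; apply sum_over_ext; intros; do 1 f_equal; ring.
Qed.

Lemma residual_lin_l (X : list R) (x : R) (u u' w : nat -> R) :
  orthogonal_family X -> in_l2 u -> in_l2 u' -> in_l2 w ->
  residual X (lin x u u') w = x * residual X u w + residual X u' w.
Proof.
intros [_ [hv _]] hu hu' hw; unfold residual; rewrite ip_lin_l by assumption.
rewrite (sum_over_ext _ (fun c => x * (ip u (v c) * ip w (v c) / ip (v c) (v c))
                        + ip u' (v c) * ip w (v c) / ip (v c) (v c))).
- rewrite sum_over_lin; ring.
- intros c hc; destruct (hv c hc) as [h [hN _]]; rewrite ip_lin_l by assumption; field; lra.
Qed.

Lemma residual_lin_r (X : list R) (x : R) (u u' w : nat -> R) :
  orthogonal_family X -> in_l2 u -> in_l2 u' -> in_l2 w ->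
  residual X w (lin x u u') = x * residual X w u + residual X w u'.
Proof. intros; rewrite !(residual_sym X w); apply residual_lin_l; assumption. Qed.

Lemma residual_le (X : list R) (u : nat -> R) :
  orthogonal_family X -> residual X u u <= ip u u.
Proof.
intros [_ [hv _]]; unfold residual.
assert (h : 0 <= sum_over (fun c => ip u (v c) * ip u (v c) / ip (v c) (v c)) X).
{ apply sum_over_nonneg; intros c hc; destruct (hv c hc) as [_ [hN _]].
  apply Rdiv_le_0_compat; [apply Rle_0_sqr|exact hN]. }
lra.
Qed.

Lemma residual_jacobi (X : list R) (u w : nat -> R) :
  orthogonal_family X -> in_l2 u -> in_l2 w ->
  residual X (jacobi u) w = residual X u (jacobi w).
Proof.
intros [_ [hv _]] hu hw; unfold residual; rewrite jacobi_sym by assumption.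
f_equal; apply sum_over_ext; intros c hc; destruct (hv c hc) as [h [hN hE]].
assert (H : forall z, in_l2 z -> ip (jacobi z) (v c) = mu c * ip z (v c)).
{ intros z hz; rewrite jacobi_sym, hE by assumption; unfold ip; rewrite <- Series_scal_l.
  apply Series_ext; intros; ring. }
rewrite !H by assumption; field; lra.
Qed.

Lemma residual_cauchy_schwarz (X : list R) (u w : nat -> R) :
  orthogonal_family X -> in_l2 u -> in_l2 w ->
  residual X u w ^ 2 <= residual X u u * residual X w w.
Proof.
intros hX hu hw.
assert (H : forall x, 0 <= x ^ 2 * residual X u u + 2 * x * residual X u w + residual X w w).
{ intros x; pose proof (bessel X (lin x u w) hX (in_l2_lin x u w hu hw)) as h.
  rewrite residual_lin_l, !residual_lin_r in h by (try apply in_l2_lin; assumption).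
  rewrite (residual_sym X w u) in h; lra. }
pose proof (bessel X u hX hu) as h1; pose proof (bessel X w hX hw) as h2.
set (A := residual X u u) in *; set (B := residual X u w) in *; set (C := residual X w w) in *.
destruct (Rle_lt_or_eq_dec 0 A h1) as [hA|hA].
- specialize (H (- B / A)).
  replace ((- B / A) ^ 2 * A + 2 * (- B / A) * B + C) with ((A * C - B ^ 2) / A) in H by (field; lra).
  apply Rmult_le_compat_r with (r := A) in H; [|lra].
  unfold Rdiv in H; rewrite Rmult_assoc, Rinv_l in H by lra; lra.
- rewrite <- hA in *.
  destruct (Req_dec B 0) as [hB|hB]; [rewrite hB; simpl; lra|].
  (* at this point the affine function of [x] would take the value [-1] *)
  specialize (H (- (C + 1) / (2 * B))).
  replace ((- (C + 1) / (2 * B)) ^ 2 * 0 + 2 * (- (C + 1) / (2 * B)) * B + C) with (-1) in H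
    by (field; exact hB); lra.
Qed.

End Weighted.

(** * The Jacobi operator of the Coulomb wave functions *)

Fixpoint weight (L eta : R) (n : nat) : R :=
  match n with O => 1 | S m => jacobi_a L eta m * weight L eta m end.

(** An eigenvector of the operator with eigenvalue [1 / x], except for row [0]. *)
Definition psi (L eta x : R) (n : nat) : R := x ^ n * phi (L + INR (S n)) eta x.

Section Coulomb.

Context (L eta : R).
Context (hL : - 3 / 2 < L) (he : slope L eta * (L + 1) = eta).

Local Notation d := (weight L eta).
Local Notation a := (jacobi_a L eta).
Local Notation b := (jacobi_b L eta).
Local Notation kap := (kappa L eta).
Local Notation J := (jacobi a b).
Local Notation v := (psi L eta).

Lemma weight_pos (n : nat) : 0 < d n.
Proof.
induction n as [|n IH]; simpl; [lra|].
apply Rmult_lt_0_compat; [apply jacobi_a_pos; assumption|exact IH].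
Qed.

Lemma weight_S (n : nat) : d (S n) = a n * d n.
Proof. reflexivity. Qed.

Lemma weight_entire : entire d.
Proof.
apply ex_pseries_entire; intros x; apply CV_radius_inside.
rewrite CV_radius_infinite_DAlembert; [exact I| |].
- intros n; pose proof (weight_pos n); lra.
- apply is_lim_seq_ext with a; [|apply jacobi_a_lim; assumption].
  intros n; rewrite weight_S.
  pose proof (weight_pos n); pose proof (jacobi_a_pos L eta hL n).
  rewrite Rabs_pos_eq; [field; lra|].
  apply Rdiv_le_0_compat; [apply Rmult_le_pos|]; lra.
Qed.

Lemma in_l2_psi (x : R) : in_l2 d (v x).
Proof.
destruct (phi_level_bound L eta hL x) as [M [hM hb]].
apply ex_series_le_R with (fun n => M ^ 2 * (d n * (x ^ 2) ^ n)).
- intros n; pose proof (weight_pos n).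
  rewrite Rabs_pos_eq by (apply Rmult_le_pos; [lra|apply pow2_ge_0]).
  replace (d n * v x n ^ 2) with (phi (L + INR (S n)) eta x ^ 2 * (d n * (x ^ 2) ^ n)).
  + apply Rmult_le_compat_r; [apply Rmult_le_pos; [lra|apply pow_le, pow2_ge_0]|].
    rewrite <- pow2_abs; apply pow_incr; split; [apply Rabs_pos|apply hb].
  + unfold psi; rewrite <- pow_mult, Nat.mul_comm, pow_mult; ring.
- apply (@ex_series_scal_l R_AbsRing R_NormedModule (M ^ 2)).
  exact (entire_ex_series d (x ^ 2) weight_entire).
Qed.

(** The three-term recurrence, row by row; in row [0] the missing entry leaves a multiple of
    [phi L eta x]. *)
Lemma jacobi_psi (x : R) :
  x <> 0 -> J (v x) = lin (/ x) (v x) (fun n => - (phi L eta x / x) * basis 0 n).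
Proof.
intros hx; apply functional_extensionality; intros n.
pose proof (phi_three_term L eta hL he n x) as E.
unfold jacobi, lin, psi, basis; destruct n as [|n].
- rewrite phi_0_level in E; rewrite E; simpl pow; destruct (Nat.eq_dec 0 0); [|lia].
  field; exact hx.
- destruct (Nat.eq_dec 0 (S n)); [lia|]; rewrite E; simpl pow; field; exact hx.
Qed.

Lemma in_l2_basis_scal (x : R) (m : nat) : in_l2 d (fun n => x * basis m n).
Proof.
replace (fun n => x * basis m n) with (lin (x - 1) (basis m) (basis m))
  by (apply functional_extensionality; intros; unfold lin; ring).
apply in_l2_lin; try exact weight_pos; apply in_l2_basis.
Qed.

Lemma ip_jacobi_sym (u w : nat -> R) :
  in_l2 d u -> in_l2 d w -> ip d (J u) w = ip d u (J w).
Proof.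
apply (jacobi_sym d a b kap weight_pos weight_S).
- intros n; apply jacobi_a_bound; assumption.
- intros n; apply jacobi_b_bound; assumption.
Qed.

(** Compares [ip (J (v x)) (v c)] with [ip (v x) (J (v c))]. *)
Lemma christoffel_darboux (x c : R) :
  x <> 0 -> c <> 0 -> x <> c -> phi L eta c = 0 ->
  ip d (v x) (v c) = phi L eta x * phi (L + 1) eta c / (1 - x / c).
Proof.
intros hx hc hxc h0.
pose proof (ip_jacobi_sym (v x) (v c) (in_l2_psi x) (in_l2_psi c)) as E.
rewrite (jacobi_psi x hx), (jacobi_psi c hc), h0 in E.
rewrite (ip_lin_l d weight_pos), (ip_lin_r d weight_pos) in E
  by (apply in_l2_psi || apply in_l2_basis_scal).
assert (e1 : ip d (fun n => - (phi L eta x / x) * basis 0 n) (v c)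
             = - (phi L eta x / x) * phi (L + 1) eta c).
{ transitivity (- (phi L eta x / x) * ip d (basis 0) (v c)).
  - unfold ip; rewrite <- Series_scal_l; apply Series_ext; intros; ring.
  - rewrite ip_basis_l; unfold psi; rewrite level_S; simpl INR; rewrite Rplus_0_r; simpl; ring. }
assert (e2 : ip d (v x) (fun n => - (0 / c) * basis 0 n) = 0).
{ transitivity (0 * ip d (v x) (basis 0)); [|ring].
  unfold ip; rewrite <- Series_scal_l; apply Series_ext; intros; unfold Rdiv; ring. }
rewrite e1, e2 in E.
set (I := ip d (v x) (v c)) in *.
apply Rmult_eq_reg_r with (/ x - / c).
- replace (I * (/ x - / c)) with (/ x * I - / c * I) by ring.
  replace (/ x * I - / c * I) with (phi L eta x / x * phi (L + 1) eta c) by lra.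
  field; repeat split; try assumption; lra.
- intros h; apply hxc; rewrite <- (Rinv_inv x), <- (Rinv_inv c); f_equal; lra.
Qed.

(** The sum of [d_k psi_k^2] over [k >= n] divided by [d_n x^(2 n)].  It is the confluent form of
    the Christoffel-Darboux kernel, in which the differential relations have replaced the
    derivatives. *)
Definition tail_norm (x : R) (n : nat) : R :=
  let f k := phi (L + INR k) eta x in
  (1 + (slope (L + INR (S n)) eta - slope (L + INR n) eta) * x) * f n * f (S n)
  - kappa (L + INR (S n)) eta * x ^ 2 * f n * f (S (S n))
  + kappa (L + INR n) eta * x ^ 2 * f (S n) ^ 2.

(** Everything at level [n] in terms of [a_n], [b_n] and [l]. *)
Lemma jacobi_relations (n : nat) :
  let l := 2 * (L + INR n) + 3 in
  slope (L + INR n) eta = b n * (l + 1) / 2 /\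
  slope (L + INR (S n)) eta = b n * (l - 1) / 2 /\
  kappa (L + INR (S n)) eta = a n * l /\
  kappa (L + INR n) eta = b n ^ 2 + 2 * a n + a n * l.
Proof.
intros l.
pose proof (level_gt L hL n) as hg.
pose proof (level_slope L eta hL he n) as h0; pose proof (level_slope L eta hL he (S n)) as h1.
pose proof (kappa_diff L eta hL he n) as hk.
assert (hkl : kappa (L + INR (S n)) eta = a n * l)
  by (unfold jacobi_a, l; field; lra).
assert (hs : slope (L + INR n) eta + slope (L + INR (S n)) eta = b n * l)
  by (unfold jacobi_b, l; field; lra).
assert (hd : slope (L + INR n) eta - slope (L + INR (S n)) eta = b n).
{ apply Rmult_eq_reg_r with l; [|unfold l; lra].
  rewrite <- hs; unfold l; rewrite (level_S L n) in *; lra. }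
repeat split; lra.
Qed.

(** The first form stays bounded as [n] grows; this one involves only two consecutive
    functions. *)
Lemma tail_norm_alt (x : R) (n : nat) :
  let l := 2 * (L + INR n) + 3 in
  let f k := phi (L + INR k) eta x in
  tail_norm x n = l * f n ^ 2 + (1 - l - 2 * slope (L + INR n) eta * x) * f n * f (S n)
                  + kappa (L + INR n) eta * x ^ 2 * f (S n) ^ 2.
Proof.
intros l f; unfold tail_norm; fold (f n) (f (S n)) (f (S (S n))).
pose proof (phi_three_term L eta hL he n x) as E; fold (f n) (f (S n)) (f (S (S n))) in E.
destruct (jacobi_relations n) as [h0 [h1 [h2 _]]]; fold l in h0, h1, h2.
rewrite h0, h1, h2.
replace (l * f n ^ 2) with (l * f n * f n) by ring.
rewrite E at 4; field.
Qed.

Lemma tail_norm_step (x : R) (n : nat) :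
  tail_norm x n = phi (L + INR (S n)) eta x ^ 2 + a n * x ^ 2 * tail_norm x (S n).
Proof.
rewrite (tail_norm_alt x (S n)); cbv zeta; unfold tail_norm.
rewrite (phi_three_term L eta hL he n x).
destruct (jacobi_relations n) as [h0 [h1 [h2 h3]]].
rewrite h3, h0, h1, h2, level_S; field.
Qed.

Lemma norm_partial_sum (x : R) (n : nat) :
  sum_f_R0 (fun k => d k * v x k * v x k) n
  = tail_norm x 0 - d (S n) * (x ^ 2) ^ S n * tail_norm x (S n).
Proof.
induction n as [|n IH].
- simpl sum_f_R0; rewrite tail_norm_step, weight_S; unfold psi; simpl; ring.
- rewrite tech5, IH, (tail_norm_step x (S n)), (weight_S (S n)); unfold psi.
  replace ((x ^ 2) ^ S (S n)) with ((x ^ 2) ^ S n * x ^ 2) by (simpl; ring).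
  rewrite <- pow_mult, Nat.mul_comm, pow_mult; ring.
Qed.

Lemma tail_norm_bound (x : R) : exists M, forall n, Rabs (tail_norm x n) <= M.
Proof.
destruct (phi_level_bound L eta hL x) as [M [hM hb]].
set (S0 := Rabs (slope L eta) + 2 * Rabs eta).
exists ((1 + (S0 + S0) * Rabs x) * M * M + kap * x ^ 2 * M * M + kap * x ^ 2 * (M * M)).
intros n; unfold tail_norm.
assert (hk : forall m, Rabs (kappa (L + INR m) eta * x ^ 2) <= kap * x ^ 2).
{ intros m; rewrite Rabs_pos_eq.
  - apply Rmult_le_compat_r; [apply pow2_ge_0|apply kappa_decr; assumption].
  - apply Rmult_le_pos; [apply Rlt_le, kappa_pos; assumption|apply pow2_ge_0]. }
assert (hs : forall m, Rabs (slope (L + INR m) eta) <= S0)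
  by (intros; apply slope_level_bound; assumption).
eapply Rle_trans; [apply Rabs_triang|]; apply Rplus_le_compat.
- unfold Rminus at 1; eapply Rle_trans; [apply Rabs_triang|]; rewrite Rabs_Ropp.
  apply Rplus_le_compat; rewrite !(Rabs_mult (_ * phi _ _ _)), !(Rabs_mult _ (phi _ _ _)).
  + repeat apply Rmult_le_compat; try apply hb; try apply Rabs_pos;
      try (apply Rmult_le_pos; apply Rabs_pos).
    eapply Rle_trans; [apply Rabs_triang|]; rewrite Rabs_R1, Rabs_mult.
    apply Rplus_le_compat_l, Rmult_le_compat_r; [apply Rabs_pos|].
    unfold Rminus; eapply Rle_trans; [apply Rabs_triang|]; rewrite Rabs_Ropp.
    apply Rplus_le_compat; apply hs.
  + repeat apply Rmult_le_compat; try apply hb; try apply Rabs_pos; try apply hk;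
      try (apply Rmult_le_pos; apply Rabs_pos).
- rewrite Rabs_mult; apply Rmult_le_compat; try apply Rabs_pos; [apply hk|].
  rewrite <- (Rsqr_pow2 (phi _ _ _)); unfold Rsqr; rewrite Rabs_mult.
  apply Rmult_le_compat; try apply hb; apply Rabs_pos.
Qed.

Lemma norm_psi (x : R) : ip d (v x) (v x) = tail_norm x 0.
Proof.
apply is_series_unique.
apply (is_lim_seq_ext (fun n => tail_norm x 0 - d (S n) * (x ^ 2) ^ S n * tail_norm x (S n))
         (sum_n (fun k => d k * v x k * v x k)) (tail_norm x 0)).
- intros n; rewrite sum_n_Reals; symmetry; apply norm_partial_sum.
- rewrite <- (Rminus_0_r (tail_norm x 0)) at 1.
  apply is_lim_seq_minus'; [apply is_lim_seq_const|].
  destruct (tail_norm_bound x) as [M hM].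
  apply is_lim_seq_abs_0.
  apply is_lim_seq_le_le with (fun _ => 0) (fun n => M * (d (S n) * (x ^ 2) ^ S n)).
  + intros n; split; [apply Rabs_pos|].
    rewrite Rabs_mult, Rmult_comm, (Rabs_pos_eq (d (S n) * _)).
    * apply Rmult_le_compat_r; [|apply hM].
      apply Rmult_le_pos; [apply Rlt_le, weight_pos|apply pow_le, pow2_ge_0].
    * apply Rmult_le_pos; [apply Rlt_le, weight_pos|apply pow_le, pow2_ge_0].
  + apply is_lim_seq_const.
  + replace (Finite 0) with (Rbar_mult M 0) by (simpl; f_equal; ring).
    apply is_lim_seq_scal_l, (is_lim_seq_incr_1 (fun n => d n * (x ^ 2) ^ n)).
    apply ex_series_lim_0, entire_ex_series, weight_entire.
Qed.

Lemma norm_psi_at_zero (c : R) :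
  phi L eta c = 0 -> ip d (v c) (v c) = kap * c ^ 2 * phi (L + 1) eta c ^ 2.
Proof.
intros h0; rewrite norm_psi; unfold tail_norm.
rewrite phi_0_level, h0, level_S; simpl INR; rewrite Rplus_0_r; ring.
Qed.

End Coulomb.

(** * Spectral moments and the removal of poles *)

Section Moments.

Context (L eta : R).
Context (hL : - 3 / 2 < L) (he : slope L eta * (L + 1) = eta).

Local Notation d := (weight L eta).
Local Notation a := (jacobi_a L eta).
Local Notation b := (jacobi_b L eta).
Local Notation kap := (kappa L eta).
Local Notation J := (jacobi a b).
Local Notation v := (psi L eta).

Definition orbit (n : nat) : nat -> R := Nat.iter n J (basis 0).

Lemma kappa_0_pos : 0 < kap.
Proof.
pose proof (kappa_pos L eta hL 0) as h; simpl INR in h; rewrite Rplus_0_r in h; exact h.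
Qed.

Lemma jacobi_sum (f : nat -> R) (U : nat -> nat -> R) (n i : nat) :
  J (fun i => sum_f_R0 (fun j => f j * U j i) n) i = sum_f_R0 (fun j => f j * J (U j) i) n.
Proof.
induction n as [|n IH].
- simpl; unfold jacobi; destruct i; ring.
- rewrite tech5, <- IH; unfold jacobi; destruct i; rewrite ?tech5; ring.
Qed.

(** The coefficient of [x^n] in [psi x], a finitely supported vector. *)
Definition psi_coef (n i : nat) : R :=
  if le_dec i n then coef (L + INR (S i)) eta (n - i) else 0.

(** The equation [psi x = x J (psi x) + phi(x) e_0], coefficient by coefficient. *)
Lemma psi_coef_S (n i : nat) :
  psi_coef (S n) i = J (psi_coef n) i + coef L eta (S n) * basis 0 i.
Proof.
assert (H1 : forall m, coef (L + INR m) eta 1 = coef (L + INR (S m)) eta 1 + b m).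
{ intros m; unfold jacobi_b; rewrite level_S.
  apply coef_three_term_1; [apply level_gt, hL|apply level_slope; assumption]. }
assert (H2 : forall m k, coef (L + INR m) eta (S (S k)) = coef (L + INR (S m)) eta (S (S k))
   + b m * coef (L + INR (S m)) eta (S k) - a m * coef (L + INR (S (S m))) eta k).
{ intros m k; unfold jacobi_b, jacobi_a; rewrite !level_S.
  apply coef_three_term; [apply level_gt, hL|apply level_slope; assumption]. }
assert (E0 : coef L eta (S n) = coef (L + INR 0) eta (S n)) by (simpl INR; rewrite Rplus_0_r; reflexivity).
unfold jacobi, psi_coef, basis.
destruct i as [|i].
- destruct (le_dec 0 (S n)), (le_dec 0 n), (Nat.eq_dec 0 0); try lia.
  rewrite E0, !Nat.sub_0_r; destruct (le_dec 1 n) as [h|h].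
  + destruct n as [|n]; [lia|]; rewrite (H2 0%nat); replace (S n - 1)%nat with n by lia; ring.
  + replace n with 0%nat by lia; rewrite (H1 0%nat), (coef_0 (L + INR 1)); ring.
- destruct (Nat.eq_dec 0 (S i)); [lia|].
  destruct (le_dec (S i) (S n)) as [h|h].
  + destruct (le_dec i n); [|lia].
    destruct (le_dec (S i) n) as [h1|h1].
    * destruct (le_dec (S (S i)) n) as [h2|h2].
      -- set (k := (n - S (S i))%nat).
         replace (n - i)%nat with (S (S k)) by (unfold k; lia).
         replace (n - S i)%nat with (S k) by (unfold k; lia).
         replace (S n - S i)%nat with (S (S k)) by (unfold k; lia).
         rewrite (H2 (S i) k); ring.
      -- replace (n - i)%nat with 1%nat by lia; replace (n - S i)%nat with 0%nat by lia.
         replace (S n - S i)%nat with 1%nat by lia; rewrite (H1 (S i)), coef_0; ring.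
    * destruct (le_dec (S (S i)) n); [lia|].
      replace (n - i)%nat with 0%nat by lia; replace (S n - S i)%nat with 0%nat by lia.
      rewrite !coef_0; ring.
  + destruct (le_dec i n); [lia|]; destruct (le_dec (S i) n); [lia|];
      destruct (le_dec (S (S i)) n); [lia|]; ring.
Qed.

Lemma psi_coef_orbit (n i : nat) :
  psi_coef n i = sum_f_R0 (fun j => coef L eta (n - j) * orbit j i) n.
Proof.
revert i; induction n as [|n IH]; intros i.
- unfold psi_coef; simpl; rewrite coef_0; unfold basis.
  destruct (le_dec i 0), (Nat.eq_dec 0 i); try lia; try ring.
  replace (0 - i)%nat with 0%nat by lia; rewrite coef_0; ring.
- rewrite psi_coef_S, (functional_extensionality _ _ IH), jacobi_sum.
  rewrite (decomp_sum _ (S n)) by lia; rewrite Nat.sub_0_r; simpl pred.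
  rewrite Rplus_comm; f_equal.
Qed.

Definition moment (n : nat) : R := orbit n 0%nat.

(** The moments of the spectral measure at the first basis vector are the
    Taylor coefficients of [phi_(L+1) / phi_L]. *)
Lemma PS_mult_moment (n : nat) :
  PS_mult (coef L eta) moment n = coef (L + 1) eta n.
Proof.
pose proof (psi_coef_orbit n 0) as h; unfold psi_coef in h.
destruct (le_dec 0 n); [|lia].
rewrite Nat.sub_0_r, level_S in h; simpl INR in h; rewrite Rplus_0_r in h.
rewrite h; unfold PS_mult; rewrite <- (sum_f_R0_skip _ n); apply sum_eq; intros i hi.
unfold moment; replace (n - (n - i))%nat with i by lia; reflexivity.
Qed.

(** The moments that remain once the atoms at [1 / c], for [c] in [X], are removed. *)
Definition moment_off (X : list R) (n : nat) : R :=
  moment n - sum_over (fun c => (/ c) ^ n / (kap * c ^ 2)) X.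

Definition zero_of_phi (c : R) : Prop := c <> 0 /\ phi L eta c = 0.

(** Numerator and denominator of the meromorphic function with Taylor coefficients
    [moment_off X]: the poles in [X] have cancelled and the others are unchanged. The
    differential relation [p' = - kappa c g] at the zeros says that they are simple with
    the same residue as for [phi_(L+1) / phi_L], so that the next one can be removed. *)
Lemma moment_off_quotient (X : list R) :
  NoDup X -> (forall c, In c X -> zero_of_phi c) ->
  exists p g, entire p /\ entire g /\ p 0%nat = 1 /\
    (forall n, g n = PS_mult p (moment_off X) n) /\
    (forall c, c <> 0 -> (PSeries p c = 0 <-> phi L eta c = 0 /\ ~ In c X)) /\
    (forall c, c <> 0 -> PSeries p c = 0 ->
       PSeries (PS_derive p) c = - kap * c * PSeries g c /\ PSeries g c <> 0).
Proof.
pose proof kappa_0_pos as hk.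
induction X as [|z X IH]; intros hnd hX.
- exists (coef L eta), (coef (L + 1) eta).
  assert (h1 : entire (coef (L + 1) eta)).
  { pose proof (coef_level_entire L eta hL 1) as h; simpl INR in h; exact h. }
  split; [apply coef_entire; exact hL|]; split; [exact h1|]; split; [apply coef_0|].
  split; [|split].
  + intros n; rewrite <- PS_mult_moment; unfold PS_mult; apply sum_eq; intros i _.
    unfold moment_off; simpl; ring.
  + intros c hc; unfold phi; simpl; tauto.
  + intros c hc h0; split.
    * rewrite (phi_derive L eta hL he); unfold phi; rewrite h0; ring.
    * apply (phi_1_nonzero_at_zero L eta hL he c hc h0).
- apply NoDup_cons_iff in hnd; destruct hnd as [hz hnd].
  destruct (IH hnd (fun c h => hX c (or_intror h))) as [p [g [hp [hg [hp0 [hE [hzero hres]]]]]]].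
  destruct (hX z (or_introl eq_refl)) as [hz0 hzphi].
  assert (hpz : PSeries p z = 0) by (apply hzero; auto).
  destruct (entire_remove_zero p z hp hz0 hpz) as [h [hh hph]].
  assert (hder : forall x, PSeries (PS_derive p) x
                   = - / z * PSeries h x + (1 - x / z) * PSeries (PS_derive h) x).
  { intros x; rewrite <- Derive_PSeries by (apply entire_lt_radius, hp).
    pose proof (is_derive_PSeries h x (entire_lt_radius h x hh)) as hd.
    rewrite (Derive_ext (PSeries p) (fun t => (1 - t / z) * PSeries h t)).
    - assert (hl : is_derive (fun t => 1 - t / z) x (- / z))
        by (auto_derive; [trivial|field; exact hz0]).
      rewrite Derive_mult by (eexists; (exact hl || exact hd)).
      f_equal; f_equal; apply is_derive_unique; assumption.
    - intros t; rewrite <- PSeries_lin_mult by exact hh; apply PSeries_ext, hph. }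
  destruct (hres z hz0 hpz) as [hz1 hgz].
  assert (hhz : PSeries h z = kap * z ^ 2 * PSeries g z).
  { rewrite hder in hz1.
    replace (1 - z / z) with 0 in hz1 by (field; exact hz0).
    apply Rmult_eq_reg_l with (- / z); [|apply Ropp_neq_0_compat, Rinv_neq_0_compat, hz0].
    rewrite Rmult_0_l, Rplus_0_r in hz1; rewrite hz1; field; exact hz0. }
  (* the weight of the atom at [1 / z]; it makes [g - w h] vanish at [z] *)
  set (w := / (kap * z ^ 2)).
  assert (hkz : kap * z ^ 2 <> 0)
    by (apply Rmult_integral_contrapositive; split; [lra|apply pow_nonzero, hz0]).
  assert (hw : entire (fun n => g n - w * h n)) by (apply entire_minus_scal; assumption).
  assert (hw0 : PSeries (fun n => g n - w * h n) z = 0).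
  { rewrite PSeries_minus_scal, hhz by assumption; unfold w; field; split; [exact hz0|lra]. }
  destruct (entire_remove_zero _ z hw hz0 hw0) as [k [hkent hkE]].
  assert (hoff : moment_off (z :: X) = fun n => moment_off X n - w * (/ z) ^ n).
  { apply functional_extensionality; intros n; unfold moment_off, w; simpl; unfold Rdiv; ring. }
  assert (hpc : forall c, PSeries p c = (1 - c / z) * PSeries h c).
  { intros c; rewrite <- PSeries_lin_mult by exact hh; apply PSeries_ext, hph. }
  assert (hcz : forall c, c <> z -> 1 - c / z <> 0).
  { intros c hc h1; apply hc; apply Rmult_eq_reg_r with (/ z); [|apply Rinv_neq_0_compat, hz0].
    rewrite Rinv_r by exact hz0; unfold Rdiv in h1; lra. }
  exists h, k; split; [exact hh|]; split; [exact hkent|]; split; [|split; [|split]].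
  + rewrite <- hp0, (hph 0%nat); reflexivity.
  + apply (lin_mult_inj z); intros n.
    rewrite <- hkE, <- (functional_extensionality _ _ (PS_mult_lin_mult z h (moment_off (z :: X))) : _ = lin_mult z _).
    rewrite hoff, PS_mult_minus_scal, PS_mult_geometric, hE.
    do 2 f_equal; apply functional_extensionality, hph.
  + intros c hc; destruct (Req_dec c z) as [->|hne].
    * split; [|intros [_ hn]; destruct hn; left; reflexivity].
      intros h0; rewrite hhz in h0; apply Rmult_integral in h0; tauto.
    * specialize (hcz c hne); specialize (hzero c hc); rewrite hpc in hzero; split.
      -- intros h0; rewrite h0, Rmult_0_r in hzero.
         destruct (proj1 hzero eq_refl) as [h1 h2]; split; [exact h1|].
         intros [h3|h3]; [congruence|tauto].
      -- intros [h1 h2]; apply Rmult_eq_reg_l with (1 - c / z); [|exact hcz].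
         rewrite Rmult_0_r; apply hzero; split; [exact h1|].
         intros h3; apply h2; right; exact h3.
  + intros c hc h0.
    assert (hne : c <> z).
    { intros ->; rewrite hhz in h0; apply Rmult_integral in h0; tauto. }
    specialize (hcz c hne).
    assert (hpc0 : PSeries p c = 0) by (rewrite hpc, h0; ring).
    destruct (hres c hc hpc0) as [h1 h2].
    rewrite hder, h0, Rmult_0_r, Rplus_0_l in h1.
    assert (hgk : PSeries g c = (1 - c / z) * PSeries k c).
    { rewrite <- PSeries_lin_mult by exact hkent.
      rewrite <- (PSeries_ext _ _ c hkE), PSeries_minus_scal, h0 by assumption; ring. }
    rewrite hgk in h1, h2; split.
    * apply Rmult_eq_reg_l with (1 - c / z); [|exact hcz]; rewrite h1; ring.
    * intros h3; apply h2; rewrite h3; ring.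
Qed.

End Moments.

(** * Completeness of the eigenvectors *)

Section Spectral.

Context (L eta : R).
Context (hL : - 3 / 2 < L) (he : slope L eta * (L + 1) = eta).

Local Notation d := (weight L eta).
Local Notation a := (jacobi_a L eta).
Local Notation b := (jacobi_b L eta).
Local Notation kap := (kappa L eta).
Local Notation J := (jacobi a b).
Local Notation v := (psi L eta).
Local Notation Res := (residual d v).
Local Notation zeros X := (NoDup X /\ forall c, In c X -> zero_of_phi L eta c).
Local Notation orb := (orbit L eta).

Lemma in_l2_J (u : nat -> R) : in_l2 d u -> in_l2 d (J u).
Proof.
apply (in_l2_jacobi d a b kap (weight_pos L eta hL) (weight_S L eta)).
- intros n; apply jacobi_a_bound; assumption.
- intros n; apply jacobi_b_bound; assumption.
Qed.

Lemma in_l2_orbit (n : nat) : in_l2 d (orb n).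
Proof. induction n as [|n IH]; [apply in_l2_basis|apply in_l2_J, IH]. Qed.

Lemma psi_eigenvector (c : R) : zero_of_phi L eta c -> J (v c) = fun n => / c * v c n.
Proof.
intros [hc h0]; rewrite (jacobi_psi L eta hL he c hc), h0.
apply functional_extensionality; intros n; unfold lin, Rdiv; ring.
Qed.

Lemma norm_psi_pos (c : R) : zero_of_phi L eta c -> 0 < ip d (v c) (v c).
Proof.
intros [hc h0]; rewrite (norm_psi_at_zero L eta hL he c h0).
pose proof (kappa_0_pos L eta hL).
pose proof (phi_1_nonzero_at_zero L eta hL he c hc h0).
apply Rmult_lt_0_compat; [apply Rmult_lt_0_compat|]; [assumption| |]; apply pow2_gt_0; assumption.
Qed.

Lemma psi_orthogonal_family (X : list R) :
  zeros X -> orthogonal_family d a b v Rinv X.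
Proof.
intros [hnd hX]; split; [exact hnd|split].
- intros c hc; specialize (hX c hc); split; [|split].
  + apply (in_l2_psi L eta hL he).
  + apply norm_psi_pos, hX.
  + apply psi_eigenvector, hX.
- intros c c' hc hc' hne; apply hX in hc, hc'; destruct hc as [h1 h2], hc' as [h1' h2'].
  rewrite (christoffel_darboux L eta hL he) by assumption.
  rewrite h2; unfold Rdiv; ring.
Qed.

Lemma ip_J_psi (u : nat -> R) (c : R) :
  zero_of_phi L eta c -> in_l2 d u -> ip d (J u) (v c) = / c * ip d u (v c).
Proof.
intros hc hu; rewrite (ip_jacobi_sym L eta hL he), psi_eigenvector by (trivial; apply (in_l2_psi L eta hL he)).
unfold ip; rewrite <- Series_scal_l; apply Series_ext; intros; ring.
Qed.

Lemma ip_orbit_psi (n : nat) (c : R) :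
  zero_of_phi L eta c -> ip d (orb n) (v c) = (/ c) ^ n * phi (L + 1) eta c.
Proof.
intros hc; induction n as [|n IH].
- simpl orbit; rewrite ip_basis_l; unfold psi; rewrite level_S; simpl.
  rewrite Rplus_0_r; ring.
- change (orb (S n)) with (J (orb n)); rewrite ip_J_psi, IH by (trivial; apply in_l2_orbit).
  simpl; ring.
Qed.

Lemma residual_J (X : list R) (u w : nat -> R) :
  zeros X -> in_l2 d u -> in_l2 d w -> Res X (J u) w = Res X u (J w).
Proof.
intros hX; apply (residual_jacobi d a b kap (weight_pos L eta hL) (weight_S L eta))
  with (mu := Rinv).
- intros n; apply jacobi_a_bound; assumption.
- intros n; apply jacobi_b_bound; assumption.
- apply psi_orthogonal_family, hX.
Qed.

Lemma residual_cs (X : list R) (u w : nat -> R) :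
  zeros X -> in_l2 d u -> in_l2 d w -> Res X u w ^ 2 <= Res X u u * Res X w w.
Proof.
intros hX; apply (residual_cauchy_schwarz d a b (weight_pos L eta hL) v Rinv).
apply psi_orthogonal_family, hX.
Qed.

Lemma residual_pos (X : list R) (u : nat -> R) :
  zeros X -> in_l2 d u -> 0 <= Res X u u.
Proof.
intros hX; apply (bessel d a b (weight_pos L eta hL) v Rinv).
apply psi_orthogonal_family, hX.
Qed.

Lemma residual_orbit (X : list R) (i j : nat) :
  zeros X -> Res X (orb i) (orb j) = moment_off L eta X (i + j).
Proof.
intros hX; revert i; induction j as [|j IH]; intros i.
- rewrite Nat.add_0_r; unfold residual, moment_off; f_equal.
  + change (orb 0) with (basis 0); rewrite ip_sym, ip_basis_l; unfold moment; simpl; ring.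
  + apply sum_over_ext; intros c hc; apply hX in hc.
    rewrite !ip_orbit_psi by exact hc.
    destruct hc as [hc h0]; rewrite (norm_psi_at_zero L eta hL he c h0).
    pose proof (phi_1_nonzero_at_zero L eta hL he c hc h0); pose proof (kappa_0_pos L eta hL).
    rewrite pow_inv; simpl; field; repeat split; try assumption; try lra; apply pow_nonzero, hc.
- change (orb (S j)) with (J (orb j)).
  rewrite <- residual_J by (trivial; apply in_l2_orbit).
  change (J (orb i)) with (orb (S i)); rewrite IH; f_equal; lia.
Qed.

(** The limit of the ratios of consecutive even moments is the square of a zero of the
    denominator, hence of a zero not in [X], and the first ratio is at least the limit. *)
Lemma residual_gap (X : list R) (r : R) :
  zeros X -> 0 < r ->
  (forall c, zero_of_phi L eta c -> ~ In c X -> r <= c ^ 2) ->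
  r * Res X (orb 1) (orb 1) <= Res X (orb 0) (orb 0).
Proof.
intros hX hr hgap.
set (s := moment_off L eta X).
rewrite !residual_orbit by exact hX; fold s; simpl Nat.add.
assert (hpos : forall n, 0 <= s (2 * n)%nat).
{ intros n; replace (2 * n)%nat with (n + n)%nat by lia; unfold s.
  rewrite <- residual_orbit by exact hX; apply residual_pos; [exact hX|apply in_l2_orbit]. }
assert (hconv : forall n, s (2 * S n)%nat ^ 2 <= s (2 * n)%nat * s (2 * S (S n))%nat).
{ intros n.
  pose proof (residual_cs X (orb n) (orb (S (S n))) hX (in_l2_orbit _) (in_l2_orbit _)) as h.
  rewrite !residual_orbit in h by exact hX; fold s in h.
  replace (2 * S n)%nat with (n + S (S n))%nat by lia.
  replace (2 * n)%nat with (n + n)%nat by lia.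
  replace (2 * S (S n))%nat with (S (S n) + S (S n))%nat by lia; exact h. }
destruct (Rle_lt_or_eq_dec 0 (s 2%nat) (hpos 1%nat)) as [h2|h2].
2: { rewrite <- h2, Rmult_0_r; apply (hpos 0%nat). }
assert (hstrict : forall n, 0 < s (2 * n)%nat /\ 0 < s (2 * S n)%nat).
{ induction n as [|n [IH1 IH2]].
  - split; [|exact h2]; pose proof (hconv 0%nat) as h; simpl Nat.mul in *.
    destruct (Rle_lt_or_eq_dec 0 (s 0%nat) (hpos 0%nat)) as [h0|h0]; [exact h0|].
    rewrite <- h0 in h; pose proof (pow_lt _ 2 h2); lra.
  - split; [exact IH2|].
    destruct (Rle_lt_or_eq_dec 0 _ (hpos (S (S n)))) as [h0|h0]; [exact h0|].
    pose proof (hconv n) as h; rewrite <- h0 in h; pose proof (pow_lt _ 2 IH2); lra. }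
destruct (moment_off_quotient L eta hL he X (proj1 hX) (proj2 hX))
  as [p [g [hp [hg [hp0 [hE [hzero _]]]]]]]; fold s in hE.
destruct (even_moment_ratio_zero s p g (fun n => proj1 (hstrict n)) hconv hp hg hE)
  as [x [hx hpx]].
assert (hx0 : x <> 0).
{ intros ->; rewrite PSeries_0, hp0 in hpx; lra. }
destruct (proj1 (hzero x hx0) hpx) as [h1 h3].
pose proof (hgap x (conj hx0 h1) h3) as h4.
apply Rmult_le_reg_r with (/ s 2%nat); [apply Rinv_0_lt_compat, h2|].
rewrite Rmult_assoc, Rinv_r by lra; unfold Rdiv in hx; lra.
Qed.

Lemma residual_basis_0_le (X : list R) : zeros X -> Res X (orb 0) (orb 0) <= 1.
Proof.
intros hX.
eapply Rle_trans; [apply (residual_le d a b v Rinv), psi_orthogonal_family, hX|].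
simpl orbit; rewrite ip_basis_l; unfold basis; simpl; lra.
Qed.

Lemma residual_basis_0 (X : list R) :
  zeros X -> kap * Res X (orb 0) (orb 0) = kap - sum_over (fun c => / c ^ 2) X.
Proof.
intros hX; rewrite residual_orbit by exact hX; unfold moment_off, moment; simpl orbit.
pose proof (kappa_0_pos L eta hL).
rewrite (sum_over_ext _ (fun c => / kap * / c ^ 2)).
- rewrite sum_over_scal; unfold basis; simpl; field; lra.
- intros c hc; apply hX in hc; destruct hc as [hc _]; simpl; field; split; [exact hc|lra].
Qed.

Section Exhaustion.

(** [hgap] says quantitatively that the lists exhaust the zeros. *)
Context (X : nat -> list R).
Context (hX : forall K, zeros (X K)).
Context (hgap : forall K c, zero_of_phi L eta c -> ~ In c (X K) -> INR K <= kap * c ^ 2).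

Definition vanishes (u : nat -> R) : Prop :=
  in_l2 d u /\ is_lim_seq (fun K => Res (X K) u u) 0.

Lemma squeeze_0 (u w : nat -> R) :
  (forall n, 0 <= u n <= w n) -> is_lim_seq w 0 -> is_lim_seq u 0.
Proof.
intros h hw; apply is_lim_seq_le_le with (fun _ => 0) w; [exact h|apply is_lim_seq_const|exact hw].
Qed.

Lemma vanishes_lin (x : R) (u w : nat -> R) :
  vanishes u -> vanishes w -> vanishes (lin x u w).
Proof.
intros [hu lu] [hw lw].
assert (hpos := weight_pos L eta hL).
split; [apply (in_l2_lin d hpos); assumption|].
apply squeeze_0 with (fun K => 2 * x ^ 2 * Res (X K) u u + 2 * Res (X K) w w).
- intros K; pose proof (psi_orthogonal_family _ (hX K)) as hf.
  split; [apply residual_pos; [apply hX|apply (in_l2_lin d hpos); assumption]|].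
  pose proof (residual_pos (X K) (lin (- x) u w) (hX K) (in_l2_lin d hpos _ _ _ hu hw)) as h.
  rewrite !(residual_lin_l d a b hpos v Rinv), !(residual_lin_r d a b hpos v Rinv) in *
    by (assumption || apply (in_l2_lin d hpos); assumption).
  rewrite (residual_sym d v (X K) w u) in *; lra.
- replace (Finite 0) with (Finite (2 * x ^ 2 * 0 + 2 * 0)) by (f_equal; ring).
  apply is_lim_seq_plus'; apply is_lim_seq_mult'; trivial; apply is_lim_seq_const.
Qed.

(** [Res (J J u) (J J u) = Res (J u) (J J J u)], to which the Cauchy-Schwarz inequality
    applies. *)
Lemma vanishes_J_J (u : nat -> R) : in_l2 d u -> vanishes (J u) -> vanishes (J (J u)).
Proof.
intros hu [h1 hlim].
pose proof (in_l2_J _ h1) as h2; pose proof (in_l2_J _ h2) as h3.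
split; [exact h2|].
apply squeeze_0 with (fun K => sqrt (ip d (J (J (J u))) (J (J (J u))) * Res (X K) (J u) (J u))).
- intros K; split; [apply residual_pos; [apply hX|exact h2]|].
  rewrite residual_J by (trivial; apply hX).
  rewrite <- (sqrt_pow2 (Res (X K) (J u) (J (J (J u))))).
  + apply sqrt_le_1_alt.
    eapply Rle_trans; [apply residual_cs; trivial; apply hX|].
    rewrite Rmult_comm; apply Rmult_le_compat_r; [apply residual_pos; trivial; apply hX|].
    apply (residual_le d a b v Rinv), psi_orthogonal_family, hX.
  + rewrite <- residual_J by (trivial; apply hX); apply residual_pos; trivial; apply hX.
- rewrite <- sqrt_0.
  apply is_lim_seq_continuous; [apply continuity_pt_sqrt; lra|].
  rewrite <- (Rmult_0_r (ip d (J (J (J u))) (J (J (J u))))).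
  apply is_lim_seq_mult'; [apply is_lim_seq_const|exact hlim].
Qed.

Lemma vanishes_J_orbit : vanishes (J (basis 0)).
Proof.
split; [apply (in_l2_orbit 1)|].
change (J (basis 0)) with (orb 1).
pose proof (kappa_0_pos L eta hL) as hk.
apply (is_lim_seq_incr_1 (fun K => Res (X K) (orb 1) (orb 1))).
apply squeeze_0 with (fun K => kap * / INR (S K)).
- intros K; split; [apply residual_pos; [apply hX|apply in_l2_orbit]|].
  assert (hK : 0 < INR (S K)) by (apply lt_0_INR; lia).
  assert (h : INR (S K) / kap * Res (X (S K)) (orb 1) (orb 1) <= 1).
  { eapply Rle_trans; [apply residual_gap|apply residual_basis_0_le]; try apply hX.
    - apply Rdiv_lt_0_compat; assumption.
    - intros c hc hn; apply Rle_div_l; [exact hk|].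
      rewrite Rmult_comm; apply hgap; assumption. }
  apply Rmult_le_reg_l with (INR (S K) / kap); [apply Rdiv_lt_0_compat; assumption|].
  replace (INR (S K) / kap * (kap * / INR (S K))) with 1 by (field; lra); exact h.
- rewrite <- (Rmult_0_r kap); apply is_lim_seq_mult'; [apply is_lim_seq_const|].
  apply (is_lim_seq_incr_1 (fun K => / INR K)).
  exact is_lim_seq_inv_INR.
Qed.

(** The next basis vector is [J e_m] plus multiples of [e_m] and [e_(m-1)]. *)
Lemma vanishes_J_basis (m : nat) : vanishes (J (basis m)).
Proof.
induction m as [| |m IH1 IH2] using nat_ind2.
- apply vanishes_J_orbit.
- replace (basis 1) with (lin (b 0) (basis 0) (J (basis 0))).
  + rewrite jacobi_lin; apply vanishes_lin; [apply vanishes_J_orbit|].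
    apply vanishes_J_J; [apply in_l2_basis|apply vanishes_J_orbit].
  + rewrite jacobi_basis; apply functional_extensionality; intros n; unfold lin; ring.
- replace (basis (S (S m))) with
    (lin (b (S m)) (basis (S m)) (lin (- a m) (basis m) (J (basis (S m))))).
  + rewrite !jacobi_lin; apply vanishes_lin; [exact IH2|].
    apply vanishes_lin; [exact IH1|].
    apply vanishes_J_J; [apply in_l2_basis|exact IH2].
  + rewrite jacobi_basis; apply functional_extensionality; intros n; unfold lin; ring.
Qed.

Lemma norm_J_basis (n : nat) :
  ip d (J (basis n)) (J (basis n)) / d n
  = b n ^ 2 + a n + match n with O => 0 | S m => a m end.
Proof.
rewrite (ip_jacobi_sym L eta hL he) by (try apply in_l2_J; apply in_l2_basis).
rewrite ip_basis_l; pose proof (weight_pos L eta hL n).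
unfold Rdiv; rewrite Rmult_comm, <- Rmult_assoc, Rinv_l, Rmult_1_l by lra.
unfold jacobi, basis; destruct n as [|[|n]];
  repeat (match goal with |- context [Nat.eq_dec ?p ?q] => destruct (Nat.eq_dec p q) end; try lia); ring.
Qed.

Lemma sum_norm_J_basis (N : nat) :
  sum_f_R0 (fun n => ip d (J (basis n)) (J (basis n)) / d n) N
  = kap - kappa (L + INR (S N)) eta - a N.
Proof.
induction N as [|N IH].
- simpl sum_f_R0; rewrite norm_J_basis.
  pose proof (kappa_diff L eta hL he 0) as h; simpl (INR 0) in h; rewrite Rplus_0_r in h; lra.
- rewrite tech5, IH, norm_J_basis; pose proof (kappa_diff L eta hL he (S N)); lra.
Qed.

(** On the first [N + 1] basis vectors, the square of the Hilbert-Schmidt norm of the operator is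
    almost [kappa]; its expansion in the eigenvectors is at most the sum of the [1 / c^2] and what
    is left over, and [residual_basis_0] compares that sum with [kappa]. *)
Lemma trace_inequality (K N : nat) :
  kap * Res (X K) (orb 0) (orb 0)
  <= kappa (L + INR (S N)) eta + a N
     + sum_f_R0 (fun n => Res (X K) (J (basis n)) (J (basis n)) / d n) N.
Proof.
pose proof (weight_pos L eta hL) as hd.
rewrite residual_basis_0 by apply hX.
pose proof (sum_norm_J_basis N) as hS.
assert (E : forall n, ip d (J (basis n)) (J (basis n)) / d n
  = Res (X K) (J (basis n)) (J (basis n)) / d n
    + sum_over (fun c => / c ^ 2 * (d n * v c n ^ 2 / ip d (v c) (v c))) (X K)).
{ intros n; specialize (hd n).
  rewrite (sum_over_ext (fun c => / c ^ 2 * _) (fun c => / d n *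
      (ip d (J (basis n)) (v c) * ip d (J (basis n)) (v c) / ip d (v c) (v c)))).
  - rewrite sum_over_scal; unfold residual, Rdiv; ring.
  - intros c hc; apply (hX K) in hc; pose proof (norm_psi_pos c hc).
    rewrite ip_J_psi, ip_basis_l by (trivial; apply in_l2_basis).
    destruct hc as [hc _]; field; repeat split; try assumption; lra. }
assert (E' : sum_f_R0 (fun n => ip d (J (basis n)) (J (basis n)) / d n) N
  = sum_f_R0 (fun n => Res (X K) (J (basis n)) (J (basis n)) / d n) N
    + sum_over (fun c => / c ^ 2 * (sum_f_R0 (fun n => d n * v c n ^ 2) N / ip d (v c) (v c))) (X K)).
{ clear hS; induction N as [|N IH]; [apply E|].
  rewrite !tech5, IH, E.
  rewrite (sum_over_ext (fun c => / c ^ 2 * (sum_f_R0 _ (S N) / _)) (fun c => 1 *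
     (/ c ^ 2 * (sum_f_R0 (fun n => d n * v c n ^ 2) N / ip d (v c) (v c))) +
      / c ^ 2 * (d (S N) * v c (S N) ^ 2 / ip d (v c) (v c)))).
  - rewrite sum_over_lin; ring.
  - intros c _; rewrite tech5; unfold Rdiv; ring. }
assert (h : sum_over (fun c => / c ^ 2 * (sum_f_R0 (fun n => d n * v c n ^ 2) N / ip d (v c) (v c))) (X K)
            <= sum_over (fun c => / c ^ 2) (X K)).
{ apply sum_over_le; intros c hc; apply (hX K) in hc; pose proof (norm_psi_pos c hc) as hn.
  rewrite <- (Rmult_1_r (/ c ^ 2)) at 2; apply Rmult_le_compat_l.
  - apply Rlt_le, Rinv_0_lt_compat, pow2_gt_0, hc.
  - apply Rle_div_l; [exact hn|]; rewrite Rmult_1_l.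
    apply (ip_partial_le d hd), (in_l2_psi L eta hL he). }
lra.
Qed.

Lemma residual_basis_0_lim : is_lim_seq (fun K => Res (X K) (orb 0) (orb 0)) 0.
Proof.
pose proof (kappa_0_pos L eta hL) as hk.
assert (hN : is_lim_seq (fun N => kappa (L + INR (S N)) eta + a N) (0 + 0)).
{ apply is_lim_seq_plus'; [|apply jacobi_a_lim; assumption].
  apply (is_lim_seq_incr_1 (fun N => kappa (L + INR N) eta)), kappa_lim; assumption. }
apply is_lim_seq_spec; intros eps.
assert (heps : 0 < kap * eps / 2) by (pose proof (cond_pos eps); nra).
apply is_lim_seq_spec in hN; destruct (hN (mkposreal _ heps)) as [N hN0].
specialize (hN0 N (le_n N)); simpl in hN0; apply Rabs_lt_between in hN0.
assert (hK : is_lim_seq (fun K => sum_f_R0 (fun n => Res (X K) (J (basis n)) (J (basis n)) / d n) N) 0).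
{ replace (Finite 0) with (Finite (sum_f_R0 (fun _ => 0) N))
    by (f_equal; apply sum_eq_R0; reflexivity).
  apply (is_lim_seq_sum (fun n K => Res (X K) (J (basis n)) (J (basis n)) / d n)).
  intros n _; destruct (vanishes_J_basis n) as [_ h].
  unfold Rdiv; rewrite <- (Rmult_0_l (/ d n)).
  apply is_lim_seq_mult'; [exact h|apply is_lim_seq_const]. }
apply is_lim_seq_spec in hK; destruct (hK (mkposreal _ heps)) as [K0 hK0].
exists K0; intros K hKK; specialize (hK0 K hKK); simpl in hK0; apply Rabs_lt_between in hK0.
pose proof (trace_inequality K N) as h.
pose proof (residual_pos (X K) (orb 0) (hX K) (in_l2_orbit 0)) as h0.
rewrite Rminus_0_r, Rabs_pos_eq by exact h0.
apply Rmult_lt_reg_l with kap; [exact hk|].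
change (INR (S N)) with (match N with 0%nat => 1 | S _ => INR N + 1 end) in h; lra.
Qed.

(** The residual of [psi rho] against the first basis vector is [phi_1(rho)] minus its expansion
    in the eigenvectors, and the Cauchy-Schwarz inequality makes it vanish in the limit. *)
Lemma partial_fraction_limit (rho : R) :
  phi L eta rho <> 0 ->
  is_lim_seq (fun K => sum_over (fun c => rho / (c * (c - rho))) (X K))
             (kap * rho * phi (L + 1) eta rho / phi L eta rho).
Proof.
intros h0; destruct (Req_dec rho 0) as [->|hrho].
{ apply is_lim_seq_ext with (fun _ => 0).
  - intros K; transitivity (sum_over (fun _ => 0) (X K)); [symmetry; apply sum_over_0|].
    apply sum_over_ext; intros; unfold Rdiv; ring.
  - replace (kap * 0 * phi (L + 1) eta 0 / phi L eta 0) with 0 by (unfold Rdiv; ring).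
    apply is_lim_seq_const. }
pose proof (kappa_0_pos L eta hL) as hk.
assert (hpsi := in_l2_psi L eta hL he rho).
assert (hlim : is_lim_seq (fun K => Res (X K) (v rho) (orb 0)) 0).
{ apply is_lim_seq_abs_0.
  apply squeeze_0 with (fun K => sqrt (ip d (v rho) (v rho) * Res (X K) (orb 0) (orb 0))).
  - intros K; split; [apply Rabs_pos|].
    rewrite <- sqrt_Rsqr_abs; apply sqrt_le_1_alt; rewrite Rsqr_pow2.
    eapply Rle_trans; [apply residual_cs; [apply hX|exact hpsi|apply in_l2_orbit]|].
    apply Rmult_le_compat_r; [apply residual_pos; [apply hX|apply in_l2_orbit]|].
    apply (residual_le d a b v Rinv), psi_orthogonal_family, hX.
  - rewrite <- sqrt_0.
    apply is_lim_seq_continuous; [apply continuity_pt_sqrt; lra|].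
    rewrite <- (Rmult_0_r (ip d (v rho) (v rho))).
    apply is_lim_seq_mult'; [apply is_lim_seq_const|apply residual_basis_0_lim]. }
apply is_lim_seq_ext with (fun K => kap * rho / phi L eta rho *
   (phi (L + 1) eta rho - Res (X K) (v rho) (orb 0))).
- intros K; unfold residual.
  rewrite (ip_sym d (v rho) (orb 0)); change (orb 0) with (basis 0).
  rewrite ip_basis_l.
  replace (d 0%nat * v rho 0%nat) with (phi (L + 1) eta rho)
    by (unfold psi; rewrite level_S; simpl; rewrite Rplus_0_r; ring).
  rewrite (sum_over_ext _ (fun c => phi L eta rho / (kap * rho) * (rho / (c * (c - rho))))).
  + rewrite sum_over_scal.
    field; repeat split; try assumption; lra.
  + intros c hc; apply (hX K) in hc; destruct hc as [hc hc0].
    assert (hne : rho <> c) by (intros ->; contradiction).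
    rewrite (christoffel_darboux L eta hL he) by assumption.
    rewrite (norm_psi_at_zero L eta hL he c hc0).
    change (basis 0) with (orb 0); rewrite ip_orbit_psi by (split; assumption).
    pose proof (phi_1_nonzero_at_zero L eta hL he c hc hc0).
    simpl; field; repeat split; try assumption; lra.
- replace (kap * rho * phi (L + 1) eta rho / phi L eta rho)
    with (kap * rho / phi L eta rho * (phi (L + 1) eta rho - 0)) by (field; exact h0).
  apply is_lim_seq_mult'; [apply is_lim_seq_const|].
  apply is_lim_seq_minus'; [apply is_lim_seq_const|exact hlim].
Qed.

End Exhaustion.

End Spectral.

(** * Enumerating the zeros *)

Lemma enumeration_NoDup (x : nat -> R) (K : nat) :
  (forall n m, (1 <= n < m)%nat -> x n <> x m) -> NoDup (map x (seq 1 K)).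
Proof.
intros h; apply NoDup_map_NoDup_ForallPairs; [|apply seq_NoDup].
intros i j hi hj hij; apply in_seq in hi, hj.
destruct (Nat.lt_trichotomy i j) as [H|[H|H]]; [|exact H|].
- exfalso; apply (h i j); [lia|exact hij].
- exfalso; apply (h j i); [lia|symmetry; exact hij].
Qed.

Lemma sum_over_enumeration (f : R -> R) (x : nat -> R) (n : nat) :
  sum_over f (map x (seq 1 (S n))) = sum_f_R0 (fun k => f (x (S k))) n.
Proof.
induction n as [|n IH]; [simpl; ring|].
rewrite seq_S, map_app, sum_over_app, IH; simpl; ring.
Qed.

Lemma sum_over_enumeration_ge (f : R -> R) (x : nat -> R) (m : R) (K : nat) :
  (forall n, (1 <= n <= K)%nat -> m <= f (x n)) ->
  INR K * m <= sum_over f (map x (seq 1 K)).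
Proof.
induction K as [|K IH]; intros h; [simpl; lra|].
rewrite seq_S, map_app, sum_over_app, S_INR; simpl.
specialize (IH (fun n hn => h n ltac:(lia))); specialize (h (S K) ltac:(lia)); lra.
Qed.

Section Enumeration.

Context (L eta : R).
Context (hL : - 3 / 2 < L) (he : slope L eta * (L + 1) = eta).
Context (x y : nat -> R).
Context (x_incr : forall n m, (1 <= n < m)%nat -> x n < x m).
Context (y_decr : forall n m, (1 <= n < m)%nat -> y m < y n).
Context (x_zeros : forall r, (0 < r /\ zero_of_phi L eta r) <-> exists n, (1 <= n)%nat /\ x n = r).
Context (y_zeros : forall r, (r < 0 /\ zero_of_phi L eta r) <-> exists n, (1 <= n)%nat /\ y n = r).

Definition first_zeros (K : nat) : list R := map x (seq 1 K) ++ map y (seq 1 K).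

Lemma first_zeros_in (K : nat) (c : R) :
  In c (first_zeros K) -> exists n, (1 <= n <= K)%nat /\
     ((x n = c /\ 0 < c /\ zero_of_phi L eta c) \/ (y n = c /\ c < 0 /\ zero_of_phi L eta c)).
Proof.
intros h; apply in_app_or in h; destruct h as [h|h];
  apply in_map_iff in h; destruct h as [n [hn h]]; apply in_seq in h;
  exists n; (split; [lia|]); [left|right]; (split; [exact hn|]).
- apply x_zeros; exists n; split; [lia|exact hn].
- apply y_zeros; exists n; split; [lia|exact hn].
Qed.

Lemma first_zeros_spec (K : nat) :
  NoDup (first_zeros K) /\ forall c, In c (first_zeros K) -> zero_of_phi L eta c.
Proof.
split.
- apply NoDup_app.
  + apply enumeration_NoDup; intros n m h; specialize (x_incr n m h); lra.
  + apply enumeration_NoDup; intros n m h; specialize (y_decr n m h); lra.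
  + intros c h h'.
    apply in_map_iff in h, h'; destruct h as [n [hn h]], h' as [m [hm h']].
    apply in_seq in h, h'.
    assert (0 < c) by (apply x_zeros; exists n; split; [lia|exact hn]).
    assert (c < 0) by (apply y_zeros; exists m; split; [lia|exact hm]).
    lra.
- intros c h; apply first_zeros_in in h; destruct h as [n [_ [h|h]]]; apply h.
Qed.

(** By Bessel's inequality the first [K] zeros on the side of [c] have
    [K / c^2 <= sum 1 / x_n^2 <= kappa]. *)
Lemma first_zeros_gap (K : nat) (c : R) :
  zero_of_phi L eta c -> ~ In c (first_zeros K) -> INR K <= kappa L eta * c ^ 2.
Proof.
intros hc hn.
pose proof (residual_basis_0 L eta hL he _ (first_zeros_spec K)) as hB.
pose proof (residual_pos L eta hL he _ _ (first_zeros_spec K) (in_l2_orbit L eta hL he 0)) as h0.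
pose proof (kappa_0_pos L eta hL) as hk.
assert (hB' : sum_over (fun c => / c ^ 2) (first_zeros K) <= kappa L eta).
{ apply Rmult_le_pos with (r1 := kappa L eta) in h0; lra. }
assert (hc0 : c <> 0) by apply hc.
assert (hc2 : 0 < c ^ 2) by (apply pow2_gt_0; exact hc0).
unfold first_zeros in hB', hn; rewrite sum_over_app in hB'.
assert (hpos : forall l, (forall z, In z l -> z <> 0) -> 0 <= sum_over (fun c => / c ^ 2) l).
{ intros l hl; apply sum_over_nonneg; intros z hz; apply Rlt_le, Rinv_0_lt_compat, pow2_gt_0, hl, hz. }
assert (hspec := proj2 (first_zeros_spec K)); unfold first_zeros in hspec.
assert (hpx : 0 <= sum_over (fun c => / c ^ 2) (map x (seq 1 K)))
  by (apply hpos; intros z hz; apply hspec, in_or_app; left; exact hz).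
assert (hpy : 0 <= sum_over (fun c => / c ^ 2) (map y (seq 1 K)))
  by (apply hpos; intros z hz; apply hspec, in_or_app; right; exact hz).
assert (H : INR K * / c ^ 2 <= kappa L eta).
{ destruct (Rdichotomy c 0 hc0) as [hneg|hposc].
  - apply Rle_trans with (sum_over (fun c => / c ^ 2) (map y (seq 1 K))); [|lra].
    destruct (proj1 (y_zeros c) (conj hneg hc)) as [N [hN hNc]].
    assert (K < N)%nat.
    { apply Nat.nle_gt; intros hle; apply hn, in_or_app; right.
      apply in_map_iff; exists N; split; [exact hNc|apply in_seq; lia]. }
    apply sum_over_enumeration_ge; intros n h.
    assert (c < y n) by (rewrite <- hNc; apply y_decr; lia).
    assert (y n < 0) by (apply y_zeros; exists n; split; [lia|reflexivity]).
    apply Rinv_le_contravar; [apply pow2_gt_0; lra|simpl; nra].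
  - apply Rle_trans with (sum_over (fun c => / c ^ 2) (map x (seq 1 K))); [|lra].
    destruct (proj1 (x_zeros c) (conj hposc hc)) as [N [hN hNc]].
    assert (K < N)%nat.
    { apply Nat.nle_gt; intros hle; apply hn, in_or_app; left.
      apply in_map_iff; exists N; split; [exact hNc|apply in_seq; lia]. }
    apply sum_over_enumeration_ge; intros n h.
    assert (x n < c) by (rewrite <- hNc; apply x_incr; lia).
    assert (0 < x n) by (apply x_zeros; exists n; split; [lia|reflexivity]).
    apply Rinv_le_contravar; [apply pow2_gt_0; lra|simpl; nra]. }
apply Rmult_le_compat_r with (r := c ^ 2) in H; [|lra].
rewrite Rmult_assoc, Rinv_l, Rmult_1_r in H by lra; exact H.
Qed.

Lemma partial_fraction_series (rho : R) :
  phi L eta rho <> 0 ->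
  is_series (fun k => rho / (x (S k) * (x (S k) - rho)) + rho / (y (S k) * (y (S k) - rho)))
            (kappa L eta * rho * phi (L + 1) eta rho / phi L eta rho).
Proof.
intros h0.
pose proof (partial_fraction_limit L eta hL he first_zeros first_zeros_spec first_zeros_gap rho h0) as h.
apply is_lim_seq_incr_1 in h.
refine (is_lim_seq_ext _ _ _ _ h); intros n.
unfold first_zeros; rewrite sum_over_app, !sum_over_enumeration.
rewrite sum_n_Reals, <- plus_sum; reflexivity.
Qed.

End Enumeration.

(** * From Kummer's function to the real power series *)

(** The real and imaginary parts of [i^n / n!]. *)
Fixpoint trig_coef (n : nat) : R * R :=
  match n with
  | O => (1, 0)
  | S m => (- snd (trig_coef m) / (INR m + 1), fst (trig_coef m) / (INR m + 1))
  end.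

Definition cos_coef (n : nat) : R := fst (trig_coef n).
Definition sin_coef (n : nat) : R := snd (trig_coef n).

Lemma trig_coef_even (n : nat) :
  cos_coef (2 * n) = (-1) ^ n / INR (fact (2 * n)) /\ sin_coef (2 * n) = 0.
Proof.
induction n as [|n [IH1 IH2]]; [unfold cos_coef, sin_coef; simpl; split; [field|ring]|].
replace (2 * S n)%nat with (S (S (2 * n))) by lia.
generalize dependent (2 * n)%nat; intros m IH1 IH2.
unfold cos_coef, sin_coef in *; cbn [trig_coef fst snd].
rewrite IH1, IH2, !fact_simpl, !mult_INR, !S_INR; pose proof (pos_INR m).
split; [change ((-1) ^ S n) with (-1 * (-1) ^ n); field|unfold Rdiv; ring].
repeat split; try lra; apply INR_fact_neq_0.
Qed.

Lemma trig_coef_odd (n : nat) :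
  cos_coef (2 * n + 1) = 0 /\ sin_coef (2 * n + 1) = (-1) ^ n / INR (fact (2 * n + 1)).
Proof.
destruct (trig_coef_even n) as [h1 h2].
replace (2 * n + 1)%nat with (S (2 * n)) by lia.
generalize dependent (2 * n)%nat; intros m h1 h2.
unfold cos_coef, sin_coef in *; cbn [trig_coef fst snd].
rewrite h1, h2, fact_simpl, mult_INR, S_INR; pose proof (pos_INR m).
split; [unfold Rdiv; ring|field; split; (lra || apply INR_fact_neq_0)].
Qed.

Lemma is_pseries_zero (a : nat -> R) (x : R) : (forall n, a n = 0) -> is_pseries a x 0.
Proof.
intros h; apply is_pseries_R.
apply is_series_ext with (fun n : nat => 0 * x ^ n); [intros n; rewrite h; reflexivity|].
apply (is_lim_seq_ext (fun _ => 0) _ (Finite 0)); [|apply is_lim_seq_const].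
intros n; rewrite sum_n_Reals; symmetry; apply sum_eq_R0; intros; ring.
Qed.

Lemma is_pseries_cos (x : R) : is_pseries cos_coef x (cos x).
Proof.
replace (cos x) with (cos x + x * 0) by ring.
apply is_pseries_odd_even.
- apply is_pseries_R; unfold cos; destruct (exist_cos (Rsqr x)) as [l hl].
  apply is_series_Reals in hl; revert hl; apply is_series_ext; intros n.
  unfold cos_n; rewrite (proj1 (trig_coef_even n)), Rsqr_pow2; reflexivity.
- apply is_pseries_zero; intros n; apply trig_coef_odd.
Qed.

Lemma is_pseries_sin (x : R) : is_pseries sin_coef x (sin x).
Proof.
unfold sin; destruct (exist_sin (Rsqr x)) as [l hl].
rewrite <- (Rplus_0_l (x * l)); apply is_pseries_odd_even.
- apply is_pseries_zero; intros n; apply trig_coef_even.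
- apply is_pseries_R; apply is_series_Reals in hl; revert hl; apply is_series_ext; intros n.
  unfold sin_n; rewrite (proj2 (trig_coef_odd n)), Rsqr_pow2; reflexivity.
Qed.

Lemma entire_cos_coef : entire cos_coef.
Proof. apply ex_pseries_entire; intros x; exists (cos x); apply is_pseries_cos. Qed.

Lemma entire_sin_coef : entire sin_coef.
Proof. apply ex_pseries_entire; intros x; exists (sin x); apply is_pseries_sin. Qed.

Lemma cos_coef_derive (n : nat) : INR (S n) * cos_coef (S n) = - sin_coef n.
Proof.
unfold cos_coef, sin_coef; cbn [trig_coef fst]; rewrite S_INR; pose proof (pos_INR n); field; lra.
Qed.

Lemma sin_coef_derive (n : nat) : INR (S n) * sin_coef (S n) = cos_coef n.
Proof.
unfold cos_coef, sin_coef; cbn [trig_coef snd]; rewrite S_INR; pose proof (pos_INR n); field; lra.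
Qed.

(** Multiplication by the variable and the Euler operator on coefficients. *)
Definition shift (u : nat -> R) (n : nat) : R := match n with O => 0 | S m => u m end.
Definition euler (u : nat -> R) (n : nat) : R := INR n * u n.

Lemma PS_mult_euler (u s : nat -> R) (n : nat) :
  INR n * PS_mult u s n = PS_mult (euler u) s n + PS_mult u (euler s) n.
Proof.
unfold PS_mult, euler; rewrite scal_sum, <- plus_sum; apply sum_eq; intros i hi.
rewrite minus_INR by exact hi; ring.
Qed.

Lemma PS_mult_shift (u s : nat -> R) (n : nat) :
  PS_mult u (shift s) n = PS_mult (shift u) s n.
Proof.
destruct n as [|n]; [unfold PS_mult; simpl; ring|].
unfold PS_mult; rewrite tech5, (decomp_sum (fun k => shift u k * _)) by lia.
replace (S n - S n)%nat with 0%nat by lia; simpl pred; simpl shift at 2 3.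
rewrite Rmult_0_r, Rmult_0_l, Rplus_0_r, Rplus_0_l; apply sum_eq; intros i hi.
replace (S n - i)%nat with (S (n - i)) by lia; reflexivity.
Qed.

Lemma PS_mult_opp_r (u s : nat -> R) (n : nat) :
  PS_mult u (fun k => - s k) n = - PS_mult u s n.
Proof.
replace (- PS_mult u s n) with (-1 * PS_mult u s n) by ring.
unfold PS_mult; rewrite scal_sum; apply sum_eq; intros; ring.
Qed.

Lemma euler_cos : euler cos_coef = fun n => - shift sin_coef n.
Proof.
apply functional_extensionality; intros [|n]; unfold euler, shift; [simpl; ring|].
apply cos_coef_derive.
Qed.

Lemma euler_sin : euler sin_coef = shift cos_coef.
Proof.
apply functional_extensionality; intros [|n]; unfold euler, shift; [simpl; ring|].
apply sin_coef_derive.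
Qed.

Lemma PS_mult_ext (u u' s s' : nat -> R) (n : nat) :
  (forall k, u k = u' k) -> (forall k, s k = s' k) -> PS_mult u s n = PS_mult u' s' n.
Proof. intros h h'; apply sum_eq; intros; rewrite h, h'; reflexivity. Qed.

Lemma PS_mult_derive (u s : nat -> R) (n : nat) :
  INR (S n) * PS_mult u s (S n) = PS_mult (PS_derive u) s n + PS_mult u (PS_derive s) n.
Proof.
rewrite PS_mult_euler; f_equal.
- unfold PS_mult at 1; rewrite decomp_sum by lia; unfold euler at 1; simpl (INR 0).
  rewrite !Rmult_0_l, Rplus_0_l; reflexivity.
- unfold PS_mult at 1; rewrite tech5.
  replace (S n - S n)%nat with 0%nat by lia; unfold euler at 2; simpl (INR 0).
  rewrite Rmult_0_l, Rmult_0_r, Rplus_0_r; apply sum_eq; intros i hi.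
  replace (S n - i)%nat with (S (n - i)) by lia; reflexivity.
Qed.

Lemma shift_derive (u : nat -> R) : shift (PS_derive u) = euler u.
Proof.
apply functional_extensionality; intros [|n]; unfold shift, euler, PS_derive; [simpl; ring|reflexivity].
Qed.

Section Kummer.

Context (L eta : R).
Context (hL : - 3 / 2 < L) (he : slope L eta * (L + 1) = eta).

Local Notation c := (coef L eta).

Lemma coef_recurrence (n : nat) :
  (INR n + (2 * L + 2)) * PS_derive c n = 2 * eta * c n - shift c n.
Proof.
unfold PS_derive, shift; destruct n as [|n].
- rewrite coef_1, coef_0; simpl INR; lra.
- rewrite coef_SS, !S_INR; pose proof (pos_INR n); field; lra.
Qed.

(** The recurrence of [coef], multiplied by an arbitrary power series. *)
Lemma PS_mult_recurrence (s : nat -> R) (n : nat) :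
  PS_mult (euler (PS_derive c)) s n + (2 * L + 2) * PS_mult (PS_derive c) s n
  = 2 * eta * PS_mult c s n - PS_mult (shift c) s n.
Proof.
unfold PS_mult; rewrite !scal_sum, <- plus_sum, <- minus_sum; apply sum_eq; intros i _.
pose proof (coef_recurrence i) as h; unfold euler.
replace (INR i * PS_derive c i * s (n - i)%nat + PS_derive c i * s (n - i)%nat * (2 * L + 2))
  with ((INR i + (2 * L + 2)) * PS_derive c i * s (n - i)%nat) by ring.
rewrite h; ring.
Qed.

(** The power series of [e^(i x) phi(x)] satisfies Kummer's recurrence
    [(n + 1) (n + 2 L + 2) k_(n+1) = 2 i (n + L + 1 - i eta) k_n]; here are its real and
    its imaginary part. *)
Lemma kummer_recurrence_re (n : nat) :
  (INR n + (2 * L + 2)) * (INR (S n) * PS_mult c cos_coef (S n))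
  = 2 * eta * PS_mult c cos_coef n - 2 * (INR n + L + 1) * PS_mult c sin_coef n.
Proof.
rewrite PS_mult_derive.
rewrite (PS_mult_ext c c (PS_derive cos_coef) (fun k => - sin_coef k) n (fun _ => eq_refl)
          cos_coef_derive), PS_mult_opp_r.
pose proof (PS_mult_euler (PS_derive c) cos_coef n) as h1.
pose proof (PS_mult_euler c sin_coef n) as h2.
rewrite euler_cos, PS_mult_opp_r, PS_mult_shift, shift_derive in h1.
rewrite euler_sin, PS_mult_shift in h2.
pose proof (PS_mult_recurrence cos_coef n) as h3.
lra.
Qed.

Lemma kummer_recurrence_im (n : nat) :
  (INR n + (2 * L + 2)) * (INR (S n) * PS_mult c sin_coef (S n))
  = 2 * eta * PS_mult c sin_coef n + 2 * (INR n + L + 1) * PS_mult c cos_coef n.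
Proof.
rewrite PS_mult_derive.
rewrite (PS_mult_ext c c (PS_derive sin_coef) cos_coef n (fun _ => eq_refl) sin_coef_derive).
pose proof (PS_mult_euler (PS_derive c) sin_coef n) as h1.
pose proof (PS_mult_euler c cos_coef n) as h2.
rewrite euler_sin, PS_mult_shift, shift_derive in h1.
rewrite euler_cos, PS_mult_opp_r, PS_mult_shift in h2.
pose proof (PS_mult_recurrence sin_coef n) as h3.
lra.
Qed.

Lemma Cpochhammer_nonzero (z : C) (n : nat) :
  (forall k, (z + RtoC (INR k))%C <> RtoC 0) -> Cpochhammer z n <> RtoC 0.
Proof.
intros h; induction n as [|n IH]; simpl.
- intros e; apply RtoC_inj in e; lra.
- apply Cmult_neq_0; [exact IH|apply h].
Qed.

Lemma RtoC_add_nat_nonzero (r : R) :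
  -1 < r -> r <> 0 -> forall k, (RtoC r + RtoC (INR k))%C <> RtoC 0.
Proof.
intros h1 h0 k; rewrite <- RtoC_plus; intros e; apply RtoC_inj in e.
destruct k as [|k]; [simpl in e; lra|rewrite S_INR in e; pose proof (pos_INR k); lra].
Qed.

(** By induction, since both sides are determined by the ratio of consecutive terms. *)
Lemma kummer_term (rho : R) (n : nat) :
  L <> -1 ->
  (Cpochhammer (RtoC (L + 1) - Ci * RtoC eta) n / Cpochhammer (RtoC (2 * L + 2)) n
     * ((RtoC 2 * Ci * RtoC rho) ^ n / RtoC (INR (fact n))))%C
  = (PS_mult c cos_coef n * rho ^ n, PS_mult c sin_coef n * rho ^ n).
Proof.
intros hL1.
assert (hb := RtoC_add_nat_nonzero (2 * L + 2) ltac:(lra) ltac:(lra)).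
assert (hf : forall m, RtoC (INR (fact m)) <> RtoC 0)
  by (intros m e; apply RtoC_inj in e; exact (INR_fact_neq_0 m e)).
assert (hs : forall m, RtoC (INR (S m)) <> RtoC 0)
  by (intros m e; apply RtoC_inj in e; exact (not_0_INR (S m) ltac:(lia) e)).
induction n as [|n IH].
- unfold PS_mult; simpl; apply injective_projections; simpl; unfold cos_coef, sin_coef; simpl;
    rewrite coef_0; field.
- assert (E : (Cpochhammer (RtoC (L + 1) - Ci * RtoC eta) (S n) / Cpochhammer (RtoC (2 * L + 2)) (S n)
     * ((RtoC 2 * Ci * RtoC rho) ^ S n / RtoC (INR (fact (S n)))))%C
    = ((Cpochhammer (RtoC (L + 1) - Ci * RtoC eta) n / Cpochhammer (RtoC (2 * L + 2)) n
     * ((RtoC 2 * Ci * RtoC rho) ^ n / RtoC (INR (fact n))))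
     * ((RtoC (L + 1) - Ci * RtoC eta + RtoC (INR n)) * (RtoC 2 * Ci * RtoC rho))
     / ((RtoC (2 * L + 2) + RtoC (INR n)) * RtoC (INR (S n))))%C).
  { rewrite fact_simpl, mult_INR, RtoC_mult; simpl Cpochhammer; simpl Cpow.
    field; repeat split; auto; apply Cpochhammer_nonzero, hb. }
  rewrite E, IH; clear E IH.
  pose proof (kummer_recurrence_re n) as hre; pose proof (kummer_recurrence_im n) as him.
  set (P1 := PS_mult c cos_coef (S n)) in *; set (Q1 := PS_mult c sin_coef (S n)) in *.
  set (P := PS_mult c cos_coef n) in *; set (Q := PS_mult c sin_coef n) in *.
  specialize (hb n); specialize (hs n).
  rewrite <- RtoC_plus, <- RtoC_mult in *.
  set (D := (2 * L + 2 + INR n) * INR (S n)) in *.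
  assert (hD : D <> 0).
  { intros e; unfold D in e; apply Rmult_integral in e; destruct e as [e|e];
      [apply hb|apply hs]; rewrite e; reflexivity. }
  assert (e1 : P1 = (2 * eta * P - 2 * (INR n + L + 1) * Q) * / D).
  { apply (Rmult_eq_reg_r D); [|exact hD].
    rewrite Rmult_assoc, Rinv_l, Rmult_1_r by exact hD; rewrite <- hre; unfold D; ring. }
  assert (e2 : Q1 = (2 * eta * Q + 2 * (INR n + L + 1) * P) * / D).
  { apply (Rmult_eq_reg_r D); [|exact hD].
    rewrite Rmult_assoc, Rinv_l, Rmult_1_r by exact hD; rewrite <- him; unfold D; ring. }
  unfold Cdiv; rewrite <- RtoC_inv by exact hD; rewrite e1, e2.
  apply injective_projections; simpl; ring.
Qed.

Lemma kummer_1F1_phi (rho : R) :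
  L <> -1 ->
  Kummer_1F1 (RtoC (L + 1) - Ci * RtoC eta) (RtoC (2 * L + 2)) (RtoC 2 * Ci * RtoC rho)
  = (phi L eta rho * cos rho, phi L eta rho * sin rho).
Proof.
intros hL1; unfold Kummer_1F1, CSeries.
pose proof (coef_entire L eta hL) as hc.
assert (H : forall s, entire s -> Series (fun n => PS_mult c s n * rho ^ n) = phi L eta rho * PSeries s rho).
{ intros s hs; unfold phi; rewrite <- PSeries_mult by (apply entire_lt_radius; assumption); reflexivity. }
apply injective_projections; unfold fst, snd.
- rewrite (Series_ext _ (fun n => PS_mult c cos_coef n * rho ^ n))
    by (intros n; rewrite (kummer_term rho n hL1); reflexivity).
  rewrite H by exact entire_cos_coef.
  rewrite (is_pseries_unique _ _ _ (is_pseries_cos rho)); reflexivity.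
- rewrite (Series_ext _ (fun n => PS_mult c sin_coef n * rho ^ n))
    by (intros n; rewrite (kummer_term rho n hL1); reflexivity).
  rewrite H by exact entire_sin_coef.
  rewrite (is_pseries_unique _ _ _ (is_pseries_sin rho)); reflexivity.
Qed.

End Kummer.

Lemma coef_limit_case (n : nat) : coef (-1) 0 n = cos_coef n.
Proof.
induction n as [| |n IH1 IH2] using nat_ind2.
- reflexivity.
- rewrite coef_1; unfold slope, cos_coef; simpl; unfold Rdiv; ring.
- rewrite coef_SS, IH1; unfold cos_coef; cbn [trig_coef fst snd]; rewrite S_INR.
  pose proof (pos_INR n); field; lra.
Qed.

Lemma slope_relation (L eta : R) : (eta <> 0 -> L <> -1) -> slope L eta * (L + 1) = eta.
Proof.
intros h; unfold slope; destruct (Req_dec L (-1)) as [hL|hL].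
- destruct (Req_dec eta 0) as [->|h0]; [unfold Rdiv; ring|exfalso; exact (h h0 hL)].
- field; lra.
Qed.

Lemma coulomb_entire_phi (L eta rho : R) :
  - 3 / 2 < L -> (eta <> 0 -> L <> -1) ->
  coulomb_entire L eta rho = RtoC (phi L eta rho).
Proof.
intros hL hL1; unfold coulomb_entire; destruct (limit_case L eta) as [[-> ->]|hn].
- f_equal; unfold phi; rewrite (PSeries_ext _ _ rho coef_limit_case).
  symmetry; apply is_pseries_unique, is_pseries_cos.
- assert (hne : L <> -1).
  { intros e; destruct (Req_dec eta 0) as [e0|e0]; [apply hn; auto|exact (hL1 e0 e)]. }
  rewrite (kummer_1F1_phi L eta hL (slope_relation L eta hL1) rho hne).
  unfold Cexp; apply injective_projections; simpl;
    replace (- (0 * rho - 1 * 0)) with 0 by ring;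
    replace (- (0 * 0 + 1 * rho)) with (- rho) by ring; rewrite exp_0, cos_neg, sin_neg.
  + transitivity (phi L eta rho * (Rsqr (sin rho) + Rsqr (cos rho))); [unfold Rsqr; ring|].
    rewrite sin2_cos2; ring.
  + ring.
Qed.

(** * The Gamma function *)

Definition is_Clim (u : nat -> C) (l : C) : Prop :=
  is_lim_seq (fun n => Re (u n)) (Re l) /\ is_lim_seq (fun n => Im (u n)) (Im l).

Lemma is_Clim_unique (u : nat -> C) (l : C) : is_Clim u l -> CLim_seq u = l.
Proof.
intros [h1 h2]; unfold CLim_seq.
rewrite (is_lim_seq_unique _ _ h1), (is_lim_seq_unique _ _ h2); destruct l; reflexivity.
Qed.

Lemma is_Clim_ext_loc (u w : nat -> C) (l : C) :
  (forall n, (1 <= n)%nat -> u n = w n) -> is_Clim u l -> is_Clim w l.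
Proof.
intros h [h1 h2]; split; [revert h1|revert h2]; apply is_lim_seq_ext_loc;
  exists 1%nat; intros n hn; rewrite (h n hn); reflexivity.
Qed.

Lemma is_Clim_mult (u w : nat -> C) (l m : C) :
  is_Clim u l -> is_Clim w m -> is_Clim (fun n => u n * w n)%C (l * m)%C.
Proof.
intros [h1 h2] [h3 h4]; split; unfold Cmult; simpl.
- apply is_lim_seq_minus'; apply is_lim_seq_mult'; assumption.
- apply is_lim_seq_plus'; apply is_lim_seq_mult'; assumption.
Qed.

Lemma Cmod_le_abs (z : C) : Cmod z <= Rabs (Re z) + Rabs (Im z).
Proof.
destruct z as [p q]; unfold Cmod, Re, Im; simpl fst; simpl snd.
pose proof (Rabs_pos p); pose proof (Rabs_pos q).
rewrite <- (sqrt_pow2 (Rabs p + Rabs q)) by lra.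
apply sqrt_le_1_alt; rewrite <- (pow2_abs p), <- (pow2_abs q); nra.
Qed.

(** The criterion for infinite products, stated for the partial products [g]: far enough out, [g]
    moves by at most half of its modulus in all, which keeps it away from [0], and both its
    coordinates have absolutely summable increments. *)
Lemma Cproduct_limit (g : nat -> C) (u : nat -> R) (N : nat) :
  (forall n, (N <= n)%nat -> g n <> RtoC 0) ->
  (forall n, 0 <= u n) -> ex_series u ->
  (forall n, (N <= n)%nat -> Cmod (g (S n) - g n) <= u n * Cmod (g n)) ->
  exists l, l <> RtoC 0 /\ is_Clim g l.
Proof.
intros hg hu hser hstep.
assert (htail := is_lim_seq_tail u hser); apply is_lim_seq_spec in htail.
destruct (htail (mkposreal (1 / 4) ltac:(lra))) as [N1 hN1]; clear htail.
(* from [M] on the product stays within a factor [2] of its value [G] at [M] *)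
set (M := S (N + N1)).
assert (hM : Series (fun k => u (M + k)%nat) < 1 / 4).
{ specialize (hN1 (N + N1)%nat ltac:(lia)); simpl in hN1.
  rewrite Rminus_0_r in hN1; apply Rabs_lt_between in hN1; apply hN1. }
assert (hserM : ex_series (fun k => u (M + k)%nat)) by (apply (ex_series_incr_n u M), hser).
set (G := Cmod (g M)).
assert (hG : 0 < G) by (apply Cmod_gt_0, hg; unfold M; lia).
set (t := fun k => match k with O => 0 | S j => sum_f_R0 (fun i => u (M + i)%nat) j end).
assert (ht : forall k, t k <= 1 / 4).
{ intros [|k]; [simpl; lra|].
  eapply Rle_trans; [apply sum_le_Series; [intros; apply hu|exact hserM]|lra]. }
assert (htS : forall k, t (S k) = t k + u (M + k)%nat).
{ intros [|k]; [simpl; ring|reflexivity]. }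
assert (hdist : forall k, Cmod (g (M + k)%nat - g M) <= 2 * G * t k).
{ induction k as [|k IH].
  - rewrite Nat.add_0_r; replace (g M - g M)%C with (RtoC 0) by ring; rewrite Cmod_0; simpl; lra.
  - assert (hk : Cmod (g (M + k)%nat) <= 2 * G).
    { replace (g (M + k)%nat) with ((g (M + k)%nat - g M) + g M)%C by ring.
      eapply Rle_trans; [apply Cmod_triangle|]; fold G; specialize (ht k); nra. }
    replace (M + S k)%nat with (S (M + k)) by lia.
    replace (g (S (M + k)) - g M)%C
      with ((g (S (M + k)) - g (M + k)%nat) + (g (M + k)%nat - g M))%C by ring.
    eapply Rle_trans; [apply Cmod_triangle|].
    specialize (hstep (M + k)%nat ltac:(unfold M; lia)); specialize (hu (M + k)%nat).
    rewrite htS; nra. }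
assert (hlow : forall k, G / 2 <= Cmod (g (M + k)%nat) <= 2 * G).
{ intros k; specialize (hdist k); specialize (ht k); split.
  - assert (G <= Cmod (g (M + k)%nat) + Cmod (g (M + k)%nat - g M)).
    { unfold G; replace (g M) with (g (M + k)%nat + - (g (M + k)%nat - g M))%C at 1 by ring.
      eapply Rle_trans; [apply Cmod_triangle|]; rewrite Cmod_opp; lra. }
    nra.
  - replace (g (M + k)%nat) with ((g (M + k)%nat - g M) + g M)%C by ring.
    eapply Rle_trans; [apply Cmod_triangle|]; fold G; nra. }
assert (hcoord : forall f : C -> R, (forall z w, f (z - w)%C = f z - f w) ->
   (forall z, Rabs (f z) <= Cmod z) -> exists l : R, is_lim_seq (fun n => f (g n)) l).
{ intros f hlin hf.
  assert (hinc : ex_series (fun k => f (g (S (M + k))) - f (g (M + k)%nat))).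
  { apply ex_series_le_R with (fun k => 2 * G * u (M + k)%nat);
      [|exact (@ex_series_scal_l R_AbsRing R_NormedModule (2 * G) _ hserM)].
    intros k; rewrite <- hlin; eapply Rle_trans; [apply hf|].
    eapply Rle_trans; [apply hstep; unfold M; lia|].
    rewrite Rmult_comm; apply Rmult_le_compat_r; [apply hu|apply hlow]. }
  exists (Series (fun k => f (g (S (M + k))) - f (g (M + k)%nat)) + f (g M)).
  apply (is_lim_seq_incr_n (fun n => f (g n)) (S M)).
  apply is_lim_seq_ext with (fun n => sum_n (fun k => f (g (S (M + k))) - f (g (M + k)%nat)) n + f (g M)).
  - intros n; rewrite sum_n_Reals; induction n as [|n IH].
    + change (0 + S M)%nat with (S M); cbn [sum_f_R0]; rewrite Nat.add_0_r; ring.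
    + rewrite tech5; transitivity (f (g (n + S M)%nat) + (f (g (S (M + S n))) - f (g (M + S n)%nat)));
        [rewrite <- IH; ring|].
      replace (n + S M)%nat with (M + S n)%nat by lia.
      replace (S n + S M)%nat with (S (M + S n)) by lia; ring.
  - apply is_lim_seq_plus'; [exact (Series_correct _ hinc)|apply is_lim_seq_const]. }
destruct (hcoord Re) as [p hp]; [intros; reflexivity|apply re_le_Cmod|].
destruct (hcoord Im) as [q hq]; [intros; reflexivity| |].
{ intros z; eapply Rle_trans; [apply (Rmax_r (Rabs (fst z)))|apply Rmax_Cmod]. }
exists (p, q); split; [|split; assumption].
intros e; injection e as -> ->.
assert (h0 : is_lim_seq (fun k => Re (g (k + M)%nat) * Re (g (k + M)%nat)
                + Im (g (k + M)%nat) * Im (g (k + M)%nat)) (0 * 0 + 0 * 0)).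
{ apply is_lim_seq_plus'; apply is_lim_seq_mult';
    apply (is_lim_seq_incr_n (fun n => Re (g n)) M) || apply (is_lim_seq_incr_n (fun n => Im (g n)) M);
    assumption. }
assert (h1 : (G / 2) ^ 2 <= 0 * 0 + 0 * 0).
{ apply (is_lim_seq_le (fun _ => (G / 2) ^ 2) (fun k => Re (g (k + M)%nat) * Re (g (k + M)%nat)
                + Im (g (k + M)%nat) * Im (g (k + M)%nat)) ((G / 2) ^ 2) (0 * 0 + 0 * 0));
    [|apply is_lim_seq_const|exact h0].
  intros k; replace (Re (g (k + M)%nat) * Re (g (k + M)%nat) + Im (g (k + M)%nat) * Im (g (k + M)%nat))
    with (Cmod (g (k + M)%nat) ^ 2) by (rewrite Cmod2_alt; ring).
  apply pow_incr; split; [lra|]; replace (k + M)%nat with (M + k)%nat by lia; apply hlow. }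
assert (0 < (G / 2) ^ 2) by (apply pow_lt; lra); lra.
Qed.

Lemma Cexp_plus (z w : C) : Cexp (z + w)%C = (Cexp z * Cexp w)%C.
Proof.
destruct z as [p q], w as [r s]; unfold Cexp, Cplus, Cmult; simpl.
rewrite exp_plus, cos_plus, sin_plus; apply injective_projections; simpl; ring.
Qed.

Lemma Cexp_nonzero (z : C) : Cexp z <> RtoC 0.
Proof.
intros e; assert (h : (Cexp z * Cexp (- z))%C = RtoC 1).
{ rewrite <- Cexp_plus; replace (z + - z)%C with (RtoC 0) by ring.
  unfold Cexp; simpl; rewrite exp_0, cos_0, sin_0; apply injective_projections; simpl; ring. }
rewrite e, Cmult_0_l in h; apply RtoC_inj in h; lra.
Qed.

Lemma cos_ge_quadratic (y : R) : 0 <= 1 - cos y <= y ^ 2.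
Proof.
split; [pose proof (COS_bound y); lra|].
replace y with (2 * (y / 2)) at 1 by field.
rewrite cos_2a_sin.
assert (h : Rabs (sin (y / 2)) <= Rabs (y / 2)).
{ destruct (MVT_gen sin 0 (y / 2) cos) as [c [_ hc]].
  - intros; apply is_derive_sin.
  - intros; apply continuity_sin.
  - rewrite sin_0, !Rminus_0_r in hc; rewrite hc, Rabs_mult.
    rewrite <- (Rmult_1_l (Rabs (y / 2))) at 2.
    apply Rmult_le_compat_r; [apply Rabs_pos|apply Rabs_le, COS_bound]. }
assert (h2 : sin (y / 2) ^ 2 <= (y / 2) ^ 2).
{ rewrite <- (pow2_abs (sin _)), <- (pow2_abs (y / 2)); apply pow_incr; split; [apply Rabs_pos|exact h]. }
nra.
Qed.

Lemma sin_minus_id (y : R) : Rabs y <= 1 -> Rabs (sin y - y) <= y ^ 2.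
Proof.
intros hy.
destruct (MVT_gen (fun t => sin t - t) 0 y (fun t => cos t - 1)) as [c [hc1 hc]].
- intros; auto_derive; [trivial|ring].
- intros t _; apply continuity_pt_minus; [apply continuity_sin|apply continuity_pt_id].
- rewrite sin_0, !Rminus_0_r in hc; rewrite hc, Rabs_mult.
  replace (y ^ 2) with (Rabs y * Rabs y) by (rewrite <- (pow2_abs y); ring).
  apply Rmult_le_compat_r; [apply Rabs_pos|].
  pose proof (cos_ge_quadratic c) as hq.
  assert (hcy : Rabs c <= Rabs y).
  { unfold Rmin, Rmax in hc1; destruct (Rle_dec 0 y);
      [rewrite !Rabs_pos_eq by lra; lra|rewrite !Rabs_left1 by lra; lra]. }
  rewrite <- (pow2_abs c) in hq; pose proof (Rabs_pos c).
  rewrite Rabs_left1 by lra; nra.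
Qed.

Lemma exp_quadratic (x : R) : Rabs x <= 1 / 2 -> 0 <= exp x - 1 - x <= 2 * x ^ 2.
Proof.
intros hx; apply Rabs_le_between in hx.
pose proof (exp_ineq1_le x); split; [lra|].
pose proof (exp_ineq1_le (- x)) as h; rewrite exp_Ropp in h.
pose proof (exp_pos x) as hp.
apply Rmult_le_compat_r with (r := exp x) in h; [|lra].
rewrite Rinv_l in h by lra.
assert (exp x * (1 - x) <= 1) by lra.
apply Rmult_le_reg_r with (1 - x); [lra|]; nra.
Qed.

Lemma Cexp_quadratic (z : C) :
  Rabs (Re z) <= 1 / 2 -> Rabs (Im z) <= 1 / 2 ->
  Cmod (Cexp z - RtoC 1 - z)%C <= 8 * Cmod z ^ 2.
Proof.
intros hp hq; eapply Rle_trans; [apply Cmod_le_abs|]; rewrite Cmod2_alt.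
destruct z as [p q]; unfold Cexp, Cminus, Cplus, Copp, Re, Im in *; simpl fst in *; simpl snd in *.
pose proof (exp_quadratic p hp) as he.
pose proof (cos_ge_quadratic q) as hc.
pose proof (sin_minus_id q ltac:(lra)) as hs.
assert (hE : 0 < exp p <= 2).
{ split; [apply exp_pos|]; apply Rabs_le_between in hp; nra. }
assert (hE1 : Rabs (exp p - 1) <= 2 * Rabs p).
{ replace (exp p - 1) with ((exp p - 1 - p) + p) by ring.
  eapply Rle_trans; [apply Rabs_triang|]; rewrite (Rabs_pos_eq (exp p - 1 - p)) by lra.
  rewrite <- (pow2_abs p) in he; pose proof (Rabs_pos p); nra. }
assert (hre : Rabs (exp p * cos q + - (1) + - p) <= 2 * p ^ 2 + 2 * q ^ 2).
{ replace (exp p * cos q + - (1) + - p) with ((exp p - 1 - p) + - (exp p * (1 - cos q))) by ring.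
  eapply Rle_trans; [apply Rabs_triang|]; rewrite Rabs_Ropp, !Rabs_pos_eq; nra. }
assert (him : Rabs (exp p * sin q + - 0 + - q) <= 2 * q ^ 2 + 2 * (Rabs p * Rabs q)).
{ replace (exp p * sin q + - 0 + - q) with (exp p * (sin q - q) + (exp p - 1) * q) by ring.
  eapply Rle_trans; [apply Rabs_triang|]; rewrite !Rabs_mult, (Rabs_pos_eq (exp p)) by lra.
  pose proof (Rabs_pos q); pose proof (Rabs_pos (sin q - q)); pose proof (Rabs_pos (exp p - 1)); nra. }
rewrite <- (pow2_abs p), <- (pow2_abs q) in *.
pose proof (Rabs_pos p); pose proof (Rabs_pos q).
assert (0 <= (Rabs p - Rabs q) ^ 2) by apply pow2_ge_0.
simpl in *; nra.
Qed.

(** Euler's sequence for the Gamma function. *)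
Definition gamma_seq (z : C) (n : nat) : C :=
  (RtoC (INR (fact n)) * Cexp (z * RtoC (ln (INR n))) / Cpochhammer z (S n))%C.

Lemma ln_step (n : nat) : (1 <= n)%nat ->
  / INR (S n) <= ln (INR (S n)) - ln (INR n) <= / INR n.
Proof.
intros hn.
assert (h1 : 0 < INR n) by (apply lt_0_INR; lia).
assert (hl : forall x, 0 < x -> ln x <= x - 1).
{ intros x hx; rewrite <- (ln_exp (x - 1)); apply ln_le; [exact hx|].
  pose proof (exp_ineq1_le (x - 1)); lra. }
rewrite S_INR; split.
- pose proof (hl (INR n / (INR n + 1)) ltac:(apply Rdiv_lt_0_compat; lra)) as h.
  rewrite ln_div in h by lra.
  replace (INR n / (INR n + 1) - 1) with (- / (INR n + 1)) in h by (field; lra); lra.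
- pose proof (hl ((INR n + 1) / INR n) ltac:(apply Rdiv_lt_0_compat; lra)) as h.
  rewrite ln_div in h by lra.
  replace ((INR n + 1) / INR n - 1) with (/ INR n) in h by (field; lra); lra.
Qed.

Lemma Cmod_add_nat_ge (z : C) (m : nat) : INR m - Cmod z <= Cmod (z + RtoC (INR m)).
Proof.
assert (h : Cmod (RtoC (INR m)) <= Cmod (z + RtoC (INR m)) + Cmod z).
{ replace (RtoC (INR m)) with ((z + RtoC (INR m)) + - z)%C at 1 by ring.
  eapply Rle_trans; [apply Cmod_triangle|]; rewrite Cmod_opp; lra. }
rewrite Cmod_R, Rabs_pos_eq in h by apply pos_INR; lra.
Qed.

Lemma ex_series_inv_succ_mult : ex_series (fun n => / (INR (S n) * INR (S (S n)))).
Proof.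
exists 1.
apply (is_lim_seq_ext (fun n => 1 - / INR (S (S n))) _ (Finite 1)).
- intros n; rewrite sum_n_Reals; induction n as [|n IH]; [simpl; field|].
  rewrite tech5, <- IH, !S_INR; pose proof (pos_INR n); field; lra.
- replace (Finite 1) with (Finite (1 - 0)) by (f_equal; ring).
  apply is_lim_seq_minus'; [apply is_lim_seq_const|].
  apply (is_lim_seq_incr_1 (fun n => / INR (S n))), (is_lim_seq_incr_1 (fun n => / INR n)).
  exact is_lim_seq_inv_INR.
Qed.

(** The relative increment is [(n + 1) ((n + 1) / n)^z / (z + n + 1) - 1]. *)
Lemma gamma_seq_step (z : C) (n : nat) :
  (forall k, (z + RtoC (INR k))%C <> RtoC 0) ->
  (gamma_seq z (S n) - gamma_seq z n)%C
  = ((RtoC (INR (S n)) * Cexp (z * RtoC (ln (INR (S n)) - ln (INR n)))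
      - (z + RtoC (INR (S n)))) / (z + RtoC (INR (S n))) * gamma_seq z n)%C.
Proof.
intros hz; unfold gamma_seq.
replace (z * RtoC (ln (INR (S n))))%C
  with (z * RtoC (ln (INR (S n)) - ln (INR n)) + z * RtoC (ln (INR n)))%C
  by (rewrite RtoC_minus; ring).
rewrite Cexp_plus.
replace (INR (fact (S n))) with (INR (S n) * INR (fact n)) by (rewrite <- mult_INR; reflexivity).
rewrite RtoC_mult.
change (Cpochhammer z (S (S n))) with (Cpochhammer z (S n) * (z + RtoC (INR (S n))))%C.
field; split; (apply hz || (apply Cpochhammer_nonzero, hz)).
Qed.

Lemma gamma_seq_nonzero (z : C) (n : nat) :
  (forall k, (z + RtoC (INR k))%C <> RtoC 0) -> gamma_seq z n <> RtoC 0.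
Proof.
intros hz; unfold gamma_seq, Cdiv; apply Cmult_neq_0; [apply Cmult_neq_0|].
- intros e; apply RtoC_inj in e; exact (INR_fact_neq_0 n e).
- apply Cexp_nonzero.
- intros e; apply C1_nz; rewrite <- (Cinv_r (Cpochhammer z (S n))), e by (apply Cpochhammer_nonzero, hz).
  ring.
Qed.

(** The relative increments of Euler's sequence are at most of the order [1 / n^2]. *)
Lemma gamma_seq_limit (z : C) :
  (forall k, (z + RtoC (INR k))%C <> RtoC 0) ->
  exists l, l <> RtoC 0 /\ is_Clim (gamma_seq z) l.
Proof.
intros hz.
pose proof (Cmod_ge_0 z) as hz0.
destruct (nfloor_ex (4 * Cmod z) ltac:(lra)) as [N [_ hN]].
set (A := 32 * Cmod z ^ 2 + 2 * Cmod z).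
assert (hA : 0 <= A) by (unfold A; pose proof (pow2_ge_0 (Cmod z)); lra).
apply Cproduct_limit with (u := fun n => 4 * A * / (INR (S n) * INR (S (S n)))) (N := S N).
- intros n _; apply gamma_seq_nonzero, hz.
- intros n; apply Rmult_le_pos; [lra|].
  apply Rlt_le, Rinv_0_lt_compat, Rmult_lt_0_compat; apply lt_0_INR; lia.
- exact (@ex_series_scal_l R_AbsRing R_NormedModule (4 * A) _ ex_series_inv_succ_mult).
- intros n hn; rewrite gamma_seq_step by exact hz; rewrite Cmod_mult.
  apply Rmult_le_compat_r; [apply Cmod_ge_0|].
  destruct (ln_step n ltac:(lia)) as [hs1 hs2].
  (* the numerator is [m (e^(z s) - 1 - z s) + z (m s - 1)] with [s = 1 / m + O(1 / m^2)] *)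
  set (m := INR (S n)) in *; set (s := ln m - ln (INR n)) in *.
  assert (hm4 : 4 * Cmod z < m /\ 2 <= m /\ INR n = m - 1).
  { unfold m; rewrite S_INR; apply le_INR in hn; rewrite S_INR in hn; pose proof (pos_INR N); lra. }
  destruct hm4 as [hm4 [hm2 hmn]].
  assert (hinv : / INR n <= 2 * / m).
  { rewrite hmn; apply Rmult_le_reg_l with (m - 1); [lra|].
    rewrite Rinv_r by lra; apply Rmult_le_reg_r with m; [lra|].
    replace ((m - 1) * (2 * / m) * m) with (2 * (m - 1)) by (field; lra); lra. }
  assert (him : 0 < / m) by (apply Rinv_0_lt_compat; lra).
  assert (hmim : m * / m = 1) by (field; lra).
  assert (hms : 0 <= m * s - 1 <= 2 * / m).
  { split; [nra|].
    assert (m * s <= m * / INR n) by (apply Rmult_le_compat_l; lra).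
    assert (m * / INR n = 1 + / INR n) by (rewrite hmn; field; lra).
    lra. }
  assert (hzs : Cmod (z * RtoC s) <= Cmod z * (2 * / m)).
  { rewrite Cmod_mult, Cmod_R, (Rabs_pos_eq s) by lra.
    apply Rmult_le_compat_l; lra. }
  assert (hhalf : Cmod z * (2 * / m) <= 1 / 2).
  { apply Rmult_le_reg_r with m; [lra|].
    replace (Cmod z * (2 * / m) * m) with (2 * Cmod z) by (field; lra); lra. }
  assert (hq : Cmod (Cexp (z * RtoC s) - RtoC 1 - z * RtoC s)%C <= 8 * (Cmod z * (2 * / m)) ^ 2).
  { eapply Rle_trans; [apply Cexp_quadratic|].
    - eapply Rle_trans; [apply re_le_Cmod|lra].
    - eapply Rle_trans; [apply (Rmax_r (Rabs (fst (z * RtoC s)%C)))|].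
      eapply Rle_trans; [apply Rmax_Cmod|lra].
    - apply Rmult_le_compat_l; [lra|apply pow_incr; split; [apply Cmod_ge_0|exact hzs]]. }
  assert (hnum : Cmod (RtoC m * Cexp (z * RtoC s) - (z + RtoC m))%C <= A * / m).
  { replace (RtoC m * Cexp (z * RtoC s) - (z + RtoC m))%C
      with (RtoC m * (Cexp (z * RtoC s) - RtoC 1 - z * RtoC s) + z * RtoC (m * s - 1))%C
      by (rewrite RtoC_minus, RtoC_mult; ring).
    eapply Rle_trans; [apply Cmod_triangle|].
    rewrite !Cmod_mult, !Cmod_R, (Rabs_pos_eq m), (Rabs_pos_eq (m * s - 1)) by lra.
    replace (A * / m) with (m * (8 * (Cmod z * (2 * / m)) ^ 2) + Cmod z * (2 * / m))
      by (unfold A; field; lra).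
    apply Rplus_le_compat; apply Rmult_le_compat_l; lra. }
  assert (hden : m / 2 <= Cmod (z + RtoC m)) by (pose proof (Cmod_add_nat_ge z (S n)) as h; fold m in h; lra).
  rewrite Cmod_div by (unfold m; apply hz).
  apply Rle_div_l; [lra|].
  eapply Rle_trans; [exact hnum|].
  rewrite S_INR; fold m.
  apply Rle_trans with (4 * A * / (m * (m + 1)) * (m / 2)).
  + replace (4 * A * / (m * (m + 1)) * (m / 2)) with (A * (2 / (m + 1))) by (field; lra).
    apply Rmult_le_compat_l; [exact hA|].
    apply Rle_div_r; [lra|]; nra.
  + apply Rmult_le_compat_l; [|exact hden].
    apply Rmult_le_pos; [lra|apply Rlt_le, Rinv_0_lt_compat; nra].
Qed.

Lemma is_Clim_of_Cmod (u : nat -> C) (l : C) :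
  is_lim_seq (fun n => Cmod (u n - l)) 0 -> is_Clim u l.
Proof.
intros h.
assert (H : forall f : C -> R, (forall z w, f (z - w)%C = f z - f w) ->
   (forall z, Rabs (f z) <= Cmod z) -> is_lim_seq (fun n => f (u n)) (f l)).
{ intros f hlin hf.
  apply is_lim_seq_ext with (fun n => f (u n - l)%C + f l); [intros; rewrite hlin; ring|].
  replace (Finite (f l)) with (Finite (0 + f l)) by (f_equal; ring).
  apply is_lim_seq_plus'; [|apply is_lim_seq_const].
  apply is_lim_seq_abs_0.
  apply is_lim_seq_le_le with (fun _ => 0) (fun n => Cmod (u n - l));
    [intros n; split; [apply Rabs_pos|apply hf]|apply is_lim_seq_const|exact h]. }
split; apply H; try reflexivity; [apply re_le_Cmod|].
intros z; eapply Rle_trans; [apply (Rmax_r (Rabs (fst z)))|apply Rmax_Cmod].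
Qed.

Lemma Cpochhammer_shift (z : C) (n : nat) :
  (z * Cpochhammer (z + RtoC 1) n)%C = Cpochhammer z (S n).
Proof.
induction n as [|n IH]; [simpl; ring|].
change (Cpochhammer (z + RtoC 1) (S n)) with (Cpochhammer (z + RtoC 1) n * (z + RtoC 1 + RtoC (INR n)))%C.
rewrite Cmult_assoc, IH.
change (Cpochhammer z (S (S n))) with (Cpochhammer z (S n) * (z + RtoC (INR (S n))))%C.
rewrite S_INR, RtoC_plus; ring.
Qed.

(** With [z + 1] for [z], this is the quotient of Euler's sequences at [z + 1] and at [z], divided
    by [z]. *)
Lemma ratio_limit_1 (z : C) :
  (forall k, (z + RtoC (INR k))%C <> RtoC 0) ->
  is_Clim (fun n => RtoC (INR n) / (z + RtoC (INR n)))%C (RtoC 1).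
Proof.
intros hz; apply is_Clim_of_Cmod.
pose proof (Cmod_ge_0 z) as hz0.
destruct (nfloor_ex (2 * Cmod z) ltac:(lra)) as [N [_ hN]].
apply is_lim_seq_le_le_loc with (fun _ => 0) (fun n => 2 * Cmod z * / INR n).
- exists (S N); intros n hn; split; [apply Cmod_ge_0|].
  apply le_INR in hn; rewrite S_INR in hn.
  replace (RtoC (INR n) / (z + RtoC (INR n)) - RtoC 1)%C with (- z / (z + RtoC (INR n)))%C
    by (field; apply hz).
  rewrite Cmod_div, Cmod_opp by apply hz.
  pose proof (Cmod_add_nat_ge z n); pose proof (pos_INR N).
  apply Rle_div_l; [lra|].
  apply Rle_trans with (2 * Cmod z * / INR n * (INR n / 2)); [right; field; lra|].
  apply Rmult_le_compat_l; [|lra].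
  apply Rmult_le_pos; [lra|apply Rlt_le, Rinv_0_lt_compat; lra].
- apply is_lim_seq_const.
- rewrite <- (Rmult_0_r (2 * Cmod z)); apply is_lim_seq_mult'; [apply is_lim_seq_const|].
  exact is_lim_seq_inv_INR.
Qed.

Lemma CGamma_limit (z : C) :
  (forall k, (z + RtoC (INR k))%C <> RtoC 0) ->
  CGamma z <> RtoC 0 /\ is_Clim (gamma_seq z) (CGamma z).
Proof.
intros hz; destruct (gamma_seq_limit z hz) as [l [hl h]].
assert (e : CGamma z = l) by (apply is_Clim_unique; exact h).
rewrite e; split; assumption.
Qed.

Lemma CGamma_succ (z : C) :
  (forall k, (z + RtoC (INR k))%C <> RtoC 0) -> CGamma (z + RtoC 1) = (z * CGamma z)%C.
Proof.
intros hz; destruct (CGamma_limit z hz) as [_ hlim].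
assert (hz1 : forall k, (z + RtoC 1 + RtoC (INR k))%C <> RtoC 0).
{ intros k; replace (z + RtoC 1 + RtoC (INR k))%C with (z + RtoC (INR (S k)))%C; [apply hz|].
  rewrite S_INR, RtoC_plus; ring. }
apply is_Clim_unique; change (is_Clim (gamma_seq (z + RtoC 1)) (z * CGamma z)%C).
apply is_Clim_ext_loc with
  (fun n => z * gamma_seq z n * (RtoC (INR n) / (z + RtoC 1 + RtoC (INR n))))%C.
- intros n hn; unfold gamma_seq.
  assert (hn0 : 0 < INR n) by (apply lt_0_INR; lia).
  assert (hexp : Cexp ((z + RtoC 1) * RtoC (ln (INR n))) = (Cexp (z * RtoC (ln (INR n))) * RtoC (INR n))%C).
  { replace ((z + RtoC 1) * RtoC (ln (INR n)))%C
      with (z * RtoC (ln (INR n)) + RtoC (ln (INR n)))%C by ring.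
    rewrite Cexp_plus; f_equal; unfold Cexp; simpl.
    rewrite exp_ln, cos_0, sin_0 by exact hn0; apply injective_projections; simpl; ring. }
  rewrite hexp.
  assert (hz0 : z <> RtoC 0) by (specialize (hz 0%nat); simpl in hz; rewrite Cplus_0_r in hz; exact hz).
  pose proof (Cpochhammer_shift z (S n)) as hp.
  change (Cpochhammer z (S (S n))) with (Cpochhammer z (S n) * (z + RtoC (INR (S n))))%C in hp.
  replace (z + RtoC (INR (S n)))%C with (z + RtoC 1 + RtoC (INR n))%C in hp
    by (rewrite S_INR, RtoC_plus; ring).
  replace (Cpochhammer (z + RtoC 1) (S n))
    with (Cpochhammer z (S n) * (z + RtoC 1 + RtoC (INR n)) / z)%C
    by (rewrite <- hp; field; exact hz0).
  field; repeat split; try apply hz1; try exact hz0; apply Cpochhammer_nonzero, hz.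
- replace (z * CGamma z)%C with (z * CGamma z * RtoC 1)%C by ring.
  apply is_Clim_mult; [|apply ratio_limit_1, hz1].
  apply is_Clim_mult; [split; apply is_lim_seq_const|exact hlim].
Qed.

Lemma CGamma_1 : CGamma (RtoC 1) = RtoC 1.
Proof.
assert (h1 := RtoC_add_nat_nonzero 1 ltac:(lra) ltac:(lra)).
apply is_Clim_unique.
apply is_Clim_ext_loc with (fun n => RtoC (INR n) / (RtoC 1 + RtoC (INR n)))%C;
  [|apply ratio_limit_1, h1].
intros n hn; assert (hn0 : 0 < INR n) by (apply lt_0_INR; lia).
assert (hp : forall m, Cpochhammer (RtoC 1) m = RtoC (INR (fact m))).
{ induction m as [|m IH]; [reflexivity|].
  rewrite fact_simpl, mult_INR, S_INR, RtoC_mult, RtoC_plus; simpl Cpochhammer; rewrite IH; ring. }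
assert (hexp : Cexp (RtoC 1 * RtoC (ln (INR n))) = RtoC (INR n)).
{ rewrite Cmult_1_l; unfold Cexp; simpl.
  rewrite exp_ln, cos_0, sin_0 by exact hn0; apply injective_projections; simpl; ring. }
rewrite hexp, hp, fact_simpl, mult_INR, S_INR, RtoC_mult, RtoC_plus.
assert (hf : RtoC (INR (fact n)) <> RtoC 0)
  by (intros e; apply RtoC_inj in e; exact (INR_fact_neq_0 n e)).
field; repeat split; (exact hf || apply h1 || (rewrite Cplus_comm; apply h1)).
Qed.

(** * The normalizing constants *)

(** From [Gamma (z + 1) = z Gamma z] at [z = L + 1 + i eta], [2 L + 2] and [2 L + 3]; the factor
    [2 L + 2] gives the quotient the sign of [L + 1]. *)
Lemma coulomb_C_succ (L eta : R) :
  - 3 / 2 < L -> (eta <> 0 -> L <> -1) ->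
  coulomb_C L eta <> RtoC 0 /\
  coulomb_C (L + 1) eta = (RtoC (coulomb_factor L eta * kappa L eta) * coulomb_C L eta)%C.
Proof.
intros hL hL1.
unfold coulomb_C at 2; destruct (limit_case (L + 1) eta) as [[h _]|_]; [exfalso; lra|].
unfold coulomb_factor, coulomb_C; destruct (limit_case L eta) as [[-> ->]|hn].
- split; [intros e; apply RtoC_inj in e; lra|].
  replace (RtoC (-1 + 1 + 1) + Ci * RtoC 0)%C with (RtoC 1)
    by (apply injective_projections; simpl; ring).
  replace (2 * (-1 + 1) + 2) with (1 + 1) by ring; rewrite RtoC_plus.
  rewrite CGamma_succ by (apply (RtoC_add_nat_nonzero 1); lra).
  rewrite CGamma_1, Cmod_1; unfold kappa, slope.
  replace (-1 + 1) with 0 by ring; rewrite Rpower_O by lra.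
  replace (- PI * 0 / 2) with 0 by field; rewrite exp_0.
  replace (1 * ((1 + (0 / 0) ^ 2) / (2 * -1 + 3))) with 1 by (unfold Rdiv; rewrite Rmult_0_l; field).
  rewrite !Rmult_1_r; field; intros e; apply RtoC_inj in e; lra.
- assert (hne : L <> -1).
  { intros e; destruct (Req_dec eta 0) as [e0|e0]; [apply hn; auto|exact (hL1 e0 e)]. }
  set (z := (RtoC (L + 1) + Ci * RtoC eta)%C).
  assert (hz : forall k, (z + RtoC (INR k))%C <> RtoC 0).
  { intros k e.
    assert (e1 : Re (z + RtoC (INR k))%C = 0) by (rewrite e; reflexivity).
    assert (e2 : Im (z + RtoC (INR k))%C = 0) by (rewrite e; reflexivity).
    unfold z in e1, e2; simpl in e1, e2.
    destruct k as [|k]; [simpl in e1; apply hne; lra|rewrite S_INR in e1; pose proof (pos_INR k); lra]. }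
  assert (hb := RtoC_add_nat_nonzero (2 * L + 2) ltac:(lra) ltac:(lra)).
  assert (hb1 := RtoC_add_nat_nonzero (2 * L + 3) ltac:(lra) ltac:(lra)).
  destruct (CGamma_limit z hz) as [hGz _].
  destruct (CGamma_limit (RtoC (2 * L + 2)) hb) as [hGb _].
  assert (hmod : Cmod z = sqrt ((L + 1) ^ 2 + eta ^ 2)).
  { unfold Cmod, z; simpl; f_equal; ring. }
  assert (hs : 0 < (L + 1) ^ 2 + eta ^ 2).
  { assert (0 < (L + 1) ^ 2) by (apply pow2_gt_0; lra); pose proof (pow2_ge_0 eta); lra. }
  assert (hsq : sqrt ((L + 1) ^ 2 + eta ^ 2) * sqrt ((L + 1) ^ 2 + eta ^ 2) = (L + 1) ^ 2 + eta ^ 2)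
    by (apply sqrt_sqrt; lra).
  assert (hsp : 0 < sqrt ((L + 1) ^ 2 + eta ^ 2)) by (apply sqrt_lt_R0; exact hs).
  replace (RtoC (L + 1 + 1) + Ci * RtoC eta)%C with (z + RtoC 1)%C
    by (unfold z; rewrite !RtoC_plus; ring).
  replace (RtoC (2 * (L + 1) + 2)) with (RtoC (2 * L + 2) + RtoC 1 + RtoC 1)%C
    by (rewrite <- !RtoC_plus; f_equal; ring).
  rewrite (CGamma_succ z hz).
  rewrite (CGamma_succ (RtoC (2 * L + 2) + RtoC 1)), (CGamma_succ (RtoC (2 * L + 2)) hb).
  2: { intros k; rewrite <- (RtoC_plus (2 * L + 2) 1).
       replace (2 * L + 2 + 1) with (2 * L + 3) by ring; apply hb1. }
  rewrite Cmod_mult, hmod, Rpower_plus, Rpower_1 by lra.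
  set (G := CGamma (RtoC (2 * L + 2))) in *; set (M := Cmod (CGamma z)).
  assert (hM : 0 < M) by (apply Cmod_gt_0; exact hGz).
  set (s := sqrt ((L + 1) ^ 2 + eta ^ 2)) in *.
  set (E := exp (- PI * eta / 2)); assert (hE : 0 < E) by apply exp_pos.
  set (P := Rpower 2 L); assert (hP : 0 < P) by (unfold P, Rpower; apply exp_pos).
  split.
  + unfold Cdiv; apply Cmult_neq_0.
    * intros e; apply RtoC_inj in e.
      assert (0 < P * E * M) by (repeat apply Rmult_lt_0_compat; assumption); lra.
    * intros e; apply C1_nz; rewrite <- (Cinv_r G hGb), e; ring.
  + assert (hfk : (L + 1) / s * kappa L eta = s / ((L + 1) * (2 * L + 3))).
    { unfold kappa, slope.
      replace ((1 + (eta / (L + 1)) ^ 2) / (2 * L + 3))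
        with (s * s / ((L + 1) ^ 2 * (2 * L + 3))) by (rewrite hsq; field; lra).
      field; repeat split; lra. }
    rewrite hfk.
    rewrite <- (RtoC_plus (2 * L + 2) 1).
    assert (h2 : RtoC (2 * L + 2) <> RtoC 0) by (intros e; apply RtoC_inj in e; lra).
    assert (h3 : RtoC (2 * L + 2 + 1) <> RtoC 0) by (intros e; apply RtoC_inj in e; lra).
    replace (RtoC (P * 2 * E * (s * M)))
      with (RtoC (s / ((L + 1) * (2 * L + 3))) * RtoC (P * E * M) * (RtoC (2 * L + 2 + 1) * RtoC (2 * L + 2)))%C
      by (rewrite <- !RtoC_mult; f_equal; field; lra).
    field; repeat split; assumption.
Qed.

Lemma nonzero_zero_iff (L eta r : R) :
  - 3 / 2 < L -> (eta <> 0 -> L <> -1) ->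
  nonzero_zero L eta r <-> zero_of_phi L eta r.
Proof.
intros hL hL1; unfold nonzero_zero, zero_of_phi; rewrite coulomb_entire_phi by assumption.
split; intros [h1 h2]; (split; [exact h1|]); [apply RtoC_inj, h2|rewrite h2; reflexivity].
Qed.

(** * The partial fraction expansion *)

Theorem lemma1 (rho eta L : R) (x y : nat -> R)
  (hL : - 3 / 2 < L)
  (hL1 : eta <> 0 -> L <> - 1)
  (hx : enumerates_positive_zeros L eta x)
  (hy : enumerates_negative_zeros L eta y)
  (hrho : ~ nonzero_zero L eta rho) :
  let term (n : nat) : R :=
    rho / (x n * (x n - rho)) + rho / (y n * (y n - rho)) in
  ex_series (fun k : nat => term (S k)) /\
  coulomb_ratio L eta rho
    = RtoC (coulomb_factor L eta * Series (fun k : nat => term (S k))).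
Proof.
intros term.
destruct hx as [x_incr x_zeros], hy as [y_decr y_zeros].
assert (he := slope_relation L eta hL1).
assert (h0 : phi L eta rho <> 0).
{ intros e; apply hrho, nonzero_zero_iff; trivial; split; [|exact e].
  intros ->; unfold phi in e; rewrite PSeries_0, coef_0 in e; lra. }
assert (H : is_series (fun k => term (S k))
              (kappa L eta * rho * phi (L + 1) eta rho / phi L eta rho)).
{ apply (partial_fraction_series L eta hL he x y); trivial; intros r.
  - rewrite <- x_zeros, nonzero_zero_iff by assumption; reflexivity.
  - rewrite <- y_zeros, nonzero_zero_iff by assumption; reflexivity. }
split; [eexists; exact H|].
rewrite (is_series_unique _ _ H).
unfold coulomb_ratio; rewrite !coulomb_entire_phi by (trivial; intros; lra).
destruct (coulomb_C_succ L eta hL hL1) as [hC ->].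
assert (h0C : RtoC (phi L eta rho) <> RtoC 0) by (intros e; apply RtoC_inj in e; exact (h0 e)).
replace (coulomb_factor L eta * (kappa L eta * rho * phi (L + 1) eta rho / phi L eta rho))
  with (coulomb_factor L eta * kappa L eta * (rho * (phi (L + 1) eta rho * / phi L eta rho)))
  by (unfold Rdiv; ring).
rewrite (RtoC_mult _ (rho * _)), (RtoC_mult rho), (RtoC_mult (phi (L + 1) eta rho)), (RtoC_inv _ h0).
field; split; assumption.
Qed.
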